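(* The problem $P_{stab}$ is in $\Pi_4$.
   Context: **SFTs and noise.** Let $\mathcal{A}$ be a finite alphabet, $\Omega_{\mathcal{A}}=\mathcal{A}^{\mathbb{Z}^d}$ with the product topology, Borel $\sigma$-algebra and shifts $\sigma_k(\omega)_l=\omega_{k+l}$ ($k\in\mathbb{Z}^d$). For a finite set $\mathcal{F}$ of forbidden patterns $w\in\mathcal{A}^{I(w)}$ ($I(w)\subset\mathbb{Z}^d$ finite), $\Omega_{\mathcal{F}}$ is the set of $\omega\in\Omega_{\mathcal{A}}$ with $\sigma_k(\omega)|_{I(w)}\neq w$ for all $w\in\mathcal{F}$, $k\in\mathbb{Z}^d$. $\mathcal{M}_{\mathcal{F}}$ is the set of $\sigma$-invariant Borel probability measures supported by $\Omega_{\mathcal{F}}$. Put $\widetilde{\mathcal{A}}=\mathcal{A}\times\{0,1\}$, with coordinate projections $\pi_1,\pi_2$, and $\widetilde{\mathcal{F}}=\{(w,0^{I(w)}):w\in\mathcal{F}\}$, a set of forbidden patterns on $\widetilde{\mathcal{A}}$. For $\epsilon\in[0,1]$, $\widetilde{\mathcal{M}_{\mathcal{F}}^{\mathcal{B}}}(\epsilon)$ is the set of $\lambda\in\mathcal{M}_{\widetilde{\mathcal{F}}}$ whose pushforward $\pi_2^*(\lambda)$ is an i.i.d. Bernoulli measure $\mathcal{B}(\epsilon')^{\otimes\mathbb{Z}^d}$ with $\epsilon'\le\epsilon$, and $\mathcal{M}_{\mathcal{F}}^{\mathcal{B}}(\epsilon)=\pi_1^*\big(\widetilde{\mathcal{M}_{\mathcal{F}}^{\mathcal{B}}}(\epsilon)\big)$.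 **Besicovitch distance.** $d_H(x,y)=\limsup_{n\to\infty}\frac{1}{(2n+1)^d}\#\{k\in\{-n,\dots,n\}^d:x_k\neq y_k\}$ for $x,y\in\Omega_{\mathcal{A}}$. For $\sigma$-invariant measures, $d_B(\mu,\nu)=\inf_{\lambda}\int d_H(x,y)\,d\lambda(x,y)$, the infimum being over $\sigma$-invariant couplings $\lambda$ of $\mu$ and $\nu$ on $\Omega_{\mathcal{A}\times\mathcal{A}}$. $d_B(\mu,V)=\inf_{\nu\in V}d_B(\mu,\nu)$ for a set $V$. **Stability.** A nonempty $\Omega_{\mathcal{F}}$ is stable if there is a non-decreasing $f:[0,1]\to[0,\infty)$, continuous at $0$ with $f(0)=0$, such that $\sup_{\mu\in\mathcal{M}_{\mathcal{F}}^{\mathcal{B}}(\epsilon)}d_B(\mu,\mathcal{M}_{\mathcal{F}})\le f(\epsilon)$ for all $\epsilon\in[0,1]$. $P_{stab}$ is the set of (encodings as integers of) finite families $\mathcal{F}$ of forbidden patterns (the dimension $d$ and alphabet $\mathcal{A}$ being part of the encoding) such that $\Omega_{\mathcal{F}}\neq\emptyset$ and $\Omega_{\mathcal{F}}$ is stable. **Arithmetical hierarchy.** $P\subset\mathbb{N}$ is in $\Pi_k$ if there is a decidable predicate $\phi$ on $\mathbb{N}^{k+1}$ with $x\in P\iff\forall n_1\exists n_2\forall n_3\dots\phi(x,n_1,\dots,n_k)$ ($k$ alternating quantifiers over $\mathbb{N}$, starting with $\forall$). *)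

(* Defs.v *)
From HB Require Import structures.
From mathcomp Require Import all_boot all_order all_algebra.
From mathcomp Require Import all_classical all_reals all_analysis.

Set Implicit Arguments.
Unset Strict Implicit.
Unset Printing Implicit Defensive.

Import Order.TTheory GRing.Theory Num.Theory.
Import numFieldNormedType.Exports.

(* The total recursive functions, as the least class containing the basic
   functions and closed under composition, primitive recursion and regular
   minimization (minimization of a function having a zero on every section).
   In [recursive_prim] and [recursive_mu] the distinguished argument is the
   head of the tuple. *)
Inductive recursive : forall n : nat, (n.-tuple nat -> nat) -> Prop :=
| recursive_zero n : recursive (fun _ : n.-tuple nat => 0)
| recursive_succ : recursive (fun v : 1.-tuple nat => (thead v).+1)
| recursive_proj n (i : 'I_n) : recursive (fun v : n.-tuple nat => tnth v i)
| recursive_comp m n (f : m.-tuple nat -> nat)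
    (g : 'I_m -> n.-tuple nat -> nat) :
    recursive f -> (forall i, recursive (g i)) ->
    recursive (fun v => f [tuple g i v | i < m])
| recursive_prim n (f : n.-tuple nat -> nat) (g : n.+2.-tuple nat -> nat)
    (h : n.+1.-tuple nat -> nat) :
    recursive f -> recursive g ->
    (forall v, h (cons_tuple 0 v) = f v) ->
    (forall a v, h (cons_tuple a.+1 v) =
       g (cons_tuple a (cons_tuple (h (cons_tuple a v)) v))) ->
    recursive h
| recursive_mu n (g : n.+1.-tuple nat -> nat) (h : n.-tuple nat -> nat) :
    recursive g ->
    (forall v, g (cons_tuple (h v) v) = 0) ->
    (forall v a, a < h v -> g (cons_tuple a v) <> 0) ->
    recursive h.

Definition decidable_pred n (phi : n.-tuple nat -> bool) : Prop :=
  recursive (fun v => nat_of_bool (phi v)).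

(* k alternating quantifiers over nat, the outermost one being universal iff
   [b] holds; the outermost variable is the head of the tuple. *)
Fixpoint alternating_quantifiers (b : bool) (k : nat) :
    (k.-tuple nat -> Prop) -> Prop :=
  match k with
  | 0 => fun phi => phi [tuple]
  | k'.+1 => fun phi =>
      if b then
        forall m, alternating_quantifiers (~~ b) (fun v => phi (cons_tuple m v))
      else
        exists m, alternating_quantifiers (~~ b) (fun v => phi (cons_tuple m v))
  end.

Definition in_Pi (k : nat) (P : set nat) : Prop :=
  exists phi : k.+1.-tuple nat -> bool, decidable_pred phi /\
    forall x, P x <->
      alternating_quantifiers true (fun v => phi (cons_tuple x v)).

(* Nonempty finite alphabets: library measurable spaces are inhabited, and over
   the empty alphabet there is no configuration at all. *)
#[short(type="alphabetType")]
HB.structure Definition Alphabet := {A of Finite A & Pointed A}.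
HB.saturate bool.
HB.saturate prod.
HB.instance Definition _ n := isPointed.Build 'I_n.+1 ord0.

Local Open Scope classical_set_scope.
Local Open Scope ring_scope.

Definition site (d : nat) := 'rV[int]_d.

Definition config (d : nat) (A : alphabetType) :=
  prod_topology (fun _ : site d => discrete_topology A).
HB.instance Definition _ (d : nat) (A : alphabetType) :=
  Topological.on (config d A).
HB.instance Definition _ (d : nat) (A : alphabetType) :=
  isPointed.Build (config d A) (fun _ => point).

Definition borel (T : ptopologicalType) := g_sigma_algebraType (@open T).

Definition shift_config d (A : alphabetType) (k : site d) (x : config d A) :
  config d A := fun l => x (k + l).

(* A pattern w is given by its graph, the list of the pairs (l, w_l) for l in
   I(w). *)
Definition pattern (d : nat) (A : alphabetType) :=
  {w : seq (site d * A) | uniq (unzip1 w)}.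

Definition occurs d (A : alphabetType) (w : pattern d A) (x : config d A) :=
  forall c : site d * A, c \in val w -> x c.1 = c.2.

Definition SFT d (A : alphabetType) (F : seq (pattern d A)) :
    set (config d A) :=
  [set x | forall w : pattern d A, w \in F ->
     forall k : site d, ~ occurs w (shift_config k x)].

Section Measures.
Variable R : realType.

Definition shift_invariant d (A : alphabetType)
    (mu : probability (borel (config d A)) R) :=
  forall (k : site d) (B : set (borel (config d A))),
    measurable B -> mu (shift_config k @^-1` B) = mu B.

(* As [SFT F] is closed, being supported by it means giving it full mass. *)
Definition invariant_measures d (A : alphabetType) (F : seq (pattern d A)) :
    set (probability (borel (config d A)) R) :=
  [set mu | shift_invariant mu /\ mu (SFT F) = 1%E].

Definition has_image d (A B : alphabetType)
    (lambda : probability (borel (config d A)) R)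
    (f : borel (config d A) -> borel (config d B))
    (mu : probability (borel (config d B)) R) :=
  forall U, measurable U -> pushforward lambda f U = mu U.

Definition proj1c d (A B : alphabetType) (z : config d (A * B)%type) :
  config d A := fun k => (z k).1.

Definition proj2c d (A B : alphabetType) (z : config d (A * B)%type) :
  config d B := fun k => (z k).2.

Lemma noiseless_subproof d (A : alphabetType) (w : pattern d A) :
  uniq (unzip1 [seq (c.1, (c.2, false)) | c <- val w]).
Proof. by rewrite /unzip1 -map_comp; apply: (valP w). Qed.

Definition noiseless d (A : alphabetType) (w : pattern d A) :
  pattern d (A * bool)%type :=
  exist (fun u : seq (site d * (A * bool)) => uniq (unzip1 u)) _
    (noiseless_subproof w).

(* The coordinates are i.i.d. with Bernoulli law of parameter [p]; this
   determines the law on all Borel sets. *)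
Definition iid_bernoulli d (p : R)
    (nu : set (borel (config d bool)) -> \bar R) :=
  forall (s : seq (site d)) (B : site d -> set bool), uniq s ->
    nu [set y | forall k, k \in s -> B k (y k)] =
    (\prod_(k <- s) bernoulli_prob p (B k))%E.

Definition noisy_measures d (A : alphabetType) (F : seq (pattern d A))
    (eps : R) : set (probability (borel (config d (A * bool)%type)) R) :=
  [set lambda | invariant_measures [seq noiseless w | w <- F] lambda /\
    exists2 p : R, 0 <= p <= eps &
      iid_bernoulli p (pushforward lambda
        (@proj2c d A bool :
           borel (config d (A * bool)%type) -> borel (config d bool)))].

Definition noisy_marginals d (A : alphabetType) (F : seq (pattern d A))
    (eps : R) : set (probability (borel (config d A)) R) :=
  [set mu | exists2 lambda, noisy_measures F eps lambda &
    has_image lambda (@proj1c d A bool) mu].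

Definition box_site d n (j : 'rV['I_(n.*2.+1)]_d) : site d :=
  \row_i ((j ord0 i)%:Z - n%:Z).

Definition hamming d (A : alphabetType) (x y : config d A) : \bar R :=
  limn_esup (fun n =>
    (#|[pred j : 'rV['I_(n.*2.+1)]_d |
         x (box_site j) != y (box_site j) :> A]|%:R
     / (n.*2.+1 ^ d)%:R)%:E).

Definition coupling d (A : alphabetType)
    (mu nu : probability (borel (config d A)) R) :
    set (probability (borel (config d (A * A)%type)) R) :=
  [set lambda | [/\ shift_invariant lambda,
    has_image lambda (@proj1c d A A) mu &
    has_image lambda (@proj2c d A A) nu]].

Definition besicovitch d (A : alphabetType)
    (mu nu : probability (borel (config d A)) R) : \bar R :=
  ereal_inf [set (\int[lambda]_z hamming (proj1c z) (proj2c z))%E |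
    lambda in coupling mu nu].

Definition besicovitch_set d (A : alphabetType)
    (mu : probability (borel (config d A)) R)
    (V : set (probability (borel (config d A)) R)) : \bar R :=
  ereal_inf [set besicovitch mu nu | nu in V].

Definition stable d (A : alphabetType) (F : seq (pattern d A)) : Prop :=
  exists f : R -> R,
    [/\ {in `[0, 1] &, {homo f : x y / x <= y}},
        (forall x : R, 0 <= x <= 1 -> 0 <= f x),
        f 0 = 0,
        f x @[x --> within `[0, 1] (nbhs (0 : R))] --> f 0 &
        forall eps : R, 0 <= eps <= 1 ->
          (ereal_sup [set besicovitch_set mu (invariant_measures F) |
             mu in noisy_marginals F eps] <= (f eps)%:E)%E].

Definition int_code (z : int) : nat :=
  match z with Posz n => n.*2 | Negz n => n.*2.+1 end.

Definition pattern_code d q (w : pattern d 'I_q.+1) : nat :=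
  CodeSeq.code
    [seq CodeSeq.code
       (nat_of_ord c.2 :: [seq int_code (c.1 ord0 i) | i <- enum 'I_d])
    | c : site d * 'I_q.+1 <- val w].

(* The code of a family over the alphabet {0, ..., q} on Z^d; [CodeSeq.code] is
   the library's bijection from finite sequences of integers to integers. *)
Definition family_code d q (F : seq (pattern d 'I_q.+1)) : nat :=
  CodeSeq.code [:: d; q.+1; CodeSeq.code [seq pattern_code w | w <- F]].

Definition Pstab : set nat :=
  [set n | exists d q (F : seq (pattern d 'I_q.+1)),
    [/\ (0 < d)%N, n = family_code F, SFT F !=set0 & stable F]].

End Measures.

(* Main.v *)
Require Import Defs.
From HB Require Import structures.
From mathcomp Require Import all_boot all_order all_algebra.
From mathcomp Require Import all_classical all_reals all_analysis.
From mathcomp Require Import measurable_realfun zify ring lra.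

(** Two observations bring stability into the shape forall exists forall
    exists.

    The first one removes the Besicovitch distance. For an invariant coupling
    xi of two measures, the integral of d_H and the rate r = xi(x_0 <> y_0)
    control each other. The density of mismatches in a box has expectation r,
    so the reverse Fatou lemma gives that r is at most the integral of d_H
    ([rate_le_integral]). Conversely, the covering argument of the maximal
    ergodic theorem bounds by 4^d r / t the probability that the density
    exceeds t in some box around the origin ([vitali], [maximal_inequality]),
    whence the integral of d_H is at most t + 4^d r / t
    ([integral_hamming_le]). Stability with an unspecified modulus therefore
    means: for every j there is e such that every noisy measure of level
    1/(e+1) has a coupling of its first marginal with an invariant measure on
    the subshift, of rate at most 1/(j+1) ([couplable]). The modulus is defined
    on all of [0,1] and finite, which is the additional requirement that e = 0
    be a correct choice for j = 0. This case also forces the subshift to be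
    nonempty: the Dirac measure at a configuration in which every site is noisy
    is a noisy measure of level 1, as soon as no forbidden pattern is empty.
    See [couplable_of_stable], [stable_of_couplable] and [SFT_nonempty].

    The second one is that [couplable] is of the form forall exists. It says
    that a compact set of measures K is contained in the projection L of a
    compact set of pairs, and both sets are defined by countably many explicit
    conditions on the masses of cylinders: invariance is a family of equalities
    between such masses, being supported by the subshift is the vanishing of
    the mass of every forbidden pattern ([SFT_full]), and noise is i.i.d. as
    soon as the event of having a 1 at one more site is independent of the
    noise at finitely many other sites ([iid_of_noise]). By compactness, K is
    contained in L if and only if for every n, finitely many of the conditions
    defining K, up to a small error, imply the first n conditions defining L,
    up to an error 1/n. Measures may here be replaced by empirical measures of
    finite samples of finite patterns: every measure is approximated by such
    samples ([sampling]), and conversely frequencies along a sequence of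
    samples converge, along an ultrafilter on the integers, to the masses of
    cylinders for some measure ([limit_probability]), because a finitely
    additive function on the algebra of cylinders extends to a measure
    ([probability_extension]). The resulting condition [certificate] only
    counts in finite lists; the two implications are [couplable_of_certificate]
    and [certificate_of_couplable].

    The condition is recursive ([stability_predicate_decidable]). To see this
    without writing programs, types built from numbers by pairs and lists are
    identified with the set of numbers by bijections, the functions between
    such types that become recursive are shown to be closed under list
    recursion and bounded iteration, and the definition of the condition is
    followed step by step. *)

Set Implicit Arguments.
Unset Strict Implicit.
Unset Printing Implicit Defensive.

(** * Recursive functions of small arity *)

Lemma recursive_ext n (f g : n.-tuple nat -> nat) :
  recursive f -> f =1 g -> recursive g.
Proof. by move=> rf /funext <-. Qed.

Lemma recursive_nth n i : recursive (fun v : n.-tuple nat => nth 0 v i).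
Proof.
have [ltin|leni] := ltnP i n.
  apply: (recursive_ext (recursive_proj (Ordinal ltin))) => v.
  by rewrite (tnth_nth 0).
apply: (recursive_ext (recursive_zero n)) => v.
by rewrite nth_default ?size_tuple.
Qed.

Definition rec1 (f : nat -> nat) :=
  recursive (fun v : 1.-tuple nat => f (nth 0 v 0)).
Definition rec2 (f : nat -> nat -> nat) :=
  recursive (fun v : 2.-tuple nat => f (nth 0 v 0) (nth 0 v 1)).
Definition rec3 (f : nat -> nat -> nat -> nat) :=
  recursive (fun v : 3.-tuple nat => f (nth 0 v 0) (nth 0 v 1) (nth 0 v 2)).

Section Application.
Variable n : nat.
Implicit Types g : n.-tuple nat -> nat.

Lemma rec1_app f g : rec1 f -> recursive g -> recursive (fun v => f (g v)).
Proof.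
move=> rf rg.
apply: (recursive_ext (recursive_comp rf (g := fun=> g) (fun=> rg))) => v.
by rewrite -(tnth_nth 0 _ ord0) tnth_mktuple.
Qed.

Lemma rec2_app f g1 g2 : rec2 f -> recursive g1 -> recursive g2 ->
  recursive (fun v => f (g1 v) (g2 v)).
Proof.
move=> rf rg1 rg2; pose g (i : 'I_2) := nth g1 [:: g1; g2] i.
have rg i : recursive (g i) by case: i => -[|[]].
apply: (recursive_ext (recursive_comp rf rg)) => v.
by rewrite -(tnth_nth 0 _ ord0) -(tnth_nth 0 _ (lift ord0 ord0)) !tnth_mktuple.
Qed.

Lemma rec3_app f g1 g2 g3 :
  rec3 f -> recursive g1 -> recursive g2 -> recursive g3 ->
  recursive (fun v => f (g1 v) (g2 v) (g3 v)).
Proof.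
move=> rf rg1 rg2 rg3; pose g (i : 'I_3) := nth g1 [:: g1; g2; g3] i.
have rg i : recursive (g i) by case: i => -[|[|[]]].
apply: (recursive_ext (recursive_comp rf rg)) => v.
by rewrite -(tnth_nth 0 _ ord0) -(tnth_nth 0 _ (lift ord0 ord0))
  -(tnth_nth 0 _ (lift ord0 (lift ord0 ord0))) !tnth_mktuple.
Qed.

End Application.

Lemma rec2_natrec f g h : rec1 f -> rec3 g ->
  (forall y, h 0 y = f y) -> (forall a y, h a.+1 y = g a (h a y) y) -> rec2 h.
Proof.
by move=> rf rg h0 hS; apply: (recursive_prim rf rg) => [v|a v] /=.
Qed.

Lemma rec1_id : rec1 id. Proof. exact: recursive_nth. Qed.

Lemma rec1_S : rec1 S.
Proof.
apply: (recursive_ext recursive_succ) => v.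
by rewrite /thead (tnth_nth 0).
Qed.

Lemma recursive_const n c : recursive (fun _ : n.-tuple nat => c).
Proof.
by elim: c => [|c IHc]; [apply: recursive_zero | apply: (rec1_app rec1_S IHc)].
Qed.

(** The recursion scheme at hand has a parameter, which is a dummy here. *)
Lemma rec1_natrec c g h : rec2 g ->
  h 0 = c -> (forall a, h a.+1 = g a (h a)) -> rec1 h.
Proof.
move=> rg h0 hS.
have rh : rec2 (fun a _ => h a).
  apply: (@rec2_natrec (fun=> c) (fun a b _ => g a b)) => //.
    exact: recursive_const.
  by apply: (rec2_app rg); apply: recursive_nth.
by apply: (rec2_app rh (recursive_nth _ 0) (recursive_nth _ 0)).
Qed.

Ltac rec_nth := by apply: recursive_nth.

Lemma rec2_addn : rec2 addn.
Proof.
apply: (@rec2_natrec id (fun _ b _ => b.+1)) => //; first exact: rec1_id.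
by apply: (rec1_app rec1_S); rec_nth.
Qed.

Lemma rec2_muln : rec2 muln.
Proof.
apply: (@rec2_natrec (fun=> 0) (fun _ b y => y + b)) => [||y|a y].
- exact: recursive_const.
- by apply: (rec2_app rec2_addn); rec_nth.
- by rewrite mul0n.
- by rewrite mulSn.
Qed.

Lemma rec1_pred : rec1 predn.
Proof.
by apply: (@rec1_natrec 0 (fun a _ => a)) => //; rec_nth.
Qed.

Lemma rec2_subn : rec2 subn.
Proof.
have r : rec2 (fun a b => b - a).
  apply: (@rec2_natrec id (fun _ b _ => b.-1)) => [||y|a y].
  - exact: rec1_id.
  - by apply: (rec1_app rec1_pred); rec_nth.
  - by rewrite subn0.
  - by rewrite subnS.
by apply: (rec2_app r); rec_nth.
Qed.

Lemma rec1_eq0 : rec1 (fun n => n == 0).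
Proof.
apply: (@rec1_natrec 1 (fun _ _ => 0)) => //; exact: recursive_const.
Qed.

(** A case distinction is a sum with two complementary factors 0 and 1. *)
Lemma rec3_if : rec3 (fun b x y => if b is 0 then y else x).
Proof.
have r : rec3 (fun b x y => (1 - (b == 0)) * x + (b == 0) * y).
  apply: (rec2_app rec2_addn); apply: (rec2_app rec2_muln);
    try rec_nth; last by apply: (rec1_app rec1_eq0); rec_nth.
  apply: (rec2_app rec2_subn); first exact: recursive_const.
  by apply: (rec1_app rec1_eq0); rec_nth.
apply: (recursive_ext r) => v.
by case: (nth 0 v 0) => [|n] /=; rewrite ?mul0n ?mul1n ?addn0.
Qed.

Lemma rec1_odd : rec1 odd.
Proof.
apply: (@rec1_natrec 0 (fun _ b => b == 0)) => [|//|a].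
  by apply: (rec1_app rec1_eq0); rec_nth.
by rewrite oddS; case: (odd a).
Qed.

Lemma rec1_half : rec1 half.
Proof.
apply: (@rec1_natrec 0 (fun a b => b + odd a)) => [|//|a].
  apply: (rec2_app rec2_addn); first rec_nth.
  by apply: (rec1_app rec1_odd); rec_nth.
by rewrite -[a.+1./2]/(uphalf a) uphalf_half addnC.
Qed.

Lemma rec1_exp2 : rec1 (expn 2).
Proof.
apply: (@rec1_natrec 1 (fun _ b => b + b)) => [|//|a].
  by apply: (rec2_app rec2_addn); rec_nth.
by rewrite expnS mul2n addnn.
Qed.

(** * Lists as numbers *)

(** This is the code of a list with head a whose tail has code c ([code_cons]).
    Every positive number is of this form in exactly one way, so that lists of
    numbers correspond bijectively to numbers, [::] having code 0. *)
Definition consn a c := 2 ^ a * c.*2.+1.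

Lemma rec2_consn : rec2 consn.
Proof.
apply: (rec2_app rec2_muln); first by apply: (rec1_app rec1_exp2); rec_nth.
apply: (rec1_app rec1_S).
apply: (recursive_ext (f := fun v => nth 0 v 1 + nth 0 v 1)).
  by apply: (rec2_app rec2_addn); rec_nth.
by move=> v; rewrite addnn.
Qed.

(** As a <= 2 ^ a, a positive number is made odd by at most as many halvings as
    its own value; this bounds the number of iterations in [headn] and [tailn],
    which makes them primitive recursive. *)
Definition strip i c := iter i (fun c => if odd c then c else c./2) c.
Definition headn c := \sum_(i < c) ~~ odd (strip i c).
Definition tailn c := (strip c c)./2.

Lemma consn_gt0 a c : 0 < consn a c.
Proof. by rewrite /consn muln_gt0 expn_gt0. Qed.

Lemma leq_consn a c : a <= consn a c.
Proof. by exact: (leq_trans (ltnW (ltn_expl a (isT : 1 < 2))) (leq_pmulr (2 ^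
  a) (isT : 0 < c.*2.+1))). Qed.

Lemma strip_consn i a c : strip i (consn a c) = 2 ^ (a - i) * c.*2.+1.
Proof.
elim: i => [|i IHi]; first by rewrite subn0.
rewrite /strip iterS -/(strip _ _) IHi subnS.
case: (a - i) => [|k]; first by rewrite expn0 mul1n oddS odd_double.
by rewrite expnS -mulnA mul2n odd_double doubleK.
Qed.

Lemma headn_consn a c : headn (consn a c) = a.
Proof.
rewrite /headn.
have odd1 : odd c.*2.+1 = true by rewrite oddS odd_double.
under eq_bigr => i _ do
  rewrite strip_consn oddM oddX odd1 andbT orbF subn_eq0 -ltnNge.
have lea := leq_consn a c.
rewrite -(big_mkord xpredT (fun i => nat_of_bool (i < a))) (big_cat_nat (leq0n
  a) lea) /=.
rewrite [X in _ + X]big1_seq ?addn0; last first.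
  by move=> i; rewrite mem_index_iota /= => /andP[lai _]; rewrite ltnNge lai.
rewrite big_nat (eq_bigr (fun=> 1)); last by move=> i /= ->.
by rewrite -big_nat sum_nat_const_nat muln1 subn0.
Qed.

Lemma tailn_consn a c : tailn (consn a c) = c.
Proof.
rewrite /tailn strip_consn.
have /eqP -> : a - consn a c == 0.
  by rewrite subn_eq0 leq_consn.
by rewrite mul1n -[X in X./2]/(true + c.*2) half_bit_double.
Qed.

Lemma rec2_strip : rec2 strip.
Proof.
apply: (@rec2_natrec id (fun _ b _ => if nat_of_bool (odd b) is 0 then b./2 else b)).
- exact: rec1_id.
- apply: (rec3_app rec3_if (g1 := fun v => odd (nth 0 v 1))
    (g2 := fun v => nth 0 v 1) (g3 := fun v => (nth 0 v 1)./2)).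
  + by apply: (rec1_app rec1_odd); rec_nth.
  + rec_nth.
  + by apply: (rec1_app rec1_half); rec_nth.
- by [].
- by move=> a y; rewrite /strip iterS -/(strip a y); case: (odd _).
Qed.

Lemma rec1_tailn : rec1 tailn.
Proof.
by apply: (rec1_app rec1_half); apply: (rec2_app rec2_strip); rec_nth.
Qed.

Lemma rec1_headn : rec1 headn.
Proof.
have r : rec2 (fun k c => \sum_(i < k) ~~ odd (strip i c)).
  apply: (@rec2_natrec (fun=> 0) (fun a b c => b + (nat_of_bool (odd (strip a
    c)) == 0))) => [||y|a y].
  - exact: recursive_const.
  - apply: (rec2_app rec2_addn); first rec_nth.
    apply: (rec1_app rec1_eq0); apply: (rec1_app rec1_odd).
    by apply: (rec2_app rec2_strip); rec_nth.
  - by rewrite big_ord0.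
  - by rewrite big_ord_recr /=; case: (odd _).
by apply: (rec2_app r); rec_nth.
Qed.

Lemma code_cons a s : CodeSeq.code (a :: s) = consn a (CodeSeq.code s).
Proof. by []. Qed.

Lemma decode_gt0 n : 0 < n ->
  CodeSeq.decode n = headn n :: CodeSeq.decode (tailn n).
Proof.
move=> n_gt0; case E: (CodeSeq.decode n) => [|a s].
  by have := CodeSeq.decodeK n; rewrite E => n0; rewrite -n0 in n_gt0.
have <- := CodeSeq.decodeK n.
by rewrite E code_cons headn_consn tailn_consn CodeSeq.codeK.
Qed.

Lemma consnK n : 0 < n -> consn (headn n) (tailn n) = n.
Proof.
move=> n_gt0; rewrite -[RHS]CodeSeq.decodeK (decode_gt0 n_gt0) code_cons.
by rewrite CodeSeq.decodeK.
Qed.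

(** * Computable functions between encoded types *)

(** The correspondence with numbers is required to be bijective, and not only
    injective: a function between encoded types then is a function on numbers
    without any condition on invalid codes. *)
Structure encType := EncType {
  enc_sort :> Type;
  enc : enc_sort -> nat;
  dec : nat -> enc_sort;
  encK : cancel enc dec;
  decK : cancel dec enc }.

Arguments enc {_} _.
Arguments dec {_} _.

Canonical nat_encType := @EncType nat id id (fun=> erefl) (fun=> erefl).

Section PairEnc.
Variables T U : encType.
(** The predecessor turns the bijection of pairs with positive numbers into a
    bijection with all numbers. *)
Definition enc_pair (p : T * U) := (consn (enc p.1) (enc p.2)).-1.
Definition dec_pair n : T * U := (dec (headn n.+1), dec (tailn n.+1)).
Lemma enc_pairK : cancel enc_pair dec_pair.
Proof.
case=> x y; rewrite /enc_pair /dec_pair prednK ?consn_gt0 //=.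
by rewrite headn_consn tailn_consn !encK.
Qed.
Lemma dec_pairK : cancel dec_pair enc_pair.
Proof. by move=> n; rewrite /enc_pair /= !decK consnK. Qed.
Canonical pair_encType := EncType enc_pairK dec_pairK.
End PairEnc.

Section SeqEnc.
Variable T : encType.
Definition enc_seq (s : seq T) := CodeSeq.code (map enc s).
Definition dec_seq n : seq T := map dec (CodeSeq.decode n).
Lemma enc_seqK : cancel enc_seq dec_seq.
Proof. by move=> s; rewrite /enc_seq /dec_seq CodeSeq.codeK (mapK (@encK T)). Qed.
Lemma dec_seqK : cancel dec_seq enc_seq.
Proof.
by move=> n; rewrite /enc_seq /dec_seq (mapK (@decK T)) CodeSeq.decodeK.
Qed.
Canonical seq_encType := EncType enc_seqK dec_seqK.
End SeqEnc.

Definition computable (T U : encType) (f : T -> U) :=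
  rec1 (fun n => enc (f (dec n))).

Definition computableb (T : encType) (P : T -> bool) :=
  computable (fun x => nat_of_bool (P x)).

Section Computable.
Variables T U V W : encType.

Lemma comp_id : computable (fun x : T => x).
Proof.
by apply: (recursive_ext rec1_id) => v; rewrite decK.
Qed.

Lemma comp_ext (f g : T -> U) : computable f -> f =1 g -> computable g.
Proof. by move=> cf /boolp.funext <-. Qed.

Lemma comp_const (c : U) : computable (fun _ : T => c).
Proof. exact: recursive_const. Qed.

Lemma comp_comp (g : U -> V) (f : T -> U) :
  computable g -> computable f -> computable (fun x => g (f x)).
Proof.
move=> cg cf; apply: (recursive_ext (rec1_app cg cf)) => v.
by rewrite encK.
Qed.

Lemma comp_pair (f : T -> U) (g : T -> V) :
  computable f -> computable g -> computable (fun x => (f x, g x)).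
Proof.
by move=> cf cg; apply: (rec1_app rec1_pred); apply: (rec2_app rec2_consn).
Qed.

Lemma comp_fst (f : T -> U * V) : computable f -> computable (fun x => (f x).1).
Proof.
move=> cf.
have r : rec1 (fun n => headn n.+1).
  by apply: (rec1_app rec1_headn); apply: rec1_S.
apply: (recursive_ext (rec1_app r cf)) => v.
by rewrite /= /enc_pair prednK ?consn_gt0 // headn_consn.
Qed.

Lemma comp_snd (f : T -> U * V) : computable f -> computable (fun x => (f x).2).
Proof.
move=> cf.
have r : rec1 (fun n => tailn n.+1).
  by apply: (rec1_app rec1_tailn); apply: rec1_S.
apply: (recursive_ext (rec1_app r cf)) => v.
by rewrite /= /enc_pair prednK ?consn_gt0 // tailn_consn.
Qed.

Lemma comp_if (P : T -> bool) (f g : T -> U) :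
  computableb P -> computable f -> computable g ->
  computable (fun x => if P x then f x else g x).
Proof.
move=> cP cf cg; apply: (recursive_ext (rec3_app rec3_if cP cf cg)) => v.
by case: (P _).
Qed.

Lemma comp_dec (f : T -> nat) : computable f -> computable (fun x => dec (f x) : U).
Proof. by move=> cf; apply: (recursive_ext cf) => v; rewrite decK. Qed.

Lemma comp_enc (f : T -> U) : computable f -> computable (fun x => enc (f x)).
Proof. by []. Qed.

(** Iteration of a function on an encoded type is primitive recursion on the
    codes of its values; all other recursion schemes are reduced to it. *)
Lemma comp_iteri (k : T -> nat) (g : T -> nat -> U -> U) (f : T -> U) :
  computable k -> computable (fun p : T * nat * U => g p.1.1 p.1.2 p.2) ->
  computable f -> computable (fun x => iteri (k x) (g x) (f x)).
Proof.
move=> ck cg cf.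
have r : rec2 (fun a y => enc (iteri a (g (dec y)) (f (dec y)))).
  apply: (@rec2_natrec (fun y => enc (f (dec y)))
    (fun a b y => enc (g (dec y) a (dec b)))) => //=; last first.
    by move=> a y; rewrite encK.
  have cp : recursive (fun v : 3.-tuple nat =>
      (consn (consn (nth 0 v 2) (nth 0 v 0)).-1 (nth 0 v 1)).-1).
    apply: (rec1_app rec1_pred); apply: (rec2_app rec2_consn); last rec_nth.
    by apply: (rec1_app rec1_pred); apply: (rec2_app rec2_consn); rec_nth.
  apply: (recursive_ext (rec1_app cg cp)) => v /=.
  by rewrite /dec_pair !prednK ?consn_gt0 ?headn_consn ?tailn_consn //= /dec_pair
     prednK ?consn_gt0 ?headn_consn ?tailn_consn.
exact: (rec2_app r ck rec1_id).
Qed.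

End Computable.

Section Arith.
Variable T : encType.
Implicit Types (f g : T -> nat) (P Q : T -> bool).

Lemma comp_S f : computable f -> computable (fun x => (f x).+1).
Proof. exact: (rec1_app rec1_S). Qed.
Lemma comp_addn f g : computable f -> computable g -> computable (fun x => f x + g x).
Proof. exact: (rec2_app rec2_addn). Qed.
Lemma comp_muln f g : computable f -> computable g -> computable (fun x => f x * g x).
Proof. exact: (rec2_app rec2_muln). Qed.
Lemma comp_subn f g : computable f -> computable g -> computable (fun x => f x - g x).
Proof. exact: (rec2_app rec2_subn). Qed.
Lemma comp_odd f : computable f -> computableb (fun x => odd (f x)).
Proof. exact: (rec1_app rec1_odd). Qed.
Lemma comp_leq f g : computable f -> computable g -> computableb (fun x => f x
  <= g x).
Proof.
by move=> cf cg; apply: (rec1_app rec1_eq0); apply: comp_subn.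
Qed.
Lemma comp_b P : computableb P -> computable (fun x => nat_of_bool (P x)).
Proof. by []. Qed.
Lemma comp_true : computableb (fun _ : T => true).
Proof. exact: comp_const. Qed.
Lemma comp_ifb P Q Q' : computableb P -> computableb Q -> computableb Q' ->
  computableb (fun x => if P x then Q x else Q' x).
Proof.
move=> cP cQ cQ'; apply: (recursive_ext (comp_if cP (comp_b cQ) (comp_b cQ')))
  => v /=.
by case: (P _).
Qed.
Lemma comp_andb P Q : computableb P -> computableb Q -> computableb (fun x => P
  x && Q x).
Proof. by move=> cP cQ; apply: comp_ifb => //; apply: comp_const. Qed.
Lemma comp_orb P Q : computableb P -> computableb Q -> computableb (fun x => P
  x || Q x).
Proof. by move=> cP cQ; apply: comp_ifb => //; apply: comp_true. Qed.
Lemma comp_negb P : computableb P -> computableb (fun x => ~~ P x).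
Proof. by move=> cP; apply: comp_ifb => //; apply: comp_const. Qed.
Lemma comp_implyb P Q : computableb P -> computableb Q -> computableb (fun x =>
  P x ==> Q x).
Proof. by move=> cP cQ; apply: comp_ifb => //; apply: comp_true. Qed.
Lemma comp_eqn f g : computable f -> computable g -> computableb (fun x => f x
  == g x).
Proof.
move=> cf cg; under [fun x => f x == g x]boolp.funext => x do rewrite eqn_leq.
by apply: comp_andb; apply: comp_leq.
Qed.
End Arith.

Section Lists.
Variables T X : encType.

Lemma comp_cons (f : T -> X) (s : T -> seq X) :
  computable f -> computable s -> computable (fun x => f x :: s x).
Proof. exact: (rec2_app rec2_consn). Qed.

Lemma comp_nilp (s : T -> seq X) : computable s -> computableb (fun x => nilp (s x)).
Proof.
move=> cs; apply: (recursive_ext (rec1_app rec1_eq0 cs)) => v /=.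
by case: (s _) => //= a l; rewrite /enc_seq /= -/(consn _ _) eqn0Ngt consn_gt0.
Qed.

Lemma comp_behead (s : T -> seq X) : computable s -> computable (fun x =>
  behead (s x)).
Proof.
move=> cs; apply: (recursive_ext (rec1_app rec1_tailn cs)) => v /=.
by case: (s _) => //= a l; rewrite /enc_seq /= -/(consn _ _) tailn_consn.
Qed.

Lemma comp_head a (s : T -> seq X) : computable s -> computable (fun x => head
  a (s x)).
Proof.
move=> cs.
have -> : (fun x => head a (s x)) = fun x =>
    if nilp (s x) then a else dec (headn (enc (s x))).
  apply: boolp.funext => x; case: (s x) => //= b l.
  by rewrite /enc_seq /= -/(consn _ _) headn_consn encK.
apply: comp_if; [exact: comp_nilp | exact: comp_const |].
by apply: comp_dec; apply: (rec1_app rec1_headn).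
Qed.

(** The code of a list bounds the number of steps of a recursion over the
    list. *)
Lemma leq_size_enc (s : seq X) : size s <= enc s.
Proof.
elim: s => //= a s IHs; rewrite /enc_seq /= -[_.+1]mul1n leq_mul ?expn_gt0 //.
by rewrite ltnS (leq_trans IHs) // -addnn leq_addr.
Qed.

End Lists.

(** The state of the iteration consists of the remaining list and of the
    accumulator, and no longer changes once the list is empty; so it may be
    iterated more often than needed, and the code of the list is a sufficient
    number of times. *)
Lemma comp_foldl (T X U : encType) (g : T -> U -> X -> U) (b : T -> U) (s : T
  -> seq X) :
  computable (fun p : T * U * X => g p.1.1 p.1.2 p.2) ->
  computable b -> computable s ->
  computable (fun x => foldl (g x) (b x) (s x)).
Proof.
move=> cg cb cs.
pose step x (_ : nat) (q : seq X * U) : seq X * U :=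
  if nilp q.1 then q else (behead q.1, g x q.2 (head (dec 0) q.1)).
have stepE x k s0 b0 : size s0 <= k ->
    (iteri k (step x) (s0, b0)).2 = foldl (g x) b0 s0.
  have iteriS k' q : iteri k'.+1 (step x) q = iteri k' (step x) (step x 0 q).
    by elim: k' => //= k' ->.
  elim: k s0 b0 => [|k IHk] [|a s0] b0 // les; rewrite iteriS IHk //=.
have E y : (iteri (enc (s y)) (step y) (s y, b y)).2 = foldl (g y) (b y) (s y).
  by rewrite stepE // leq_size_enc.
apply: (comp_ext _ E).
apply: comp_snd.
apply: (@comp_iteri T (pair_encType (seq_encType X) U) (fun x => enc (s x)) step);
  [exact: comp_enc | | exact: comp_pair].
have c1 := comp_snd (comp_id (pair_encType (pair_encType T nat_encType)
  (pair_encType (seq_encType X) U))).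
apply: comp_if; [exact: comp_nilp (comp_fst c1) | exact: c1 |].
apply: comp_pair; first exact: comp_behead (comp_fst c1).
apply: (comp_comp cg (f := fun p => (p.1.1, p.2.2, head (dec 0) p.2.1))).
apply: comp_pair; last exact: comp_head (comp_fst c1).
apply: comp_pair; last exact: comp_snd c1.
by apply: comp_fst; apply: comp_fst; apply: comp_id.
Qed.

Lemma comp_rev (T X : encType) (s : T -> seq X) :
  computable s -> computable (fun x => rev (s x)).
Proof.
move=> cs; apply: (comp_ext (f := fun x => foldl (fun r y => y :: r) [::] (s x))).
  apply: (@comp_foldl T X (seq_encType X) (fun _ r y => y :: r)) => //.
    apply: comp_cons; first exact: comp_snd (comp_id _).
    exact: comp_snd (comp_fst (comp_id _)).
  exact: comp_const.
by move=> x; rewrite /rev; elim: (s x) [::] => //=.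
Qed.

(** A fold from the right is a fold from the left of the reversed list, which
    is itself obtained by a fold from the left. *)
Lemma comp_foldr (T X U : encType) (g : T -> X -> U -> U) (b : T -> U) (s : T
  -> seq X) :
  computable (fun p : T * X * U => g p.1.1 p.1.2 p.2) ->
  computable b -> computable s ->
  computable (fun x => foldr (g x) (b x) (s x)).
Proof.
move=> cg cb cs.
apply: (comp_ext (f := fun x => foldl (fun r y => g x y r) (b x) (rev (s x)))).
  apply: (@comp_foldl T X U (fun x r y => g x y r)) => //; last exact: comp_rev.
  apply: (comp_comp cg (f := fun p => (p.1.1, p.2, p.1.2))).
  have c1 := comp_fst (comp_id (pair_encType (pair_encType T U) X)).
  apply: comp_pair; last exact: comp_snd c1.
  by apply: comp_pair; [exact: comp_fst c1 | exact: comp_snd (comp_id _)].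
by move=> x; rewrite foldl_rev.
Qed.

Section MoreLists.
Variables T X Y : encType.

Lemma comp_map (g : T -> X -> Y) (s : T -> seq X) :
  computable (fun p : T * X => g p.1 p.2) -> computable s ->
  computable (fun x => map (g x) (s x)).
Proof.
move=> cg cs.
apply: (comp_foldr (g := fun x y r => g x y :: r) (b := fun=> [::])) => //.
  apply: comp_cons; last exact: comp_snd (comp_id _).
  exact: comp_comp cg (comp_fst (comp_id _)).
exact: comp_const.
Qed.

Lemma comp_all (P : T -> X -> bool) (s : T -> seq X) :
  computableb (fun p : T * X => P p.1 p.2) -> computable s ->
  computableb (fun x => all (P x) (s x)).
Proof.
move=> cP cs.
apply: (comp_ext (f := fun x => foldr (fun y r => if P x y then r else 0) 1 (s x))).
  apply: (@comp_foldr _ X nat_encType (fun x y r => if P x y then r else 0)) => //.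
    apply: (@comp_if _ _ (fun p => P p.1.1 p.1.2)).
    - exact: comp_comp cP (comp_fst (comp_id _)).
    - exact: comp_snd (comp_id _).
    - exact: comp_const.
  exact: comp_const.
by move=> x; elim: (s x) => //= y r ->; case: (P x y).
Qed.

Lemma comp_count (P : T -> X -> bool) (s : T -> seq X) :
  computableb (fun p : T * X => P p.1 p.2) -> computable s ->
  computable (fun x => count (P x) (s x)).
Proof.
move=> cP cs.
apply: (@comp_foldr _ X nat_encType (fun x y r => P x y + r)) => //.
  apply: comp_addn; last exact: comp_snd (comp_id _).
  exact: comp_comp cP (comp_fst (comp_id _)).
exact: comp_const.
Qed.

Lemma comp_cat (s r : T -> seq X) : computable s -> computable r ->
  computable (fun x => s x ++ r x).
Proof.
move=> cs cr.
apply: (comp_ext (f := fun x => foldr (fun y r => y :: r) (r x) (s x))).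
  apply: (@comp_foldr _ _ (seq_encType X) (fun _ y r => y :: r)) => //.
  apply: comp_cons; last exact: comp_snd (comp_id _).
  by apply: comp_snd; apply: comp_fst; apply: comp_id.
by move=> x; elim: (s x) => //= y l ->.
Qed.

Lemma comp_size (s : T -> seq X) : computable s -> computable (fun x => size (s x)).
Proof.
move=> cs; apply: (@comp_foldr _ X nat_encType (fun _ _ r => r.+1)) => //.
  apply: comp_S; exact: comp_snd (comp_id _).
exact: comp_const.
Qed.

Lemma comp_nth a (s : T -> seq X) (k : T -> nat) :
  computable s -> computable k -> computable (fun x => nth a (s x) (k x)).
Proof.
move=> cs ck.
apply: (comp_ext (f := fun x => head a (iteri (k x) (fun _ => behead) (s x)))).
  apply: comp_head.
  apply: (@comp_iteri _ (seq_encType X) k (fun _ _ => behead) s) => //.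
  exact: comp_behead (comp_snd (comp_id _)).
move=> x; rewrite -nth0 -[k x in RHS]addn0; elim: (k x) 0 => //= n IHn i.
by rewrite nth_behead IHn addnS.
Qed.

End MoreLists.

Lemma comp_flatten (T X : encType) (s : T -> seq (seq X)) :
  computable s -> computable (fun x => flatten (s x)).
Proof.
move=> cs; apply: (comp_foldr (g := fun _ y r => y ++ r) (b := fun=> [::])) => //.
  apply: comp_cat; last exact: comp_snd (comp_id _).
  by apply: comp_snd; apply: comp_fst; apply: comp_id.
exact: comp_const.
Qed.

Arguments enc : simpl never.
Arguments dec : simpl never.

(** The tactic [comp] recognizes the outermost construction in the definition
    of a function and applies the corresponding closure property. The hook is
    redefined whenever functions for which it is to work have been added. *)
Ltac comp_hook := fail.
Ltac comp_step := first
  [ assumption | exact: comp_id | exact: comp_const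
  | match goal with
    | H : computable ?f |- computable (fun x => ?f _) => apply: (comp_comp H)
    | H : computableb ?f |- computableb (fun x => ?f _) => apply: (comp_comp H)
    end
  | lazymatch goal with
    | |- computable fst => apply: comp_fst
    | |- computable snd => apply: comp_snd
    | |- computable (fun x => fst _) => apply: comp_fst
    | |- computable (fun x => snd _) => apply: comp_snd
    | |- computable (fun x => (_, _)) => apply: comp_pair
    | |- computable (fun x => nat_of_bool _) => apply: comp_b
    | |- computable (fun x => _.+1) => apply: comp_S
    | |- computable (fun x => _ + _) => apply: comp_addn
    | |- computable (fun x => _ - _) => apply: comp_subn
    | |- computable (fun x => _ * _) => apply: comp_muln
    | |- computable (fun x => if _ then _ else _) => apply: comp_if
    | |- computable (fun x => behead _) => apply: comp_behead
    | |- computable (fun x => head _ _) => apply: comp_head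
    | |- computable (fun x => _ :: _) => apply: comp_cons
    | |- computable (fun x => rev _) => apply: comp_rev
    | |- computable (fun x => map _ _) => apply: comp_map
    | |- computable (fun x => count _ _) => apply: comp_count
    | |- computable (fun x => _ ++ _) => apply: comp_cat
    | |- computable (fun x => flatten _) => apply: comp_flatten
    | |- computable (fun x => size _) => apply: comp_size
    | |- computable (fun x => nth _ _ _) => apply: comp_nth
    | |- computable (fun x => foldl _ _ _) => apply: comp_foldl
    | |- computable (fun x => foldr _ _ _) => apply: comp_foldr
    | |- computable (fun x => iteri _ _ _) => apply: comp_iteri
    | |- computable (fun x => enc _) => apply: comp_enc
    | |- computable (fun x => dec _) => apply: comp_dec
    | |- computableb (fun x => _ <= _) => apply: comp_leq
    | |- computableb (fun x => _ == _) => apply: comp_eqn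
    | |- computableb (fun x => if _ then _ else _) => apply: comp_ifb
    | |- computableb (fun x => _ && _) => apply: comp_andb
    | |- computableb (fun x => _ || _) => apply: comp_orb
    | |- computableb (fun x => ~~ _) => apply: comp_negb
    | |- computableb (fun x => _ ==> _) => apply: comp_implyb
    | |- computableb (fun x => odd _) => apply: comp_odd
    | |- computableb (fun x => nilp _) => apply: comp_nilp
    | |- computableb (fun x => all _ _) => apply: comp_all
    | |- _ => comp_hook
    end ].
Ltac comp := rewrite /=; repeat (comp_step; rewrite /=).

Lemma comp_iota (T : encType) (m n : T -> nat) : computable m -> computable n ->
  computable (fun x => iota (m x) (n x)).
Proof.
move=> cm cn.
apply: (comp_ext (f := fun x =>
    rev (iteri (n x) (fun i r => (m x + i) :: r) [::]))); first by comp.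
move=> x; elim: (n x) => [//|k IHk].
by rewrite -[in RHS]addn1 iotaD /= rev_cons IHk cats1.
Qed.

Lemma comp_expn (T : encType) (f g : T -> nat) :
  computable f -> computable g -> computable (fun x => f x ^ g x).
Proof.
move=> cf cg.
have -> : (fun x => f x ^ g x) = fun x => iteri (g x) (fun _ u => f x * u) 1.
  apply: boolp.funext => x; elim: (g x) => [|n IHn] /=; first by [].
  by rewrite expnS IHn.
by comp.
Qed.

(** * Finite samples and certificates *)

(** A sample is a pair of finite configurations, each of them given by the list
    of the symbols at the sites with codes 0, 1, 2 and so on. A constraint
    [a :: r] means that the symbol at the site with coordinates coded by r is
    a. A test consists of two lists of constraints, one for each configuration,
    and of the coordinates of a site, which serves both as a translation vector
    and as the additional site in the independence condition. *)
Notation sample := (seq nat * seq nat)%type.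
Notation test := (seq (seq nat) * seq (seq nat) * seq nat)%type.

(** Every number denotes a symbol of an alphabet of size Q, so that every list
    of numbers denotes a configuration. *)
Definition sym Q v := if v < Q then v else 0.

(** The list is first brought to length d: lists that denote the same site have
    the same index. *)
Definition site_index d (r : seq nat) := enc (mkseq (nth 0 r) d).

(** The code of an integer is twice a natural number n for n, and twice n plus
    one for -n-1; this is addition in terms of codes ([int_code_addE]). *)
Definition int_code_add u v :=
  if ~~ odd (u + v) then u + v + odd u
  else if odd u then (if u < v then v - u - 1 else u - v)
  else (if v < u then u - v - 1 else v - u).

Definition translate d (r : seq nat) (c : seq (seq nat)) :=
  [seq head 0 e :: mkseq (fun i => int_code_add (nth 0 r i) (nth 0 (behead e) i)) d
  | e <- c].

Definition holds d Q (x : seq nat) (c : seq (seq nat)) :=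
  all (fun e => sym Q (nth 0 x (site_index d (behead e))) == head 0 e) c.

Definition cnt d Q1 Q2 (S : seq sample) (c1 c2 : seq (seq nat)) :=
  count (fun x => holds d Q1 x.1 c1 && holds d Q2 x.2 c2) S.

(** The inequality |a / N - b / M| <= 1 / t without denominators
    ([close_ratiosE]). *)
Definition close_ratios t a N b M :=
  (t * (a * M) <= t * (b * N) + N * M) && (t * (b * N) <= t * (a * M) + N * M).

Definition almost_invariant d Q1 Q2 t (tests : seq test) (S : seq sample) :=
  all (fun u => close_ratios t (cnt d Q1 Q2 S u.1.1 u.1.2) (size S)
    (cnt d Q1 Q2 S (translate d u.2 u.1.1) (translate d u.2 u.1.2)) (size S))
  tests.

Definition fresh d (r : seq nat) (c : seq (seq nat)) :=
  all (fun e => site_index d (behead e) != site_index d r) c.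

Definition noise_at0 : seq (seq nat) := [:: [:: 1]].

(** Four approximate conditions, with an error 1/t: invariance, the rarity of
    forbidden patterns without noise, the bound 1/(e+1) on the density of
    noise, and the independence of noise at one site from noise at other
    sites. *)
Definition noisy_samples d Q F e t (tests : seq test) (S : seq sample) :=
  [&& almost_invariant d Q 2 t tests S,
    all (fun w => t * cnt d Q 2 S w [seq 0 :: behead b | b <- w] <= size S) F,
    e.+1 * t * cnt d Q 2 S [::] noise_at0 <= t * size S + e.+1 * size S &
    all (fun u => fresh d u.2 u.1.2 ==>
      close_ratios t (cnt d Q 2 S [::] ((1 :: u.2) :: u.1.2)) (size S)
        (cnt d Q 2 S [::] u.1.2 * cnt d Q 2 S [::] noise_at0)
        (size S * size S)) tests].

Definition mismatches d Q (S : seq sample) :=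
  count (fun x => sym Q (nth 0 x.1 (site_index d [::])) !=
                  sym Q (nth 0 x.2 (site_index d [::]))) S.

(** The samples T approximate an invariant coupling of the first marginal of S
    and a measure on the subshift, with rate of mismatches at most 1/(j+1). *)
Definition coupling_samples d Q F j t (tests : seq test) (S T : seq sample) :=
  [&& 0 < size T, almost_invariant d Q Q t tests T,
    all (fun u => close_ratios t (cnt d Q Q T u.1.1 [::]) (size T)
      (cnt d Q 2 S u.1.1 [::]) (size S)) tests,
    all (fun w => t * cnt d Q Q T [::] w <= size T) F &
    j.+1 * t * mismatches d Q T <= t * size T + j.+1 * size T].

Definition all_seqs (X : Type) L (s : seq X) : seq (seq X) :=
  iteri L (fun _ l => flatten [seq [seq a :: r | r <- l] | a <- s]) [:: [::]].

(** All the constraints that have to be evaluated. The constraint [:: 1] has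
    empty coordinates and stands for noise at the origin. *)
Definition entries d (F : seq (seq (seq nat))) (tests : seq test) :=
  [:: 1] :: flatten F ++ flatten [seq (1 :: u.2) :: (u.1.1 ++ u.1.2 ++
    (translate d u.2 u.1.1 ++ translate d u.2 u.1.2)) | u <- tests].

(** A sum bounds all its terms, and the initial value 1 makes the bound strict
    ([lt_region]). *)
Definition region d F tests :=
  foldr (fun e l => site_index d (behead e) + l) 1 (entries d F tests).

Definition all_samples Q L N : seq (seq sample) :=
  all_seqs N (flatten [seq [seq (x, y) | y <- all_seqs L (iota 0 2)]
                      | x <- all_seqs L (iota 0 Q)]).

(** The frequencies in a sample of size N and the probabilities that they
    approximate differ by at most K / N, where K is the number of restrictions
    to the region ([sampling]). With N = [precision t1 t2] * K, three such
    errors together are at most 1 / t1 and at most 1 / t2. Three is the number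
    of approximate terms in the independence condition. *)
Definition precision t1 t2 := 3 * (t1 + t2) + 1.

(** The universal variable n codes the accuracy asked of the couplings, as an
    inverse error and a list of tests. The existential variable m codes the
    accuracy required of the noisy samples and, in order to make the condition
    decidable, a finite list in which the samples of the couplings are to be
    found. All noisy samples of one fixed size on a fixed region are then
    examined; compactness provides a finite list that works for all of them. *)
Definition certificate d Q F j e (n : nat * seq test)
    (m : nat * seq test * seq (seq sample)) :=
  let L := region d F (n.2 ++ m.1.2) in
  all (fun S => noisy_samples d Q F e m.1.1 m.1.2 S ==>
      ~~ all (fun T => ~~ coupling_samples d Q F j n.1 n.2 S T) m.2)
    (all_samples Q L (precision n.1 m.1.1 * (Q * 2) ^ L)).

Definition code_dim x := nth 0 (dec x : seq nat) 0.
Definition code_alphabet x := nth 0 (dec x : seq nat) 1.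
Definition code_patterns x : seq (seq (seq nat)) := dec (nth 0 (dec x : seq nat) 2).

(** The patterns must be nonempty with distinct sites. An empty forbidden
    pattern makes the subshift empty, so such families are to be rejected; the
    case j = 0 of [couplable] does not rule them out. *)
Definition valid_code x :=
  [&& size (dec x : seq nat) == 3, 0 < code_dim x, 0 < code_alphabet x &
    all (fun w => ~~ nilp w && all (fun e =>
      [&& size e == (code_dim x).+1, head 0 e < code_alphabet x &
        count (fun e' => enc (behead e') == enc (behead e)) w <= 1]) w)
      (code_patterns x)].

(** The clause about j = 0 makes the case e = 0 of [couplable] part of the
    condition: it concerns noise of every level up to 1. *)
Definition stability_predicate x j e n m :=
  [&& valid_code x, (j == 0) ==> (e == 0) &
    certificate (code_dim x) (code_alphabet x) (code_patterns x) j e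
      (dec n) (dec m)].

(** * Decidability of the finite condition *)

Section ComputableSites.
Variable T : encType.
Implicit Types (d Q t j e : T -> nat).

Lemma comp_sym Q v : computable Q -> computable v ->
  computable (fun x : T => sym (Q x) (v x)).
Proof. by move=> cQ cv; rewrite /sym; comp. Qed.

Lemma comp_mkseq (X : encType) (g : T -> nat -> X) d :
  computable (fun p : T * nat => g p.1 p.2) -> computable d ->
  computable (fun x : T => mkseq (g x) (d x)).
Proof.
move=> cg cd; apply: comp_map => //; apply: comp_iota => //; exact: comp_const.
Qed.

Lemma comp_site_index d (r : T -> seq nat) : computable d -> computable r ->
  computable (fun x => site_index (d x) (r x)).
Proof.
by move=> cd cr; rewrite /site_index; apply: comp_enc; apply: comp_mkseq; comp.
Qed.

End ComputableSites.

Ltac comp_hook ::= lazymatch goal with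
  | |- computable (fun x => sym _ _) => apply: comp_sym
  | |- computable (fun x => mkseq _ _) => apply: comp_mkseq
  | |- computable (fun x => site_index _ _) => apply: comp_site_index
  | |- computable (fun x => iota _ _) => apply: comp_iota
  | |- computable (fun x => expn _ _) => apply: comp_expn
  end.

Lemma comp_int_code_add (T : encType) (u v : T -> nat) : computable u ->
  computable v ->
  computable (fun x => int_code_add (u x) (v x)).
Proof. by move=> cu cv; rewrite /int_code_add; comp. Qed.

Section ComputableEvents.
Variable T : encType.
Implicit Types (d Q t j e : T -> nat) (c r : T -> seq (seq nat)).

Lemma comp_translate d s c : computable d -> computable s -> computable c ->
  computable (fun x => translate (d x) (s x) (c x)).
Proof.
move=> cd cs cc; rewrite /translate; comp_step => //.
comp_step; first by comp.
apply: comp_mkseq; last by comp.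
by apply: comp_int_code_add; comp.
Qed.

Lemma comp_holds d Q x c : computable d -> computable Q -> computable x ->
  computable c -> computableb (fun y : T => holds (d y) (Q y) (x y) (c y)).
Proof. by move=> *; rewrite /holds; comp. Qed.

Lemma comp_close_ratios t a N b M : computable t -> computable a -> computable N ->
  computable b -> computable M ->
  computableb (fun y : T => close_ratios (t y) (a y) (N y) (b y) (M y)).
Proof. by move=> *; rewrite /close_ratios; comp. Qed.

Lemma comp_fresh d s c : computable d -> computable s -> computable c ->
  computableb (fun y : T => fresh (d y) (s y) (c y)).
Proof. by move=> *; rewrite /fresh; comp. Qed.

Lemma comp_mismatches d Q S : computable d -> computable Q -> computable S ->
  computable (fun y : T => mismatches (d y) (Q y) (S y)).
Proof. by move=> *; rewrite /mismatches; comp. Qed.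

Lemma comp_all_seqs (X : encType) L (s : T -> seq X) :
  computable L -> computable s -> computable (fun y : T => all_seqs (L y) (s y)).
Proof. by move=> *; rewrite /all_seqs; comp. Qed.

End ComputableEvents.

Ltac comp_hook ::= lazymatch goal with
  | |- computable (fun x => sym _ _) => apply: comp_sym
  | |- computable (fun x => mkseq _ _) => apply: comp_mkseq
  | |- computable (fun x => site_index _ _) => apply: comp_site_index
  | |- computable (fun x => iota _ _) => apply: comp_iota
  | |- computable (fun x => expn _ _) => apply: comp_expn
  | |- computable (fun x => int_code_add _ _) => apply: comp_int_code_add
  | |- computable (fun x => translate _ _ _) => apply: comp_translate
  | |- computable (fun x => mismatches _ _ _) => apply: comp_mismatches
  | |- computable (fun x => all_seqs _ _) => apply: comp_all_seqs
  | |- computableb (fun x => holds _ _ _ _) => apply: comp_holds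
  | |- computableb (fun x => close_ratios _ _ _ _ _) => apply: comp_close_ratios
  | |- computableb (fun x => fresh _ _ _) => apply: comp_fresh
  end.

Section ComputableCounts.
Variable T : encType.
Implicit Types (d Q t j e : T -> nat) (F : T -> seq (seq (seq nat))).

Lemma comp_cnt d Q1 Q2 S c1 c2 : computable d -> computable Q1 ->
  computable Q2 -> computable S -> computable c1 -> computable c2 ->
  computable (fun y : T => cnt (d y) (Q1 y) (Q2 y) (S y) (c1 y) (c2 y)).
Proof. by move=> *; rewrite /cnt; comp. Qed.

Lemma comp_region d F tests : computable d -> computable F -> computable tests ->
  computable (fun y : T => region (d y) (F y) (tests y)).
Proof. by move=> *; rewrite /region /entries; comp. Qed.

Lemma comp_all_samples Q L N : computable Q -> computable L -> computable N ->
  computable (fun y : T => all_samples (Q y) (L y) (N y)).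
Proof. by move=> *; rewrite /all_samples; comp. Qed.

End ComputableCounts.

Ltac comp_hook ::= lazymatch goal with
  | |- computable (fun x => sym _ _) => apply: comp_sym
  | |- computable (fun x => mkseq _ _) => apply: comp_mkseq
  | |- computable (fun x => site_index _ _) => apply: comp_site_index
  | |- computable (fun x => iota _ _) => apply: comp_iota
  | |- computable (fun x => expn _ _) => apply: comp_expn
  | |- computable (fun x => int_code_add _ _) => apply: comp_int_code_add
  | |- computable (fun x => translate _ _ _) => apply: comp_translate
  | |- computable (fun x => mismatches _ _ _) => apply: comp_mismatches
  | |- computable (fun x => all_seqs _ _) => apply: comp_all_seqs
  | |- computableb (fun x => holds _ _ _ _) => apply: comp_holds
  | |- computableb (fun x => close_ratios _ _ _ _ _) => apply: comp_close_ratios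
  | |- computableb (fun x => fresh _ _ _) => apply: comp_fresh
  | |- computable (fun x => cnt _ _ _ _ _ _) => apply: comp_cnt
  | |- computable (fun x => region _ _ _) => apply: comp_region
  | |- computable (fun x => all_samples _ _ _) => apply: comp_all_samples
  end.

Lemma comp_almost_invariant (T : encType) (d Q1 Q2 t : T -> nat) tests S :
  computable d ->
  computable Q1 -> computable Q2 -> computable t -> computable tests ->
  computable S ->
  computableb (fun y : T => almost_invariant (d y) (Q1 y) (Q2 y) (t y) (tests
    y) (S y)).
Proof. by move=> *; rewrite /almost_invariant; comp. Qed.

Section ComputableSamples.
Variable T : encType.
Implicit Types (d Q t j e : T -> nat) (F : T -> seq (seq (seq nat))).

Lemma comp_noisy_samples d Q F e t tests S : computable d -> computable Q ->
  computable F -> computable e -> computable t -> computable tests ->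
  computable S ->
  computableb (fun y : T =>
    noisy_samples (d y) (Q y) (F y) (e y) (t y) (tests y) (S y)).
Proof.
move=> *; rewrite /noisy_samples /noise_at0.
by comp_step; [apply: comp_almost_invariant|]; comp.
Qed.

Lemma comp_coupling_samples d Q F j t tests S U : computable d ->
  computable Q -> computable F -> computable j -> computable t ->
  computable tests -> computable S -> computable U ->
  computableb (fun y : T =>
    coupling_samples (d y) (Q y) (F y) (j y) (t y) (tests y) (S y) (U y)).
Proof.
move=> *; rewrite /coupling_samples; comp_step; first by comp.
by comp_step; [apply: comp_almost_invariant|]; comp.
Qed.

End ComputableSamples.

Section ComputableCertificate.
Variable T : encType.
Implicit Types (d Q t j e : T -> nat) (F : T -> seq (seq (seq nat))).

Lemma comp_certificate d Q F j e n m : computable d ->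
  computable Q -> computable F -> computable j -> computable e ->
  computable n -> computable m ->
  computableb (fun y : T =>
    certificate (d y) (Q y) (F y) (j y) (e y) (n y) (m y)).
Proof.
move=> *; rewrite /certificate /precision; comp_step; last by comp.
comp_step; first by apply: comp_noisy_samples; comp.
comp_step; comp_step; last by comp.
by comp_step; apply: comp_coupling_samples; comp.
Qed.

Lemma comp_valid_code x : computable x -> computableb (fun y : T => valid_code (x y)).
Proof.
move=> cx; have cd := comp_dec (seq_encType nat_encType) cx.
rewrite /valid_code /code_dim /code_alphabet /code_patterns.
have cF : computable (fun y => dec (nth 0 (dec (x y)) 2) : seq (seq (seq nat))).
  by apply: comp_dec; comp.
by comp.
Qed.

End ComputableCertificate.

(** The five arguments are combined into one code, as computability is defined
    for functions of one argument. *)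
Lemma stability_predicate_decidable :
  decidable_pred (fun v : 5.-tuple nat => stability_predicate (nth 0 v 0)
    (nth 0 v 1) (nth 0 v 2) (nth 0 v 3) (nth 0 v 4)).
Proof.
have cP : computableb (fun p : nat * (nat * (nat * (nat * nat))) =>
    stability_predicate p.1 p.2.1 p.2.2.1 p.2.2.2.1 p.2.2.2.2).
  rewrite /stability_predicate; comp_step; first by apply: comp_valid_code; comp.
  comp_step; first by comp.
  rewrite /code_dim /code_alphabet /code_patterns.
  by apply: comp_certificate; do ?apply: comp_dec; comp.
have r2 : rec2 (fun a b => (consn a b).-1).
  by apply: (rec1_app rec1_pred); apply: rec2_consn.
pose cod (v : 5.-tuple nat) := enc (nth 0 v 0, (nth 0 v 1, (nth 0 v 2, (nth 0 v
  3, nth 0 v 4)))).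
have cr : recursive cod.
  by rewrite /cod /=; do 4 (apply: (rec2_app r2); first rec_nth); rec_nth.
apply: (recursive_ext (rec1_app cP cr)) => v.
by rewrite /cod encK.
Qed.

Import Order.TTheory GRing.Theory Num.Theory.
Import numFieldNormedType.Exports.
Local Open Scope classical_set_scope.
Local Open Scope ring_scope.

(** * Cylinder sets *)

Section Cylinders.
Variables (d : nat) (A : alphabetType).
Local Notation X := (config d A).

Definition agree (s : seq (site d)) (x y : X) := forall k, k \in s -> y k = x k.

Definition cylinder (E : set X) :=
  exists s, forall x y, agree s x y -> E x -> E y.

Definition elementary (c : seq (site d * A)) : set X :=
  [set x | forall e, e \in c -> x e.1 = e.2].

Lemma elementary_cylinder c : cylinder (elementary c).
Proof.
exists (unzip1 c) => x y xy /= xc e ec.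
by rewrite xy ?xc //; apply: map_f.
Qed.

Lemma cylinderT : cylinder setT. Proof. by exists [::]. Qed.

Lemma cylinder0 : cylinder set0. Proof. by exists [::]. Qed.

Lemma cylinderC E : cylinder E -> cylinder (~` E).
Proof.
move=> [s sE]; exists s => x y xy nEx /(sE y x) Ey.
by apply/nEx/Ey => k /xy.
Qed.

Lemma cylinderU E F : cylinder E -> cylinder F -> cylinder (E `|` F).
Proof.
move=> [s sE] [r rF]; exists (s ++ r) => x y xy [Ex|Fx].
  by left; apply: sE Ex => k ks; apply: xy; rewrite mem_cat ks.
by right; apply: rF Fx => k ks; apply: xy; rewrite mem_cat ks orbT.
Qed.

Lemma cylinderI E F : cylinder E -> cylinder F -> cylinder (E `&` F).
Proof.
by move=> cE cF; rewrite -[_ `&` _]setCK setCI; apply/cylinderC/cylinderU;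
  apply: cylinderC.
Qed.

Lemma open_coord k a : open [set x : X | x k = a].
Proof.
have -> : [set x : X | x k = a] =
    @proj (site d) (fun=> discrete_topology A) k @^-1` [set a] by [].
apply: (@open_comp X (discrete_topology A)); last exact: discrete_open.
by move=> x _; apply: (@proj_continuous _ (fun=> discrete_topology A) k).
Qed.

Lemma open_agree s (x : X) : open [set y | agree s x y].
Proof.
elim: s => [|k s IHs].
  have -> : [set y | agree [::] x y] = setT by apply/seteqP; split.
  exact: openT.
have -> : [set y | agree (k :: s) x y] =
    [set y | y k = x k] `&` [set y | agree s x y].
  apply/seteqP; split => [y xy|y [/= yk xy] l].
    by split => [|l ls]; apply: xy; rewrite in_cons ?eqxx ?ls ?orbT.
  by rewrite in_cons => /orP[/eqP->//|/xy].
by apply: openI => //; apply: open_coord.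
Qed.

Lemma cylinder_open E : cylinder E -> open E.
Proof.
move=> [s sE].
have -> : E = \bigcup_(x in E) [set y | agree s x y].
  by apply/seteqP; split => [x Ex|y [x Ex xy]]; [exists x | apply: sE Ex].
by apply: bigcup_open => x _; apply: open_agree.
Qed.

Lemma cylinder_closed E : cylinder E -> closed E.
Proof. by move=> cE; rewrite -[E]setCK;
  apply/open_closedC/cylinder_open/cylinderC. Qed.

(** The product topology is generated by the conditions on one coordinate, and
    finitely many of them are implied by agreement on a finite set of sites. *)
Lemma nbhs_agree (x : X) U : nbhs x U -> exists s, [set y | agree s x y] `<=` U.
Proof.
pose B (s : seq (site d)) := [set y | agree s x y].
pose F := filter_from setT B.
have FF : Filter F.
  apply: filter_from_filter; first by exists [::].
  move=> s r _ _; exists (s ++ r) => // y /= xy.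
  by split => k ks; apply: xy; rewrite mem_cat ks ?orbT.
have Fx : F --> x.
  apply/cvg_sup => k V [W] [[Z oZ <-] Zx] ZV.
  exists [:: k] => // y /= xy; apply: ZV => /=.
  by rewrite xy ?mem_seq1.
by move=> /Fx [s _ sU]; exists s.
Qed.

(** As the union runs over finite lists of constraints, it is countable: this
    is why the cylinders generate the Borel sets. *)
Lemma open_bigcup_elementary U : open U ->
  U = \bigcup_(c in [set c | elementary c `<=` U]) elementary c.
Proof.
move=> oU; apply/seteqP; split => [x Ux|x [c cU]]; last exact: cU.
have /nbhs_agree[s sU] : nbhs x U by apply: open_nbhs_nbhs.
exists [seq (k, x k) | k <- s] => /=.
  by move=> y yc; apply: sU => k ks; apply: (yc (k, x k)); apply: map_f.
by move=> e /mapP[k ks ->].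
Qed.

Lemma compact_config : compact [set: X].
Proof.
have := @tychonoff (site d) (fun=> discrete_topology A) (fun=> setT).
have -> : [set f : X | forall i, [set: discrete_topology A] (f i)] = setT.
  by apply/seteqP; split.
by apply => i; apply: finite_compact; apply: (@finite_finset A).
Qed.

(** Cylinders are closed in a compact space and open: a countable cover has a
    finite subcover. This replaces the continuity at the empty set that is
    needed to extend a measure. *)
Lemma cylinder_cover E (F : nat -> set X) : cylinder E ->
  (forall n, cylinder (F n)) -> E `<=` \bigcup_n F n ->
  exists n, E `<=` \bigcup_(i in `I_n) F i.
Proof.
move=> cE cF EF.
have : compact E.
  apply: (subclosed_compact _ compact_config) => //; exact: cylinder_closed.
rewrite compact_cover => /(_ nat setT F)[|//|D _ ED].
  by move=> i _; apply: cylinder_open.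
exists (\max_(i <- finmap.enum_fset D) i).+1 => x /ED [i /= iD Fx]; exists i => //=.
by rewrite ltnS; apply: (@leq_bigmax_seq _ _ xpredT id).
Qed.

End Cylinders.

(** * Borel probability measures *)

Section Borel.
Variables (d : nat) (A : alphabetType).
Local Notation X := (config d A).

Lemma open_borel (U : set X) : open U -> measurable (U : set (borel X)).
Proof. exact: sub_gen_smallest. Qed.

Lemma cylinder_borel (E : set X) : cylinder E -> measurable (E : set (borel X)).
Proof. by move=> /cylinder_open/open_borel. Qed.

Lemma closed_borel (U : set X) : closed U -> measurable (U : set (borel X)).
Proof.
move=> cU; rewrite -[U]setCK; apply: (@measurableC _ (borel X)).
exact: open_borel (closed_openC cU).
Qed.

Lemma countable_elementary : countable [set: seq (site d * A)].
Proof. by rewrite /site; apply: countableP. Qed.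

Lemma borel_generated (G : set (set X)) :
  (forall c, G (elementary c)) -> G `<=` (@measurable _ (borel X)) ->
  (@measurable _ (borel X)) = <<s G >>.
Proof.
move=> eG Gm; apply/seteqP; split; last first.
  by apply: smallest_sub => //; apply: sigma_algebra_measurable.
apply: smallest_sub; first exact: smallest_sigma_algebra.
move=> U oU; rewrite (open_bigcup_elementary oU) bigcup_mkcond.
rewrite -[<<s G >>]/(@measurable _ (g_sigma_algebraType G)).
apply: (countable_bigcupT_measurable countable_elementary) => c.
by case: ifP => // _; apply: sub_gen_smallest.
Qed.

Section Uniqueness.
Variable R : realType.
Variable G : set (set X).
Hypothesis eG : forall c, G (elementary c).
Hypothesis Gm : G `<=` (@measurable _ (borel X)).
Hypothesis GI : setI_closed G.

(** The family G is closed under intersections and generates the Borel sets,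
    and it contains the whole space as the elementary cylinder of no
    constraint. *)
Lemma borel_measure_eq (m1 m2 : {measure set (borel X) -> \bar R}) :
  m1 setT = m2 setT -> (m1 setT < +oo)%E ->
  (forall E, G E -> m1 E = m2 E) ->
  forall E, measurable E -> m1 E = m2 E.
Proof.
move=> mT mfin mG E; rewrite (borel_generated eG Gm) => mE.
have G1 : G setT.
  by rewrite (_ : setT = elementary [::]) //; apply/seteqP; split.
have gT : \bigcup_(k in [set: nat]) [set: X] = setT.
  by apply/seteqP; split => // x _; exists 0%N.
exact: (@g_sigma_algebra_measure_unique _ R (borel X) G Gm (fun=> setT)
  (fun=> G1) gT m1 m2 GI mG (fun=> mfin)).
Qed.

End Uniqueness.

End Borel.

(** * Extension from cylinders *)

Section Extension.
Variables (d : nat) (A : alphabetType) (R : realType).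
Local Notation X := (config d A).

(** A copy of the space of configurations, on which the measurable sets are the
    cylinders instead of the Borel sets. *)
Definition cylinder_space := X.
HB.instance Definition _ := Pointed.on cylinder_space.
HB.instance Definition _ := isAlgebraOfSets.Build default_measure_display
  cylinder_space (@cylinder0 d A) (@cylinderU d A) (@cylinderC d A).

(** Additivity is required on all sets, as it holds for frequencies and for
    their limits along an ultrafilter; no measurability has to be checked
    then. *)
Record finitely_additive (c : set X -> R) : Prop := FinitelyAdditive {
  fadd_ge0 : forall E, 0 <= c E;
  fadd_setT : c setT = 1;
  faddU : forall E F, E `&` F = set0 -> c (E `|` F) = c E + c F }.

Lemma fadd0 c : finitely_additive c -> c set0 = 0.
Proof.
move=> cf; have := faddU cf (setI0 set0).
by rewrite setU0 -{1}[c set0]addr0 => /addrI.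
Qed.

Definition cylinder_content (c : set X -> R) (_ : finitely_additive c) :
  set cylinder_space -> \bar R := fun E => (c E)%:E.

Section Content.
Variables (c : set X -> R) (cf : finitely_additive c).
Local Notation mu := (cylinder_content cf).

Lemma cylinder_content_ge0 E : (0 <= mu E)%E.
Proof. by rewrite lee_fin fadd_ge0. Qed.

Lemma cylinder_content_additive : measure_function.semi_additive mu.
Proof.
apply/additive2P.
  by rewrite /cylinder_content (fadd0 cf).
by move=> E F _ _ EF; rewrite /cylinder_content (faddU cf).
Qed.

HB.instance Definition _ := isContent.Build _ cylinder_space R mu
  cylinder_content_ge0 cylinder_content_additive.

(** By compactness, a countable cover of a cylinder by cylinders may be assumed
    finite, so that finite subadditivity is sufficient. *)
Lemma cylinder_content_subadditive : measurable_subset_sigma_subadditive mu.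
Proof.
move=> E F mF mE EF.
have [n En] := cylinder_cover mE mF EF.
apply: (@le_trans _ _ (\sum_(0 <= i < n) mu (F i))%E); last first.
  apply: nneseries_lim_ge => *; exact: cylinder_content_ge0.
rewrite big_mkord; apply: (@content_subadditive _ _ _ mu) => //.
by rewrite -bigcup_mkord.
Qed.

HB.instance Definition _ := Content_SigmaSubAdditive_isMeasure.Build _ R
  cylinder_space mu cylinder_content_subadditive.

End Content.

Lemma borel_cylinder_generated :
  (@measurable _ (borel X)) = <<s @cylinder d A >>.
Proof.
apply: borel_generated => [c|E]; first exact: elementary_cylinder.
exact: cylinder_borel.
Qed.

Definition cylinder_extension (c : set X -> R) (cf : finitely_additive c) :
  set (borel X) -> \bar R := measure_extension (cylinder_content cf).

Section ExtensionMeasure.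
Variables (c : set X -> R) (cf : finitely_additive c).
Local Notation m := (cylinder_extension cf).

Lemma cylinder_extensionE E : cylinder E -> m E = (c E)%:E.
Proof.
by move=> cE; rewrite /m /measure_extension measurable_mu_extE.
Qed.

Lemma cylinder_extension0 : m set0 = 0%E.
Proof. by rewrite cylinder_extensionE ?(fadd0 cf) //; apply: cylinder0. Qed.

Lemma cylinder_extension_ge0 E : (0 <= m E)%E.
Proof. exact: measure_ge0. Qed.

Lemma cylinder_extension_additive : semi_sigma_additive m.
Proof.
move=> F mF tF mUF; rewrite borel_cylinder_generated in mF mUF.
exact: (@measure_semi_sigma_additive _ _ _
  (measure_extension (cylinder_content cf)) F mF tF mUF).
Qed.

HB.instance Definition _ := isMeasure.Build _ (borel X) R m
  cylinder_extension0 cylinder_extension_ge0 cylinder_extension_additive.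

Lemma cylinder_extension_setT : m setT = 1%E.
Proof. by rewrite cylinder_extensionE ?(fadd_setT cf) //; apply: cylinderT. Qed.

HB.instance Definition _ := Measure_isProbability.Build _ (borel X) R m
  cylinder_extension_setT.

End ExtensionMeasure.

Lemma probability_extension (c : set X -> R) : finitely_additive c ->
  exists P : probability (borel X) R,
    forall E, cylinder E -> P E = (c E)%:E.
Proof.
move=> cf; exists (cylinder_extension cf : probability (borel X) R).
exact: cylinder_extensionE.
Qed.

End Extension.

(** * Sites and symbols as numbers *)

Definition int_decode n : int := if odd n then Negz n./2 else Posz n./2.

Lemma int_codeK : cancel int_code int_decode.
Proof.
by case=> n; rewrite /int_decode /= ?odd_double ?doubleK //= uphalf_double.
Qed.

Lemma int_decodeK : cancel int_decode int_code.
Proof.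
move=> n; rewrite /int_decode; case: ifP => on /=.
  by rewrite -[RHS](odd_double_half n) on.
by rewrite -[RHS](odd_double_half n) on.
Qed.

Lemma int_code_addE u v :
  int_code_add u v = int_code (int_decode u + int_decode v).
Proof.
rewrite -[LHS]int_decodeK; congr int_code.
by rewrite /int_code_add /int_decode; do !case: ifP; lia.
Qed.

Section Sites.
Variable d : nat.

Definition site_of (r : seq nat) : site d :=
  \row_i int_decode (nth 0%N r i).

Definition coords (k : site d) : seq nat :=
  [seq int_code (k ord0 i) | i <- enum 'I_d].

Lemma size_coords k : size (coords k) = d.
Proof. by rewrite size_map size_enum_ord. Qed.

Lemma nth_coords k (i : 'I_d) : nth 0%N (coords k) i = int_code (k ord0 i).
Proof.
by rewrite (nth_map i) ?size_enum_ord ?nth_ord_enum //.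
Qed.

Lemma coordsK : cancel coords site_of.
Proof.
by move=> k; apply/rowP => i; rewrite mxE nth_coords int_codeK.
Qed.

Lemma coords_site_of r : coords (site_of r) = mkseq (nth 0%N r) d.
Proof.
apply: (@eq_from_nth _ 0%N); first by rewrite size_coords size_mkseq.
move=> i; rewrite size_coords => ltid.
by rewrite (nth_coords _ (Ordinal ltid)) mxE int_decodeK nth_mkseq.
Qed.

Lemma site_index_site_of r : site_index d r = enc (coords (site_of r)).
Proof. by rewrite coords_site_of. Qed.

Lemma site_index_inj r s : (site_index d r == site_index d s) = (site_of r ==
  site_of s).
Proof.
rewrite !site_index_site_of; apply/eqP/eqP => [/(can_inj (@encK _))|->//].
exact: (can_inj coordsK).
Qed.

Lemma site_of0 : site_of [::] = 0.
Proof. by apply/rowP => i; rewrite !mxE nth_nil. Qed.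

Lemma site_of_add r s :
  site_of (mkseq (fun i => int_code_add (nth 0%N r i) (nth 0%N s i)) d) =
  site_of r + site_of s.
Proof.
apply/rowP => i; rewrite !mxE nth_mkseq //.
by rewrite int_code_addE int_codeK.
Qed.

End Sites.

(** The decoding is total, by the same convention as [sym], so that the finite
    conditions on lists of numbers and the events in the space of
    configurations agree for arbitrary lists ([holdsE]). *)
Record coding (A : alphabetType) := Coding {
  code_size : nat;
  code_of : A -> nat;
  code_to : nat -> A;
  code_ofK : cancel code_of code_to;
  code_toE : forall v, code_of (code_to v) = sym code_size v;
  code_lt : forall a, (code_of a < code_size)%N }.

Lemma inordE q v : \val (inord v : 'I_q.+1) = sym q.+1 v.
Proof.
rewrite /sym; case: ifP => [/inordK//|nv].
by rewrite /inord /insubd insubF.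
Qed.

Definition ord_coding q : coding 'I_q.+1 :=
  @Coding 'I_q.+1 q.+1 val inord (@inord_val q) (@inordE q) (@ltn_ord _).

Lemma bool_codingK : cancel nat_of_bool (fun n => n == 1%N).
Proof. by case. Qed.

Lemma bool_codingE v : nat_of_bool (v == 1%N) = sym 2 v.
Proof. by case: v => [|[|]]. Qed.

Lemma bool_coding_lt (b : bool) : (b < 2)%N. Proof. by case: b. Qed.

Definition bool_coding : coding bool :=
  @Coding bool 2 nat_of_bool (fun n => n == 1%N) bool_codingK bool_codingE
    bool_coding_lt.

(** * Cylinder events as lists of numbers *)

Section Event.
Variables (d : nat) (A : alphabetType) (cA : coding A).
Local Notation X := (config d A).

Definition eventb (c : seq (seq nat)) (x : X) : bool :=
  all (fun e => code_of cA (x (site_of d (behead e))) == head 0%N e) c.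

Definition event c : set X := [set x | eventb c x].

(** Sites outside of the list get the default 0 of [nth], decoded as a
    symbol. *)
Definition config_of (x : seq nat) : X :=
  fun k => code_to cA (nth 0%N x (enc (coords k))).

Lemma holdsE x c : holds d (code_size cA) x c = eventb c (config_of x).
Proof.
by apply: eq_all => e; rewrite /config_of code_toE site_index_site_of.
Qed.

Lemma eventb_cat c1 c2 x : eventb (c1 ++ c2) x = eventb c1 x && eventb c2 x.
Proof. exact: all_cat. Qed.

Lemma eventb_cylinder c : cylinder (event c).
Proof.
exists [seq site_of d (behead e) | e <- c] => x y xy.
rewrite /event /= /eventb => /allP cx; apply/allP => e ec.
by rewrite xy ?cx //; apply: map_f.
Qed.

Lemma shift_cylinder (k : site d) E : cylinder E -> cylinder (@shift_config d A
  k @^-1` E).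
Proof.
move=> [s sE]; exists [seq k + l | l <- s] => x y xy; apply: sE => l ls.
by rewrite /shift_config xy //; apply: map_f.
Qed.

Lemma eventb_translate r c x :
  eventb (translate d r c) x = eventb c (shift_config (site_of d r) x).
Proof.
by rewrite /eventb all_map; apply: eq_all => e /=; rewrite site_of_add.
Qed.

Definition coded (c : seq (site d * A)) : seq (seq nat) :=
  [seq code_of cA e.2 :: coords e.1 | e <- c].

Lemma eventb_coded c x : eventb (coded c) x <-> elementary c x.
Proof.
rewrite /eventb all_map; split => [/allP xc e ec|xc].
  have /= := xc e ec; rewrite coordsK => /eqP /(can_inj (@code_ofK _ cA)) //.
by apply/allP => e ec; rewrite /= coordsK xc.
Qed.

End Event.

Section PairEvent.
Variables (d : nat) (A B : alphabetType) (cA : coding A) (cB : coding B).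
Local Notation X := (config d (A * B)%type).

Definition event2 c1 c2 : set X :=
  [set z | eventb cA c1 (proj1c z) && eventb cB c2 (proj2c z)].

Definition config2_of (x : seq nat * seq nat) : X :=
  fun k => ((config_of cA x.1 : config d A) k, (config_of cB x.2 : config d B) k).

Lemma proj1c_cylinder E : cylinder E -> cylinder (@proj1c d A B @^-1` E).
Proof.
by move=> [s sE]; exists s => x y xy; apply: sE => k ks; rewrite /proj1c xy.
Qed.

Lemma proj2c_cylinder E : cylinder E -> cylinder (@proj2c d A B @^-1` E).
Proof.
by move=> [s sE]; exists s => x y xy; apply: sE => k ks; rewrite /proj2c xy.
Qed.

Lemma event2_cylinder c1 c2 : cylinder (event2 c1 c2).
Proof.
rewrite (_ : event2 c1 c2 = (@proj1c d A B @^-1` event cA c1) `&`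
    (@proj2c d A B @^-1` event cB c2)).
  apply: cylinderI; [apply: proj1c_cylinder|apply: proj2c_cylinder];
  exact: eventb_cylinder.
by apply/seteqP; split => z => [/andP[]|[e1 e2]]; [split|apply/andP].
Qed.

Lemma event2I c1 c2 c1' c2' :
  event2 c1 c2 `&` event2 c1' c2' = event2 (c1 ++ c1') (c2 ++ c2').
Proof.
rewrite /event2; apply/seteqP; split => z /=; rewrite !eventb_cat.
  by case=> /andP[-> ->] /andP[-> ->].
by case/andP => /andP[-> ->] /andP[-> ->].
Qed.

(** Every elementary cylinder over a product alphabet is such an event, hence
    these events determine measures ([event2_eq]). *)
Lemma elementary_event2 c : exists c1 c2, elementary c = event2 c1 c2.
Proof.
exists (coded cA [seq (e.1, e.2.1) | e <- c]), (coded cB [seq (e.1, e.2.2) | e <- c]).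
apply/seteqP; split => z /=.
  move=> zc; apply/andP; split; apply/eventb_coded => _ /mapP[e ec ->] /=;
  by rewrite /proj1c /proj2c zc.
move=> /andP[/eventb_coded z1 /eventb_coded z2] [k [a b]] ec /=.
have := z1 (k, a) (map_f (fun e => (e.1, e.2.1)) ec).
have := z2 (k, b) (map_f (fun e => (e.1, e.2.2)) ec).
by rewrite /proj1c /proj2c /=; case: (z k) => a' b' /= -> ->.
Qed.

End PairEvent.

(** * Empirical measures *)

Section Frequency.
Variables (R : realType) (X : Type).
Implicit Types (S : seq X) (E F : set X).

Definition freq S E : R := (count (fun x => `[<E x>]) S)%:R / (size S)%:R.

Lemma freq_ge0 S E : 0 <= freq S E.
Proof. by rewrite divr_ge0 ?ler0n. Qed.

Lemma freq_le1 S E : freq S E <= 1.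
Proof.
rewrite /freq; have [->|S0] := posnP (size S); first by rewrite invr0 mulr0.
by rewrite ler_pdivrMr ?ltr0n // mul1r ler_nat count_size.
Qed.

Lemma freqT S : (0 < size S)%N -> freq S setT = 1.
Proof.
move=> S0; rewrite /freq (eq_count (a2 := predT)) ?count_predT ?divff
  ?pnatr_eq0 -?lt0n //.
by move=> x; rewrite asboolT.
Qed.

Lemma freqU S E F : E `&` F = set0 -> freq S (E `|` F) = freq S E + freq S F.
Proof.
move=> EF; rewrite /freq -mulrDl -natrD -count_predUI.
rewrite (@eq_count _ (predI _ _) pred0) ?count_pred0 ?addn0.
  congr (_%:R / _); apply: eq_count => x /=.
  by apply/asboolP/orP => [[]|[]/asboolP]; [left; apply/asboolP|right;
    apply/asboolP|left|right].
move=> x /=; apply/negbTE/negP => /andP[/asboolP Ex /asboolP Fx].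
by have : (E `&` F) x by []; rewrite EF.
Qed.

End Frequency.

Section FrequencyLimit.
Variables (d : nat) (A : alphabetType) (R : realType).
Local Notation X := (config d A).
Variables (U : set_system nat) (S : nat -> seq X).
Hypothesis FU : UltraFilter U.
Hypothesis S_gt0 : forall j, (0 < size (S j))%N.

(** The images of an ultrafilter are maximal: for every B, the original
    ultrafilter contains the preimage of B or that of its complement. *)
Lemma ultra_fmap (u : nat -> R) : UltraFilter (u @ U).
Proof.
split; first exact: fmap_proper_filter.
move=> G PG uG; apply/seteqP; split => // B GB.
have [//|nB] := in_ultra_setVsetC (u @^-1` B) FU.
have /filter_ex[x []//] : G (B `&` ~` B) by apply: filterI => //; apply: uG.
Qed.

Lemma ultra_bounded_cvg (u : nat -> R) : (forall j, 0 <= u j <= 1) ->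
  cvg (u @ U).
Proof.
move=> u01; have := @segment_compact R 0 1.
have U1 : U (u @^-1` `[0, 1]).
  by apply: filterS filterT => j _; rewrite /= in_itv; apply: u01.
rewrite compact_ultra => /(_ _ (ultra_fmap u) U1)[l [_ ul]].
by apply/cvg_ex; exists l.
Qed.

(** The limits of frequencies exist for all sets simultaneously, and they are
    finitely additive like the frequencies. Only on cylinders do they have to
    agree with a measure. *)
Lemma limit_probability : exists P : probability (borel X) R,
  forall E, cylinder E -> freq R (S j) E @[j --> U] --> fine (P E).
Proof.
have cv E : cvg (freq R (S j) E @[j --> U]).
  by apply: ultra_bounded_cvg => j; rewrite freq_ge0 freq_le1.
pose c E := lim (freq R (S j) E @[j --> U]).
have cf : finitely_additive c.
  split => [E||E F EF].
  - by apply: limr_ge => //; apply: nearW => j; apply: freq_ge0.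
  - rewrite /c (_ : (fun j => _) = fun=> 1) ?lim_cst //.
    by apply/funext => j; rewrite freqT.
  - rewrite /c (_ : (fun j => freq R (S j) (E `|` F)) = (fun j => freq R (S j)
    E) \+ (fun j => freq R (S j) F)) ?limD //.
    by apply/funext => j; rewrite freqU.
have [P PE] := probability_extension cf.
exists P => E cE; rewrite PE //=; exact: cv.
Qed.

End FrequencyLimit.

(** * Sampling a measure *)

Lemma measure_finType d (T : measurableType d) (R : realType)
    (mu : {measure set T -> \bar R}) (I : finType) (f : T -> I) (P : pred I) :
  (forall i, measurable (f @^-1` [set i])) ->
  mu [set x | P (f x)] = (\sum_(i | P i) mu (f @^-1` [set i]))%E.
Proof.
move=> mf.
have H (s : seq I) : uniq s ->
  measurable [set x | f x \in s] /\
  mu [set x | f x \in s] = (\sum_(i <- s) mu (f @^-1` [set i]))%E.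
  elim: s => [_|i s IHs /= /andP[nis us]].
    have -> : [set x | f x \in [::]] = set0 by apply/seteqP; split.
    by rewrite big_nil measure0.
  have [ms Es] := IHs us.
  have -> : [set x | f x \in i :: s] = f @^-1` [set i] `|` [set x | f x \in s].
    apply/seteqP; split => x /=; rewrite in_cons.
      by move=> /orP[/eqP|]; [left|right].
    by move=> [->|->]; rewrite ?eqxx ?orbT.
  split; first exact: measurableU.
  rewrite big_cons measureU //; first exact: (congr1 (adde _) Es).
  by apply/seteqP; split => // x [/= ->]; rewrite (negbTE nis).
have [_ E] := H (enum P) (enum_uniq P).
have -> : [set x | P (f x)] = [set x | f x \in enum P].
  by apply/seteqP; split => x /=; rewrite mem_enum.
by rewrite E big_enum; apply: eq_bigl.
Qed.

(** Every i is taken trunc(N w_i) times, and the sample is completed by copies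
    of one i0. This gives each set P at least N w(P) - |I| entries; the upper
    bound follows, applying the lower one to the complement of P. *)
Lemma rounding (R : realType) (I : finType) (w : I -> R) N :
  (forall i, 0 <= w i) -> \sum_i w i = 1 -> (0 < N)%N ->
  exists S : seq I, size S = N /\ forall P : pred I,
    `|(count P S)%:R / N%:R - \sum_(i | P i) w i| <= #|I|%:R / N%:R.
Proof.
move=> w_ge0 w1 N0.
have N0R : 0 < N%:R :> R by rewrite ltr0n.
have [i0 _] : exists i0 : I, true.
  have [I0|/card_gt0P[i _]] := posnP #|I|; last by exists i.
  move: w1; rewrite big_pred0 => [/eqP|i]; first by rewrite eq_sym oner_eq0.
  by have := card0_eq I0 i.
pose n i := Num.trunc (N%:R * w i).
have n_le i : (n i)%:R <= N%:R * w i by rewrite truncn_le mulr_ge0 // ltW.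
have n_gt i : N%:R * w i - 1 <= (n i)%:R.
  by rewrite lerBlDr natr1 ltW // truncnS_gt.
have n_sum : (\sum_i n i <= N)%N.
  rewrite -(ler_nat R) natr_sum (le_trans (ler_sum _ (fun i _ => n_le i))) //.
  by rewrite -mulr_sumr w1 mulr1.
pose S := flatten [seq nseq (n i) i | i <- enum I] ++ nseq (N - \sum_i n i) i0.
have sizeS : size S = N.
  rewrite size_cat size_nseq size_flatten /shape -map_comp sumnE big_map.
  rewrite (eq_bigr n) => [|i _]; last by rewrite /= size_nseq.
  by rewrite big_enum subnKC.
have countS (P : pred I) : (\sum_(i | P i) n i <= count P S)%N.
  rewrite count_cat (leq_trans _ (leq_addr _ _)) // count_flatten -map_comp.
  rewrite sumnE big_map big_enum /= big_mkcond /= leq_sum // => i _.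
  by rewrite count_nseq; case: (P i); rewrite ?mul1n.
have lower (P : pred I) :
    N%:R * \sum_(i | P i) w i - #|I|%:R <= (count P S)%:R.
  apply: (@le_trans _ _ (\sum_(i | P i) n i)%:R); last by rewrite ler_nat.
  apply: (@le_trans _ _ (\sum_(i | P i) (N%:R * w i - 1))); last first.
    by rewrite natr_sum ler_sum.
  rewrite big_split /= mulr_sumr lerD2l sumrN lerN2 sumr_const ler_nat.
  exact: max_card.
exists S; split => // P.
have cP : (count P S)%:R = N%:R - (count (predC P) S)%:R :> R.
  have := congr1 (fun k => k%:R : R) (count_predC P S).
  by rewrite natrD sizeS => <-; rewrite addrK.
have sP : \sum_(i | P i) w i = 1 - \sum_(i | ~~ P i) w i.
  by have := w1; rewrite (bigID P) /= => <-; rewrite addrK.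
have := lower P; have := lower (predC P) => /=.
set a := \sum_(i | ~~ P i) w i in sP *; set b := \sum_(i | P i) w i in sP *.
move=> l1 l2.
rewrite -[b](mulfK (lt0r_neq0 N0R)) -mulrBl normrM normfV (gtr0_norm N0R).
rewrite ler_pM2r ?invr_gt0 // ler_norml; apply/andP; split; first by lra.
by rewrite cP sP; lra.
Qed.

Section Sampling.
Variables (d : nat) (A B : alphabetType) (cA : coding A) (cB : coding B).
Variable R : realType.
Local Notation X := (config d (A * B)%type).
Local Notation qA := (code_size cA).
Local Notation qB := (code_size cB).

Definition inside L (c : seq (seq nat)) :=
  all (fun e => site_index d (behead e) < L)%N c.

Definition sample_shape L (x : seq nat * seq nat) : bool :=
  [&& size x.1 == L, all (fun v => v < qA)%N x.1,
      size x.2 == L & all (fun v => v < qB)%N x.2].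

Definition restriction (C : alphabetType) (cC : coding C) L (x : config d C) :
    L.-tuple 'I_(code_size cC) :=
  [tuple Ordinal (code_lt cC (x (site_of d (dec i)))) | i < L].

Lemma nth_restriction (C : alphabetType) (cC : coding C) L (x : config d C) i :
  (i < L)%N ->
  nth 0%N (map val (restriction cC L x)) i = code_of cC (x (site_of d (dec i))).
Proof.
move=> iL; have x0 : 'I_(code_size cC) := Ordinal (code_lt cC (x 0)).
by rewrite (nth_map x0) ?size_tuple // -(tnth_nth x0 _ (Ordinal iL)) tnth_mktuple.
Qed.

Lemma config_of_restriction (C : alphabetType) (cC : coding C) L (x : config d C) k :
  (enc (coords k) < L)%N ->
  (config_of cC (map val (restriction cC L x)) : config d C) k = x k.
Proof.
by move=> kL; rewrite /config_of nth_restriction // encK coordsK code_ofK.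
Qed.

Lemma restriction_cylinder (C : alphabetType) (cC : coding C) L t :
  cylinder [set x : config d C | restriction cC L x = t].
Proof.
exists [seq site_of d (dec i) | i <- iota 0 L] => x y xy /= <-.
apply: eq_from_tnth => i; rewrite !tnth_mktuple; apply: val_inj => /=.
by rewrite xy //; apply: map_f; rewrite mem_iota /= add0n.
Qed.

Definition regional L (E : set X) :=
  forall z z', (forall k, (enc (coords k) < L)%N -> z k = z' k) -> E z -> E z'.

Lemma event2_regional L c1 c2 : inside L c1 -> inside L c2 ->
  regional L (event2 cA cB c1 c2).
Proof.
move=> /allP i1 /allP i2 z z' zz' /andP[/allP e1 /allP e2].
apply/andP; split; apply/allP => e ec.
  by rewrite -(eqP (e1 e ec)) /proj1c zz' // -site_index_site_of i1.
by rewrite -(eqP (e2 e ec)) /proj2c zz' // -site_index_site_of i2.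
Qed.

Definition restriction2 L (z : X) :=
  (restriction cA L (proj1c z), restriction cB L (proj2c z)).

Lemma restriction2_cylinder L t :
  cylinder (restriction2 L @^-1` [set t]).
Proof.
rewrite (_ : _ @^-1` _ =
    (@proj1c d A B @^-1` [set x | restriction cA L x = t.1]) `&`
    (@proj2c d A B @^-1` [set x | restriction cB L x = t.2])).
  apply: cylinderI; [apply: proj1c_cylinder|apply: proj2c_cylinder];
  exact: restriction_cylinder.
case: t => t1 t2; apply/seteqP; split => z; rewrite /restriction2 /=.
  by case=> <- <-.
by case=> /= <- <-.
Qed.

Lemma restriction_shape (C : alphabetType) (cC : coding C) L (t : L.-tuple
  'I_(code_size cC)) :
  (size (map val t) == L) && all (fun v => v < code_size cC)%N (map val t).
Proof.
by rewrite size_map size_tuple eqxx; apply/allP => _ /mapP[i _ ->]; apply: ltn_ord.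
Qed.

(** The probabilities of the finitely many restrictions to the region are
    rounded to multiples of 1 / N. *)
Lemma sampling (mu : probability (borel X) R) L N : (0 < N)%N ->
  exists S : seq (seq nat * seq nat),
    [/\ size S = N, all (sample_shape L) S &
    forall E, regional L E ->
      `|freq R (map (@config2_of d A B cA cB) S) E - fine (mu E)|
        <= ((qA * qB) ^ L)%:R / N%:R].
Proof.
move=> N0.
pose w t := fine (mu (restriction2 L @^-1` [set t])).
have mr t : measurable (restriction2 L @^-1` [set t] : set (borel X)).
  exact: cylinder_borel (restriction2_cylinder t).
have wE P : \sum_(t | P t) w t = fine (mu [set z | P (restriction2 L z)]).
  rewrite measure_finType // -sum_fine // => t _.
  exact: fin_num_measure.
have w_ge0 t : 0 <= w t by rewrite fine_ge0.
have w1 : \sum_t w t = 1.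
  rewrite (wE xpredT) (_ : [set z : X | true] = setT) ?probability_setT //.
  by apply/seteqP; split.
have [S [sS HS]] := rounding w_ge0 w1 N0.
pose f (t : L.-tuple 'I_qA * L.-tuple 'I_qB) := (map val t.1, map val t.2) :
  seq nat * seq nat.
exists (map f S); split; first by rewrite size_map.
  apply/allP => _ /mapP[t _ ->]; rewrite /sample_shape /f /=.
  by have /andP[-> ->] := restriction_shape t.1; exact: restriction_shape t.2.
move=> E EL.
pose P t := `[<E (@config2_of d A B cA cB (f t))>].
have := HS P; rewrite card_prod !card_tuple !card_ord -expnMn wE.
rewrite (_ : [set z | P (restriction2 L z)] = E); last first.
  have fE z k : (enc (coords k) < L)%N ->
      @config2_of d A B cA cB (f (restriction2 L z)) k = z k.
    move=> kL; rewrite /config2_of /f !config_of_restriction //.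
    by rewrite /proj1c /proj2c -surjective_pairing.
  apply/seteqP; split => z; first by move=> /asboolP; apply: EL; apply: fE.
  by move=> Ez; apply/asboolP; apply: EL Ez => k kL; rewrite fE.
by rewrite /freq !size_map sS !count_map.
Qed.

End Sampling.

(** * The finite conditions in terms of frequencies *)

Section Tolerance.
Variable R : realType.

Lemma close_ratiosE t a N b M : (0 < N)%N -> (0 < M)%N ->
  close_ratios t a N b M = (t%:R * `|a%:R / N%:R - b%:R / M%:R| <= 1 :> R).
Proof.
move=> N0 M0; rewrite -[t%:R]ger0_norm ?ler0n // -normrM ler_norml andbC.
have NM : 0 < N%:R * M%:R :> R by rewrite mulr_gt0 ?ltr0n.
have E : t%:R * (a%:R / N%:R - b%:R / M%:R) * (N%:R * M%:R) =
    t%:R * (a%:R * M%:R) - t%:R * (b%:R * N%:R) :> R.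
  by field; rewrite !pnatr_eq0 -!lt0n N0 M0.
rewrite /close_ratios -!(ler_nat R) !natrD !natrM.
rewrite -[X in _ = (X <= 1) && _](mulfK (lt0r_neq0 NM)) E ler_pdivrMr // mul1r.
rewrite -[X in _ = _ && (_ <= X)](mulfK (lt0r_neq0 NM)) E ler_pdivlMr // mulN1r.
by congr (_ && _); apply/idP/idP => H; lra.
Qed.

(** The tolerance 1 / t, allowing t = 0. The same conditions are considered
    with the tolerance [nonpositive], where they are exact. *)
Definition small t : set R := [set x | t%:R * x <= 1].

Variables (d : nat) (F : seq (seq (seq nat))).
Implicit Types (f g : seq (seq nat) -> seq (seq nat) -> R) (sm : set R).

Definition approx_invariant sm (tests : seq test) f :=
  forall u, u \in tests ->
    sm `|f u.1.1 u.1.2 - f (translate d u.2 u.1.1) (translate d u.2 u.1.2)|.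

(** The functions f c1 c2 stand for the probability that the two coordinates
    satisfy the constraints c1 and c2. The set sm contains the permitted
    errors: [small] for samples and [nonpositive] for measures. *)
Definition approx_noisy eps sm (tests : seq test) f :=
  [/\ approx_invariant sm tests f,
    forall w, w \in F -> sm (f w [seq 0%N :: behead b | b <- w]),
    sm (f [::] noise_at0 - eps) &
    forall u, u \in tests -> fresh d u.2 u.1.2 ->
      sm `|f [::] ((1%N :: u.2) :: u.1.2) - f [::] u.1.2 * f [::] noise_at0|].

(** Here f gives the probabilities for the noisy measure and g those for the
    coupling, in which mis is the probability of a mismatch at the origin. *)
Definition approx_coupling delta sm (tests : seq test) f g mis :=
  [/\ approx_invariant sm tests g,
    forall u, u \in tests -> sm `|g u.1.1 [::] - f u.1.1 [::]|,
    forall w, w \in F -> sm (g [::] w) &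
    sm (mis - delta)].

End Tolerance.

Section Counting.
Variables (R : realType) (d : nat) (A B : alphabetType).
Variables (cA : coding A) (cB : coding B).
Local Notation X := (config d (A * B)%type).
Local Notation qA := (code_size cA).
Local Notation qB := (code_size cB).

Definition mismatch (C : alphabetType) : set (config d (C * C)%type) :=
  [set z | (z 0).1 != (z 0).2].

Definition frequency (S : seq sample) c1 c2 : R :=
  freq R (map (@config2_of d A B cA cB) S) (event2 cA cB c1 c2).

Lemma cntE S c1 c2 : (0 < size S)%N ->
  (cnt d qA qB S c1 c2)%:R / (size S)%:R = frequency S c1 c2.
Proof.
move=> S0; rewrite /frequency /freq size_map count_map.
congr (_%:R / _); apply: eq_count => x /=.
rewrite -[holds d qA x.1 c1]/(holds d (code_size cA) x.1 c1) !holdsE.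
by rewrite /event2 /= asboolb.
Qed.

Lemma almost_invariantE t tests S : (0 < size S)%N ->
  almost_invariant d qA qB t tests S <->
  approx_invariant d (@small R t) tests (frequency S).
Proof.
move=> S0; split => [/allP H u /H|H].
  by rewrite (close_ratiosE R) ?cntE.
by apply/allP => u /H; rewrite (close_ratiosE R) ?cntE.
Qed.

Lemma leq_small t a N : (0 < N)%N ->
  (t * a <= N)%N = (t%:R * (a%:R / N%:R) <= 1 :> R).
Proof.
move=> N0; rewrite mulrA ler_pdivrMr ?ltr0n // mul1r.
by rewrite -natrM ler_nat.
Qed.

Lemma leq_small_shift e t a N : (0 < N)%N ->
  (e.+1 * t * a <= t * N + e.+1 * N)%N =
  (t%:R * (a%:R / N%:R - e.+1%:R^-1) <= 1 :> R).
Proof.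
move=> N0; rewrite -(ler_nat R) natrD !natrM.
have N0R : 0 < N%:R :> R by rewrite ltr0n.
have e0R : 0 < e.+1%:R :> R by rewrite ltr0n.
have NM : 0 < e.+1%:R * N%:R :> R by rewrite mulr_gt0.
rewrite -[X in _ = (X <= 1)](mulfK (lt0r_neq0 NM)) ler_pdivrMr // mul1r.
have -> : t%:R * (a%:R / N%:R - e.+1%:R^-1) * (e.+1%:R * N%:R) =
    e.+1%:R * t%:R * a%:R - t%:R * N%:R :> R.
  by field; rewrite lt0r_neq0 // lt0r_neq0.
by rewrite lerBlDr addrC.
Qed.

End Counting.

Section CountingConditions.
Variables (R : realType) (d : nat) (A : alphabetType) (cA : coding A).
Variable F : seq (seq (seq nat)).
Local Notation qA := (code_size cA).

Lemma noisy_samplesE e t tests S : (0 < size S)%N ->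
  noisy_samples d qA F e t tests S <->
  approx_noisy d F e.+1%:R^-1 (@small R t) tests (@frequency R d A bool cA
    bool_coding S).
Proof.
move=> S0.
have cE c1 c2 := @cntE R d A bool cA bool_coding S c1 c2 S0.
have iE := @almost_invariantE R d A bool cA bool_coding t tests S S0.
rewrite /noisy_samples /approx_noisy; split.
  case/and4P => /iE c1 /allP c2 c3 /allP c4; split => //.
  - by move=> w /c2; rewrite (leq_small R) // cE.
  - by move: c3; rewrite (leq_small_shift R) // cE.
  - move=> u /c4/implyP H /H.
    rewrite (close_ratiosE R) ?muln_gt0 ?S0 // !natrM invfM mulrACA !cE => K;
      exact: K.
case=> /iE c1 c2 c3 c4; apply/and4P; split => //.
- by apply/allP => w /c2; rewrite (leq_small R) // cE.
- by rewrite (leq_small_shift R) // cE.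
- apply/allP => u ut; apply/implyP => fr; have K := c4 u ut fr.
  by rewrite (close_ratiosE R) ?muln_gt0 ?S0 // !natrM invfM mulrACA !cE; exact: K.
Qed.

Lemma mismatchesE (S : seq sample) : (0 < size S)%N ->
  (mismatches d qA S)%:R / (size S)%:R =
  freq R (map (@config2_of d A A cA cA) S) (@mismatch d A).
Proof.
move=> S0; rewrite /freq size_map count_map; congr (_%:R / _).
apply: eq_count => x; rewrite /= /mismatch /= asboolb.
rewrite /config2_of /= /config_of /= -!code_toE site_index_site_of site_of0.
by congr (~~ _); apply/eqP/eqP => [/(can_inj (@code_ofK _ cA))|->].
Qed.

Lemma coupling_samplesE j t tests S T : (0 < size S)%N ->
  coupling_samples d qA F j t tests S T <->
  (0 < size T)%N /\
  approx_coupling d F j.+1%:R^-1 (@small R t) tests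
    (@frequency R d A bool cA bool_coding S) (@frequency R d A A cA cA T)
    (freq R (map (@config2_of d A A cA cA) T) (@mismatch d A)).
Proof.
move=> S0; rewrite /coupling_samples /approx_coupling.
have cE c1 c2 := @cntE R d A bool cA bool_coding S c1 c2 S0.
split.
  case/and5P => T0 c1 /allP c2 /allP c3 c4; split => //.
  have cE' c1 c2 := @cntE R d A A cA cA T c1 c2 T0.
  split.
  - exact/(almost_invariantE R).
  - by move=> u /c2; rewrite (close_ratiosE R) // cE cE'.
  - by move=> w /c3; rewrite (leq_small R) // cE'.
  - by move: c4; rewrite (leq_small_shift R) // mismatchesE.
case=> T0 [c1 c2 c3 c4]; have cE' c1 c2 := @cntE R d A A cA cA T c1 c2 T0.
apply/and5P; split => //.
- exact/(almost_invariantE R).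
- by apply/allP => u /c2; rewrite (close_ratiosE R) // cE cE'.
- by apply/allP => w /c3; rewrite (leq_small R) // cE'.
- by rewrite (leq_small_shift R) // mismatchesE.
Qed.

End CountingConditions.

(** * Measures determined by their values on events *)

Section Image.
Variables (d : nat) (A B : alphabetType) (R : realType).
Variable phi : config d A -> config d B.
Hypothesis phi_cylinder : forall E, cylinder E -> cylinder (phi @^-1` E).

Lemma cylinder_measurable_fun :
  measurable_fun setT (phi : borel (config d A) -> borel (config d B)).
Proof.
apply: (measurability _ (borel_cylinder_generated d B)).
move=> _ [E cE <-]; rewrite setTI.
by apply: cylinder_borel; apply: phi_cylinder.
Qed.

Lemma preimage_borel (U : set (borel (config d B))) : measurable U ->
  measurable (phi @^-1` U : set (borel (config d A))).
Proof.
by move=> mU; rewrite -[X in measurable X]setTI; apply: cylinder_measurable_fun.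
Qed.

Lemma image_probability (mu : probability (borel (config d A)) R) :
  exists nu : probability (borel (config d B)) R,
    forall U, nu U = mu (phi @^-1` U).
Proof.
pose f : {mfun borel (config d A) >-> borel (config d B)} :=
  mfun_Sub (mem_set cylinder_measurable_fun).
by exists (distribution mu f).
Qed.

End Image.

Section EventUniqueness.
Variables (d : nat) (A B : alphabetType) (cA : coding A) (cB : coding B).
Variable R : realType.

Lemma probability_lty (X : ptopologicalType) (m : probability (borel X) R) :
  (m setT < +oo)%E.
Proof. by rewrite probability_setT ltry. Qed.

Lemma event_eq (m1 m2 : probability (borel (config d A)) R) :
  (forall c, m1 (event cA c) = m2 (event cA c)) ->
  forall U, measurable U -> m1 U = m2 U.
Proof.
move=> m12; apply: (@borel_measure_eq d A R [set event cA c | c in setT]).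
- move=> c; exists (coded cA c) => //.
  by apply/seteqP; split => x; [move/eventb_coded | move=> xc; apply/eventb_coded].
- by move=> _ [c _ <-]; apply: cylinder_borel; apply: eventb_cylinder.
- move=> _ _ [c _ <-] [c' _ <-]; exists (c ++ c') => //.
  apply/seteqP; split => x; rewrite /event /= eventb_cat; first by move=> /andP.
  by move=> [-> ->].
- exact: (eq_trans (probability_setT m1) (esym (probability_setT m2))).
- exact: probability_lty.
- by move=> _ [c _ <-]; apply: m12.
Qed.

Lemma event2_eq (m1 m2 : probability (borel (config d (A * B)%type)) R) :
  (forall c1 c2, m1 (event2 cA cB c1 c2) = m2 (event2 cA cB c1 c2)) ->
  forall U, measurable U -> m1 U = m2 U.
Proof.
move=> m12; apply: (@borel_measure_eq d (A * B)%type R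
  [set E | exists c1 c2, E = event2 cA cB c1 c2]).
- by move=> c; have [c1 [c2 ->]] := elementary_event2 cA cB c; exists c1, c2.
- by move=> _ [c1 [c2 ->]]; apply: cylinder_borel; apply: event2_cylinder.
- by move=> _ _ [c1 [c2 ->]] [c1' [c2' ->]]; rewrite event2I; do 2 eexists.
- exact: (eq_trans (probability_setT m1) (esym (probability_setT m2))).
- exact: probability_lty.
- by move=> _ [c1 [c2 ->]]; apply: m12.
Qed.

Definition valuation (mu : probability (borel (config d (A * B)%type)) R) c1 c2 :=
  fine (mu (event2 cA cB c1 c2)).

Lemma valuationE (mu : probability (borel (config d (A * B)%type)) R) c1 c2 :
  mu (event2 cA cB c1 c2) = (valuation mu c1 c2)%:E.
Proof.
rewrite fineK // fin_num_measure //.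
by apply: cylinder_borel; apply: event2_cylinder.
Qed.

Definition nonpositive : set R := [set x | x <= 0].

Lemma nonpositive_dist (x y : R) : nonpositive `|x - y| <-> x = y.
Proof.
rewrite /nonpositive /= normr_le0 subr_eq0; split => [/eqP//|->]; exact: eqxx.
Qed.

Lemma event2_translate r c1 c2 :
  event2 cA cB (translate d r c1) (translate d r c2) =
  shift_config (site_of d r) @^-1` event2 cA cB c1 c2.
Proof. by apply/seteqP; split => z; rewrite /event2 /= !eventb_translate. Qed.

(** The test with the list of coordinates of a site k compares the masses of an
    event and of its translate by k, and events determine measures. *)
Lemma shift_invariantP (mu : probability (borel (config d (A * B)%type)) R) :
  shift_invariant mu <->
  forall tests, approx_invariant d nonpositive tests (valuation mu).
Proof.
split => [inv tests u _|inv k U mU].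
  apply/nonpositive_dist; rewrite /valuation event2_translate inv //.
  by apply: cylinder_borel; apply: event2_cylinder.
have [nu nuE] := @image_probability _ _ _ R _ (@shift_cylinder d (A * B)%type k) mu.
rewrite -nuE; apply: event2_eq => // c1 c2; rewrite nuE.
rewrite -[k]coordsK -event2_translate !valuationE; congr (_%:E).
have u1 : (c1, c2, coords k) \in [:: (c1, c2, coords k)] by rewrite mem_head.
by have /nonpositive_dist /= := inv _ _ u1.
Qed.

End EventUniqueness.

(** * Measures on subshifts *)

Section Subshift.
Variables (d : nat) (A : alphabetType) (R : realType).
Variable F : seq (pattern d A).

Lemma shift_config0 (x : config d A) : shift_config 0 x = x.
Proof. by apply/funext => k; rewrite /shift_config add0r. Qed.

Lemma SFT_bigcap : SFT F = \bigcap_n \bigcap_(w in [set w | w \in F])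
  shift_config (site_of d (dec n)) @^-1` (~` elementary (val w)).
Proof.
apply/seteqP; split => [x xF n _ w wF|x xF w wF k].
  exact: (xF w wF).
have := xF (enc (coords k)) I w wF; rewrite encK coordsK; exact.
Qed.

Lemma SFT_closed : closed (SFT F).
Proof.
rewrite SFT_bigcap; apply: closed_bigI => n _; apply: closed_bigI => w _.
apply: cylinder_closed; apply: shift_cylinder; apply: cylinderC.
exact: elementary_cylinder.
Qed.

Lemma SFT_borel : measurable (SFT F : set (borel (config d A))).
Proof. by apply: closed_borel; apply: SFT_closed. Qed.

(** The complement of the subshift is a countable union of translates of
    elementary cylinders, all of the same mass by invariance. *)
Lemma SFT_full (mu : probability (borel (config d A)) R) : shift_invariant mu ->
  mu (SFT F) = 1%E <-> forall w, w \in F -> mu (elementary (val w)) = 0%E.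
Proof.
move=> inv.
have me w : measurable (elementary (val w) : set (borel (config d A))).
  by apply: cylinder_borel; apply: elementary_cylinder.
have mSC : measurable (~` SFT F : set (borel (config d A))).
  exact: (measurableC SFT_borel).
split => [F1 w wF|F0].
  have : mu (~` SFT F) = 0%E by rewrite (probability_setC _ SFT_borel) F1 subee.
  move=> C0; apply/eqP; rewrite eq_le measure_ge0 andbT -C0.
  apply: le_measure; rewrite ?inE // => x xw xF.
  by have := xF w wF 0; rewrite shift_config0; apply.
suff C0 : mu (~` SFT F) = 0%E.
  by rewrite -[SFT F]setCK (probability_setC _ mSC) C0 sube0.
apply: measure_negligible => //.
pose U := \bigcup_(w in [set` F]) elementary (val w).
have mU : measurable (U : set (borel (config d A))).
  by apply: fin_bigcup_measurable => // w _; apply: me.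
have U0 : mu U = 0%E.
  apply: measure_negligible => //.
  rewrite /U bigcup_seq; elim: (F) F0 => [_|w s IHs F0].
    by rewrite big_nil; apply: negligible_set0.
  rewrite big_cons; apply: negligibleU.
    by apply/negligibleP => //; apply: F0; rewrite mem_head.
  by apply: IHs => v vs; apply: F0; rewrite in_cons vs orbT.
rewrite SFT_bigcap setC_bigcap; apply: negligible_bigcup => n.
exists (shift_config (site_of d (dec n)) @^-1` U); split.
- exact: (preimage_borel (@shift_cylinder d A _)).
- exact: (eq_trans (inv _ _ mU) U0).
- rewrite setC_bigcap => x [w wF /= /contrapT xw].
  by exists w.
Qed.

End Subshift.

(** * Bernoulli noise through the addition of one site *)

Section Bernoulli.
Variable R : realType.

(** The Bernoulli probability of B as a real number, also for parameters
    outside of [0, 1]. *)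
Definition bernoulli_weight (p : R) (B : set bool) : R :=
  p * `[<B true>]%:R + (1 - p) * `[<B false>]%:R.

Lemma bernoulli_weightE (p : R) B : 0 <= p <= 1 ->
  bernoulli_prob p B = (bernoulli_weight p B)%:E.
Proof.
by move=> p01; rewrite bernoulli_probE // !diracE.
Qed.

End Bernoulli.

Section Noise.
Variables (R : realType) (d : nat) (A : alphabetType) (cA : coding A).
Variable lambda : probability (borel (config d (A * bool)%type)) R.
Local Notation f := (@valuation d A bool cA bool_coding R lambda).
Local Notation nu := (pushforward lambda
  (@proj2c d A bool : borel (config d (A * bool)%type) -> borel (config d bool))).

Definition constrained (s : seq (site d)) (B : site d -> set bool) : set
  (config d bool) :=
  [set y | forall k, k \in s -> B k (y k)].

Lemma constrained_cylinder s B : cylinder (constrained s B).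
Proof. by exists s => x y xy xB k ks; rewrite xy //; apply: xB. Qed.

Lemma noise_law_event c : nu (event bool_coding c) = (f [::] c)%:E.
Proof.
by rewrite -valuationE /pushforward; congr (lambda _); apply/seteqP; split.
Qed.

Lemma proj2_borel E : cylinder E -> measurable
  (@proj2c d A bool @^-1` E : set (borel (config d (A * bool)%type))).
Proof. by move=> cE; apply: cylinder_borel; apply: proj2c_cylinder. Qed.

Lemma eventb1 r c (y : config d bool) :
  eventb bool_coding ((1%N :: r) :: c) y = y (site_of d r) && eventb bool_coding c y.
Proof. by rewrite /eventb /=; case: (y _). Qed.

Lemma event1 r c (y : config d bool) :
  event bool_coding ((1%N :: r) :: c) y <-> y (site_of d r) /\ event bool_coding c y.
Proof. by rewrite -[_ <-> _]/(is_true _ <-> _) eventb1; split => [/andP[]|[->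
  ?]]. Qed.

Lemma noise_at0_event (y : config d bool) :
  event bool_coding noise_at0 y <-> y 0.
Proof. by split => [/event1[]|y0]; [|apply/event1; split => //]; rewrite
  site_of0. Qed.

Lemma freshP r c : fresh d r c ->
  forall e, e \in c -> site_of d (behead e) != site_of d r.
Proof. by move=> /allP fr e /fr; rewrite site_index_inj. Qed.

(** The condition of [iid_bernoulli] applies to the sites that occur in c,
    together with the site of r. The set of values allowed at a site collects
    all the constraints of c at this site, since sites may occur repeatedly in
    c. *)
Lemma noise_of_iid p : 0 <= p <= 1 -> iid_bernoulli p nu ->
  f [::] noise_at0 = p /\
  forall r c, fresh d r c -> f [::] ((1%N :: r) :: c) = f [::] c * p.
Proof.
move=> p01 iid.
have w1 : bernoulli_weight p [set true] = p.
  by rewrite /bernoulli_weight asboolT // asboolF // mulr1 mulr0 addr0.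
split.
  have := iid [:: 0] (fun=> [set true]) isT.
  rewrite big_seq1 bernoulli_weightE // w1 => H.
  apply: EFin_inj; rewrite -H -noise_law_event; congr (nu _).
  apply/seteqP; split => y.
    by move=> /noise_at0_event y0 k; rewrite mem_seq1 => /eqP->.
  by move=> y0; apply/noise_at0_event/(y0 0); rewrite mem_seq1.
move=> r c fr.
pose s := undup [seq site_of d (behead e) | e <- c].
pose B k := [set b : bool | all (fun e =>
  (site_of d (behead e) == k) ==> (nat_of_bool b == head 0%N e)) c].
pose B' k := if k == site_of d r then [set true] else B k.
have cE y : eventb bool_coding c y <-> constrained s B y.
  split => [/allP yc k _|yB].
    by apply/allP => e ec; apply/implyP => /eqP <-; apply: yc.
  apply/allP => e ec.
  have : site_of d (behead e) \in s by rewrite mem_undup; apply: map_f.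
  by move=> /yB /allP /(_ e ec); rewrite eqxx.
have rs : site_of d r \notin s.
  rewrite mem_undup; apply/negP => /mapP[e ec rE].
  by have := freshP fr ec; rewrite rE eqxx.
have us : uniq s by apply: undup_uniq.
have := iid s B us; have := iid (site_of d r :: s) B'.
rewrite /= rs us => /(_ isT).
rewrite big_cons {2}/B' eqxx bernoulli_weightE // w1.
rewrite (eq_big_seq (fun k => (bernoulli_weight p (B k))%:E)); last first.
  move=> k ks; rewrite /B' ifF ?bernoulli_weightE //.
  by apply/negP => /eqP kr; rewrite -kr ks in rs.
rewrite [in X in _ -> X -> _](eq_bigr (fun k => (bernoulli_weight p (B
  k))%:E)); last first.
  by move=> k _; rewrite bernoulli_weightE.
rewrite !prodEFin -EFinM => H1 H2.
have -> : f [::] c = \prod_(j <- s) bernoulli_weight p (B j).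
  apply: EFin_inj; rewrite -H2 -noise_law_event; congr (nu _).
  by apply/seteqP; split => y /cE.
rewrite mulrC; apply: EFin_inj; rewrite -H1 -noise_law_event; congr (nu _).
apply/seteqP; split => y.
  move=> /event1[yr /cE yc] k; rewrite in_cons /B'.
  by case: ifP => [/eqP->//|_ /= ks]; apply: yc.
move=> yB; apply/event1; split.
  by have := yB (site_of d r); rewrite mem_head /B' eqxx => /(_ isT).
apply/cE => k ks; have := yB k; rewrite in_cons ks orbT /B' ifF => [/(_ isT)//|].
by apply/negP => /eqP kr; rewrite -kr ks in rs.
Qed.

Local Notation p := (f [::] noise_at0).

(** By induction on the number of sites, for the probability that the noise
    satisfies given constraints c and takes a value in B k at each new site k.
    Adding one site k, the condition on it holds always or never, or means that
    the symbol is 1, or that it is not 1. The third case is the hypothesis,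
    where the constraint at k joins c, and the fourth one follows by
    subtraction. *)
Lemma iid_of_noise :
  (forall r c, fresh d r c -> f [::] ((1%N :: r) :: c) = f [::] c * p) ->
  0 <= p <= 1 /\ iid_bernoulli p nu.
Proof.
move=> indep.
have p01 : 0 <= p <= 1.
  rewrite -!lee_fin -noise_law_event /pushforward measure_ge0 /=.
  apply: (@probability_le1 _ _ _ lambda); apply: proj2_borel.
  exact: eventb_cylinder.
split; first exact: p01.
move=> s B us.
have mono (E : set (config d bool)) : cylinder E ->
    nu E = (fine (nu E))%:E.
  by move=> cE; rewrite fineK // fin_num_measure //; apply: proj2_borel.
have key c : (forall e, e \in c -> site_of d (behead e) \notin s) ->
  nu (event bool_coding c `&` constrained s B) =
  (f [::] c * \prod_(k <- s) bernoulli_weight p (B k))%:E.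
  elim: s us c => [_|k s IHs /= /andP[nks us]] c cs.
    rewrite big_nil mulr1 -noise_law_event; congr (nu _); apply/seteqP; split
      => [y []//|y yc].
    by split.
  have IH0 := IHs us c _.
  have {}IH0 : nu (event bool_coding c `&` constrained s B) =
      (f [::] c * \prod_(k <- s) bernoulli_weight p (B k))%:E.
    by apply: IH0 => e /cs; rewrite in_cons negb_or => /andP[].
  have fr : fresh d (coords k) c.
    apply/allP => e /cs; rewrite site_index_inj coordsK in_cons negb_or.
    by case/andP.
  have IH1 : nu (event bool_coding ((1%N :: coords k) :: c) `&` constrained s B) =
      (f [::] c * p * \prod_(k <- s) bernoulli_weight p (B k))%:E.
    rewrite -(indep _ _ fr); apply: IHs => // e; rewrite in_cons => /orP[/eqP->|/cs].
      by rewrite /= coordsK.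
    by rewrite in_cons negb_or => /andP[].
  rewrite big_cons.
  set E1 := event bool_coding ((1%N :: coords k) :: c) `&` constrained s B in IH1.
  set E0 := event bool_coding c `&` constrained s B in IH0.
  set Pi := \prod_(k <- s) _ in IH0 IH1 *.
  have E1E : E1 = [set y : config d bool | y k /\ E0 y].
    apply/seteqP; split => y.
      by case=> /event1; rewrite coordsK => -[].
    by case=> yk [yc yB]; split => //; apply/event1; rewrite coordsK.
  have -> : event bool_coding c `&` constrained (k :: s) B =
      [set y : config d bool | B k (y k) /\ E0 y].
    apply/seteqP; split => y.
      case=> yc yB; split; first by apply: yB; rewrite mem_head.
      by split => // l ls; apply: yB; rewrite in_cons ls orbT.
    case=> yk [yc yB]; split => // l; rewrite in_cons => /orP[/eqP->//|].
    exact: yB.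
  have cE1 : cylinder E1.
    by apply: cylinderI; [apply: eventb_cylinder|apply: constrained_cylinder].
  have cE0 : cylinder E0.
    by apply: cylinderI; [apply: eventb_cylinder|apply: constrained_cylinder].
  rewrite /bernoulli_weight.
  case: (pselect (B k true)) => Bt; case: (pselect (B k false)) => Bf;
    rewrite ?(asboolT Bt) ?(asboolT Bf) ?(asboolF Bt) ?(asboolF Bf) ?mulr1 ?mulr0.
  - rewrite (_ : [set y : config d bool | B k (y k) /\ E0 y] = E0).
      by rewrite IH0 subrKC mul1r.
    apply/seteqP; split => y; first by case.
    by move=> yE; split => //; case: (y k).
  - rewrite (_ : [set y : config d bool | B k (y k) /\ E0 y] = E1).
      by rewrite IH1 addr0 mulrA.
    rewrite E1E; apply/seteqP; split => y [yk yE]; split => //.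
      by move: yk; case: (y k).
    by rewrite yk.
  - have -> : [set y : config d bool | B k (y k) /\ E0 y] = E0 `\` E1.
      rewrite E1E; apply/seteqP; split => y.
        case=> yk yE; split => // -[yk' _].
        by rewrite yk' in yk.
      case=> yE nyE; split => //.
      by case yk: (y k); [exfalso; apply: nyE | exact: Bf].
    have E10 : E1 `<=` E0 by rewrite E1E => z [].
    have : nu E0 = (nu (E0 `\` E1) + nu E1)%E.
      rewrite /pushforward -measureU ?preimage_setU.
      - by congr (lambda _); rewrite -preimage_setU setDKU.
      - by apply: proj2_borel; apply: cylinderI => //; apply: cylinderC.
      - exact: proj2_borel.
      - by rewrite -preimage_setI setDE -setIA setICl setI0 preimage_set0.
    rewrite IH0 IH1 mono; last by apply: cylinderI => //; apply: cylinderC.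
    rewrite -EFinD => HH; have H := EFin_inj HH; congr (_%:E).
    by rewrite -[LHS](addrK (f [::] c * p * Pi)) -H; ring.
  - rewrite (_ : [set y : config d bool | B k (y k) /\ E0 y] = set0).
      by rewrite /pushforward preimage_set0 measure0 addr0 mul0r mulr0.
    by apply/seteqP; split => y // [yk _]; move: yk; case: (y k).
have := key [::] (fun e => ltac:(by [])).
rewrite (_ : _ `&` _ = constrained s B); last first.
  by apply/seteqP; split => [y []|y yB].
rewrite /constrained => ->.
rewrite (_ : f [::] [::] = 1) ?mul1r; last first.
  rewrite /valuation (_ : event2 _ _ _ _ = setT) ?probability_setT //.
  by apply/seteqP; split.
rewrite -prodEFin; apply: eq_bigr => k _.
by rewrite bernoulli_weightE.
Qed.

End Noise.

(** * Noisy measures through their values on events *)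

Section NoisyMeasures.
Variables (R : realType) (d : nat) (A : alphabetType) (cA : coding A).
Variable F : seq (pattern d A).

Definition coded_patterns := [seq coded cA (val w) | w <- F].
Local Notation nF := coded_patterns.

Lemma noiseless_event (w : pattern d A) :
  elementary (val (noiseless w)) =
  event2 cA bool_coding (coded cA (val w))
    [seq 0%N :: behead b | b <- coded cA (val w)].
Proof.
apply/seteqP; split => z.
  move=> zw; apply/andP; split.
    apply/eventb_coded => e ew.
    by rewrite /proj1c (zw (e.1, (e.2, false))) //; apply/mapP; exists e.
  rewrite /eventb all_map all_map; apply/allP => e ew /=.
  rewrite coordsK /proj2c (zw (e.1, (e.2, false))) //.
  by apply/mapP; exists e.
move=> /andP[/eventb_coded z1 z2] _ /mapP[e ew ->] /=.
have := z1 e ew; move: z2; rewrite /eventb all_map all_map => /allP/(_ e ew) /=.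
rewrite coordsK /proj1c /proj2c eqb0; case: (z e.1) => a b /=.
by move=> /negbTE -> ->.
Qed.

(** The parameter of the noise is the probability of noise at the origin, so
    that the bound on it is a condition on one event. *)
Lemma noisy_measuresP (eps : R) lambda : 0 <= eps <= 1 ->
  noisy_measures F eps lambda <->
  forall tests, approx_noisy d nF eps (@nonpositive R) tests
    (valuation cA bool_coding lambda).
Proof.
move=> /andP[eps0 eps1].
pose tilF := [seq noiseless w | w <- F].
have zeroP w : lambda (elementary (val (noiseless w))) = 0%E <->
    nonpositive (valuation cA bool_coding lambda (coded cA (val w))
      [seq 0%N :: behead b | b <- coded cA (val w)]).
  rewrite noiseless_event valuationE /nonpositive /=.
  have v0 : 0 <= valuation cA bool_coding lambda (coded cA (val w))
      [seq 0%N :: behead b | b <- coded cA (val w)].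
    by rewrite /valuation fine_ge0.
  split => [[->]//|v1]; congr (_%:E).
  by apply/eqP; rewrite eq_le v1.
split.
  case=> -[inv full] [p /andP[p0 peps] iid] tests.
  have p01 : 0 <= p <= 1 by rewrite p0 (le_trans peps).
  have [fp indep] := noise_of_iid cA p01 iid.
  split => [|w||u _].
  - by move: inv => /(shift_invariantP cA bool_coding).
  - move=> /mapP[v vF ->]; apply/zeroP.
    by have /(SFT_full _ inv) := full; apply; apply: map_f.
  - by rewrite /nonpositive /= fp subr_le0.
  - by move=> /indep ->; rewrite fp; apply/nonpositive_dist.
move=> H.
have inv : shift_invariant lambda.
  by apply/(shift_invariantP cA bool_coding) => tests; have [] := H tests.
have [|p01 iid] := @iid_of_noise R d A cA lambda.
  move=> r c fr.
  have [_ _ _ /(_ (c, c, r))] := H [:: (c, c, r)].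
  by rewrite mem_head => /(_ isT fr)/nonpositive_dist.
split; last first.
  exists (valuation cA bool_coding lambda [::] noise_at0) => //.
  have [_ _ + _] := H [::]; rewrite /nonpositive /= subr_le0 => ->.
  by move: p01 => /andP[-> _].
split => //; apply/(SFT_full _ inv) => _ /mapP[w wF ->].
apply/zeroP; have [_ + _ _] := H [::]; apply.
exact: map_f.
Qed.

End NoisyMeasures.

(** * Passing to the limit *)

Section Limits.
Variables (R : realType) (U : set_system nat).
Hypothesis FU : UltraFilter U.
Hypothesis ooU : \oo `<=` U.

Lemma eventually_ge n : U [set k | (n <= k)%N].
Proof. by apply: ooU; exists n. Qed.

(** If l were positive, x_k would eventually exceed l / 2, and k x_k could not
    be bounded. *)
Lemma limit_nonpositive C (x : nat -> R) l :
  (\forall k \near U, k%:R * x k <= C) -> x k @[k --> U] --> l -> l <= 0.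
Proof.
move=> xC xl; rewrite leNgt; apply/negP => l0.
have xl2 : \forall k \near U, l / 2 < x k.
  by apply: (cvgr_gt l) => //; rewrite ltr_pdivrMr // ltr_pMr // ltr1n.
pose n := (Num.trunc (`|C| / (l / 2))).+1.
have nC : `|C| < n%:R * (l / 2).
  by rewrite -ltr_pdivrMr ?divr_gt0 // truncnS_gt.
have [k [[/= kC kl] nk]] := @filter_ex _ U _ _
  (@filterI _ U _ _ _ (@filterI _ U _ _ _ xC xl2) (eventually_ge n)).
have : n%:R * (l / 2) <= k%:R * x k.
  by rewrite ler_pM // ?ler_nat ?divr_ge0 // ltW.
have := ler_norm C; lra.
Qed.

(** Every test belongs to all but finitely many of these finite lists. *)
Definition tests_upto k : seq test := [seq dec i | i <- iota 0 k].

Lemma mem_tests_upto u k : (enc u < k)%N -> u \in tests_upto k.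
Proof.
by move=> uk; apply/mapP; exists (enc u); rewrite ?encK // mem_iota.
Qed.

Lemma near_tests_upto u : \forall k \near U, u \in tests_upto k.
Proof.
apply: filterS (eventually_ge (enc u).+1) => k; exact: mem_tests_upto.
Qed.

Variables (d : nat) (F : seq (seq (seq nat))).
Implicit Types f g : nat -> seq (seq nat) -> seq (seq nat) -> R.

Lemma approx_invariant_limit f (f' : seq (seq nat) -> seq (seq nat) -> R) :
  (forall c1 c2, f k c1 c2 @[k --> U] --> f' c1 c2) ->
  (forall k, approx_invariant d (@small R k) (tests_upto k) (f k)) ->
  forall tests, approx_invariant d (@nonpositive R) tests f'.
Proof.
move=> fg H tests u _.
apply: (@limit_nonpositive 1 (fun k => `|f k u.1.1 u.1.2 -
    f k (translate d u.2 u.1.1) (translate d u.2 u.1.2)|)).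
  by apply: filterS (near_tests_upto u) => k /H.
by apply: cvg_norm; apply: cvgB.
Qed.

Lemma approx_noisy_limit (eps : R) f (f' : seq (seq nat) -> seq (seq nat) -> R) :
  (forall c1 c2, f k c1 c2 @[k --> U] --> f' c1 c2) ->
  (forall k, approx_noisy d F eps (@small R k) (tests_upto k) (f k)) ->
  forall tests, approx_noisy d F eps (@nonpositive R) tests f'.
Proof.
move=> fg H tests; split => [|w wF||u _ fr].
- by apply: (approx_invariant_limit fg) => k; have [] := H k.
- apply: (@limit_nonpositive 1 (fun k => f k w [seq 0%N :: behead b | b <- w])) => //.
  by apply: nearW => k; have [_ + _ _] := H k; apply.
- apply: (@limit_nonpositive 1 (fun k => f k [::] noise_at0 - eps)).
    by apply: nearW => k; have [_ _ + _] := H k; apply.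
  by apply: cvgB => //; apply: cvg_cst.
- apply: (@limit_nonpositive 1 (fun k => `|f k [::] ((1%N :: u.2) :: u.1.2) -
    f k [::] u.1.2 * f k [::] noise_at0|)).
    by apply: filterS (near_tests_upto u) => k uk; have [_ _ _ +] := H k; apply.
  by apply: cvg_norm; apply: cvgB => //; apply: cvgM.
Qed.

(** The values f k need not converge to f' beyond the tests in consideration:
    it suffices that they are within 1 / k of it on them. The bound 2 adds this
    error to that of the coupling. *)
Lemma approx_coupling_limit (delta : R) f g (f' g' : seq (seq nat) -> seq (seq
  nat) -> R)
    (mis : nat -> R) mis' :
  (forall c1 c2, g k c1 c2 @[k --> U] --> g' c1 c2) ->
  mis k @[k --> U] --> mis' ->
  (forall k u, u \in tests_upto k ->
     k%:R * `|f k u.1.1 [::] - f' u.1.1 [::]| <= 1) ->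
  (forall k, approx_coupling d F delta (@small R k) (tests_upto k)
     (f k) (g k) (mis k)) ->
  forall tests, approx_coupling d F delta (@nonpositive R) tests f' g' mis'.
Proof.
move=> gg' mm' ff' H tests; split => [|u _|w wF|].
- by apply: (approx_invariant_limit gg') => k; have [] := H k.
- apply: (@limit_nonpositive 2 (fun k => `|g k u.1.1 [::] - f' u.1.1 [::]|));
  last first.
    by apply: cvg_norm; apply: cvgB => //; apply: cvg_cst.
  apply: filterS (near_tests_upto u) => k uk.
  have [_ /(_ u uk) + _ _] := H k; rewrite /small /= => H1.
  have H2 := ff' k u uk.
  have H3 := ler_distD (f k u.1.1 [::]) (g k u.1.1 [::]) (f' u.1.1 [::]).
  rewrite (le_trans (ler_wpM2l (ler0n _ _) H3)) // mulrDr.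
  by rewrite (_ : 2 = 1 + 1 :> R) // lerD.
- apply: (@limit_nonpositive 1 (fun k => g k [::] w)) => //.
  by apply: nearW => k; have [_ _ + _] := H k; apply.
- apply: (@limit_nonpositive 1 (fun k => mis k - delta)).
    by apply: nearW => k; have [_ _ _ +] := H k; apply.
  by apply: cvgB => //; apply: cvg_cst.
Qed.

End Limits.

(** * Approximate conditions from exact ones *)

Section Region.
Variables (d : nat) (F : seq (seq (seq nat))).
Implicit Types (tests : seq test).

Lemma lt_region tests e : e \in entries d F tests ->
  (site_index d (behead e) < region d F tests)%N.
Proof.
rewrite /region; elim: (entries _ _ _) => //= e' s IHs.
rewrite in_cons => /orP[/eqP->|/IHs es]; last first.
  by rewrite (leq_trans es) ?leq_addl.
rewrite -addn1 leq_add2l; elim: s {IHs} => //= a s IHs.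
by rewrite (leq_trans IHs) ?leq_addl.
Qed.

Lemma noise_inside tests : inside d (region d F tests) noise_at0.
Proof.
by rewrite /inside /= andbT (@lt_region tests [:: 1%N]) // mem_head.
Qed.

Lemma site0_inside tests : (enc (coords (0%R : site d)) < region d F tests)%N.
Proof.
have /andP[] := noise_inside tests; rewrite /= site_index_site_of site_of0.
by [].
Qed.

Lemma pattern_inside tests w : w \in F -> inside d (region d F tests) w.
Proof.
move=> wF; apply/allP => e ew; apply: lt_region.
rewrite in_cons mem_cat; apply/orP; right; apply/orP; left.
by apply/flattenP; exists w.
Qed.

Lemma zeros_inside tests w : w \in F ->
  inside d (region d F tests) [seq 0%N :: behead b | b <- w].
Proof. by move=> /(pattern_inside tests); rewrite /inside all_map. Qed.

Lemma test_inside tests u (L := region d F tests) : u \in tests ->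
  [/\ inside d L u.1.1, inside d L u.1.2, inside d L (translate d u.2 u.1.1),
      inside d L (translate d u.2 u.1.2) & inside d L [:: 1%N :: u.2]].
Proof.
move=> ut.
have sub c : {subset c <= (1%N :: u.2) :: (u.1.1 ++ u.1.2 ++
    (translate d u.2 u.1.1 ++ translate d u.2 u.1.2))} -> inside d L c.
  move=> sub; apply/allP => e /sub eu; apply: lt_region.
  rewrite in_cons mem_cat; apply/orP; right; apply/orP; right.
  apply/flattenP; eexists; last exact: eu.
  by apply/mapP; exists u.
by split; apply: sub => e; rewrite ?mem_seq1 in_cons !mem_cat => ->;
  rewrite ?orbT.
Qed.

Variable R : realType.
Implicit Types (f g : seq (seq nat) -> seq (seq nat) -> R).

Definition near_on L (eta : R) f f' := forall c1 c2,
  inside d L c1 -> inside d L c2 -> `|f c1 c2 - f' c1 c2| <= eta.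

Lemma small_of_le t C eta (x : R) : x <= C * eta -> C * eta * t%:R <= 1 ->
  @small R t x.
Proof.
by move=> xC C1; rewrite /small /= mulrC (le_trans (ler_wpM2r _ xC)) ?ler0n.
Qed.

Lemma dist_triangle (x y x' y' eta : R) : x' = y' ->
  `|x - x'| <= eta -> `|y - y'| <= eta -> `|x - y| <= 2 * eta.
Proof.
move=> -> xe ye; rewrite mulrDl mul1r.
by rewrite (le_trans (ler_distD y' x y)) // lerD // distrC.
Qed.

Lemma le_near (x x' eta : R) : x' <= 0 -> `|x - x'| <= eta -> x <= eta.
Proof. by move=> x0 /ler_normlP[_]; lra. Qed.

(** An exact condition for f' becomes one for f, the error being at most eta
    for each value that occurs in it. In the independence condition these are
    three values, the product contributing two since all values are in [0,
    1]. *)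
Lemma approx_noisy_near eps eta t tests tests' f f' :
  {subset tests <= tests'} ->
  0 <= eta -> 3 * eta * t%:R <= 1 ->
  (forall c1 c2, 0 <= f c1 c2 <= 1) -> (forall c1 c2, 0 <= f' c1 c2 <= 1) ->
  near_on (region d F tests') eta f f' ->
  approx_noisy d F eps (@nonpositive R) tests f' ->
  approx_noisy d F eps (@small R t) tests f.
Proof.
move=> sub eta0 eta1 f01 f'01 ff' [c1 c2 c3 c4].
have noise := noise_inside tests'.
have sm (x : R) : x <= 3 * eta -> @small R t x by move=> x3; apply: small_of_le eta1.
split => [u ut|w wF||u ut fr].
- have [i1 i2 i3 i4 i5] := test_inside (sub _ ut).
  apply: sm; have /nonpositive_dist E := c1 u ut.
  apply: le_trans (dist_triangle E (ff' _ _ i1 i2) (ff' _ _ i3 i4)) _.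
  by rewrite ler_wpM2r // ler_nat.
- apply: sm.
  have := le_near (c2 w wF) (ff' _ _ (pattern_inside tests' wF) (zeros_inside
    tests' wF)).
  by lra.
- apply: sm; have := ff' [::] _ isT noise.
  by move: c3; rewrite /nonpositive /= => c3 /ler_normlP[_]; lra.
- apply: sm; have [i1 i2 i3 i4 i5] := test_inside (sub _ ut).
  have /nonpositive_dist E := c4 u ut fr.
  have i6 : inside d (region d F tests') ((1%N :: u.2) :: u.1.2).
    by move: i5; rewrite /inside /= andbT => ->.
  have := ff' [::] _ isT i6; have := ff' [::] _ isT i2; have := ff' [::] _ isT noise.
  rewrite E; move: (f01 [::] u.1.2) (f'01 [::] noise_at0).
  set a := f _ u.1.2; set b := f _ noise_at0; set a' := f' _ u.1.2.
  set b' := f' _ noise_at0; set z := f _ _ => a01 b01 bb aa zz.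
  have E2 : z - a * b = (z - a' * b') - (a - a') * b' - a * (b - b') by ring.
  rewrite E2 (le_trans (ler_normB _ _)) // (_ : 3 * eta = (eta + eta) + eta);
    last by ring.
  apply: lerD; last first.
    rewrite normrM -[leRHS]mul1r ler_pM // ger0_norm; by case/andP: a01.
  rewrite (le_trans (ler_normB _ _)) // lerD //.
  by rewrite normrM -[leRHS]mulr1 ler_pM // ger0_norm; case/andP: b01.
Qed.

Lemma approx_coupling_near delta (eta : R) t tests f f' g g' mis mis' :
  0 <= eta -> 2 * eta * t%:R <= 1 ->
  (forall u, u \in tests -> `|f u.1.1 [::] - f' u.1.1 [::]| <= eta) ->
  near_on (region d F tests) eta g g' -> `|mis - mis'| <= eta ->
  approx_coupling d F delta (@nonpositive R) tests f' g' mis' ->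
  approx_coupling d F delta (@small R t) tests f g mis.
Proof.
move=> eta0 eta1 ff' gg' mm' [c1 c2 c3 c4].
have sm (x : R) : x <= 2 * eta -> @small R t x by move=> x3; apply: small_of_le eta1.
split => [u ut|u ut|w wF|].
- have [i1 i2 i3 i4 i5] := test_inside ut.
  apply: sm; have /nonpositive_dist E := c1 u ut.
  exact: dist_triangle E (gg' _ _ i1 i2) (gg' _ _ i3 i4).
- have [i1 i2 i3 i4 i5] := test_inside ut.
  apply: sm; have /nonpositive_dist E := c2 u ut.
  exact: dist_triangle E (gg' _ [::] i1 isT) (ff' u ut).
- apply: sm; have := le_near (c3 w wF) (gg' [::] _ isT (pattern_inside tests wF)).
  by lra.
- apply: sm; move: c4 mm'; rewrite /nonpositive /= => c4 /ler_normlP[_].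
  by lra.
Qed.

End Region.

(** * Compactness: couplings and certificates *)

Lemma mem_all_seqs (T : eqType) L (X s : seq T) :
  (s \in all_seqs L X) = (size s == L) && all (mem X) s.
Proof.
elim: L s => [|L IHL] s; first by rewrite mem_seq1; case: s.
rewrite /all_seqs /=; apply/flattenP/andP => [[_ /mapP[a aX ->] /mapP[r rL ->]]|].
  move: rL; rewrite [r \in _]IHL => /andP[sr ar].
  by rewrite /= eqSS sr ar andbT.
case: s => [|a s] [] //= sL /andP[aX sX].
exists [seq a :: r | r <- all_seqs L X]; first by apply/mapP; exists a.
by apply: map_f; rewrite IHL -eqSS sL.
Qed.

Section Compactness.
Variables (R : realType) (d : nat) (A : alphabetType) (cA : coding A).
Variable F : seq (pattern d A).
Local Notation nF := (coded_patterns cA F).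
Local Notation Q := (code_size cA).
Implicit Types (j e : nat).

Lemma mem_all_samples L N S :
  (S \in all_samples Q L N) = (size S == N) && all (@sample_shape A bool cA
    bool_coding L) S.
Proof.
rewrite mem_all_seqs; congr (_ && _); apply: eq_all => -[x y] /=.
have memQ q (s : seq nat) : all (mem (iota 0 q)) s = all (fun v => v < q)%N s.
  by apply: eq_all => v /=; rewrite mem_iota.
have mem2 (s : seq nat) : all (mem [:: 0; 1]%N) s = all (fun v => v < 2)%N s.
  exact: (memQ 2).
apply/flattenP/idP => [[_ /mapP[x' + ->] /mapP[y' + [-> ->]]]|].
  by rewrite !mem_all_seqs memQ mem2 /sample_shape /= => /andP[-> ->] /andP[-> ->].
rewrite /sample_shape /= => /and4P[x1 x2 y1 y2].
exists [seq (x, y) | y <- all_seqs L (iota 0 2)].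
  by apply/mapP; exists x; rewrite // mem_all_seqs memQ x1.
by apply: map_f; rewrite mem_all_seqs mem2 y1.
Qed.

Lemma code_size_gt0 (B : alphabetType) (cB : coding B) : (0 < code_size cB)%N.
Proof. exact: leq_ltn_trans (leq0n _) (code_lt cB point). Qed.

Lemma freq01 (X : Type) (S : seq X) E : 0 <= freq R S E <= 1.
Proof. by rewrite freq_ge0 freq_le1. Qed.

Lemma valuation01 (B : alphabetType) (cB : coding B) mu c1 c2 :
  0 <= @valuation d A B cA cB R mu c1 c2 <= 1.
Proof.
rewrite -!lee_fin -valuationE measure_ge0 /=.
by apply: probability_le1; apply: cylinder_borel; apply: event2_cylinder.
Qed.

Lemma mismatch_cylinder : cylinder (@mismatch d A).
Proof. by exists [:: 0] => x y xy; rewrite /mismatch /= xy ?mem_head. Qed.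

Lemma mismatch_regional L : (enc (coords (0%R : site d)) < L)%N ->
  regional L (@mismatch d A).
Proof. by move=> L0 z z' zz'; rewrite /mismatch /= zz'. Qed.

Lemma exists_ultrafilter : exists U : set_system nat,
  UltraFilter U /\ \oo `<=` U.
Proof. by apply: ultraFilterLemma; apply: eventually_filter. Qed.

(** Every noisy measure of level 1/(e+1) has a coupling of its first marginal
    with an invariant measure on the subshift, in which the symbols at the
    origin differ with probability at most 1/(j+1). Being stated through the
    values on events, this has the form that passes to limits. *)
Definition couplable j e :=
  forall lambda, noisy_measures F (e.+1%:R^-1 : R) lambda ->
  exists xi : probability (borel (config d (A * A)%type)) R,
    forall tests, approx_coupling d nF j.+1%:R^-1 (@nonpositive R) tests
      (valuation cA bool_coding lambda) (valuation cA cA xi)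
      (fine (xi (@mismatch d A))).

Lemma invS01 e : 0 <= (e.+1%:R^-1 : R) <= 1.
Proof. by rewrite invr_ge0 ler0n /= invf_le1 ?ltr0n // ler1n. Qed.

(** A noisy measure is approximated by samples S_k, to which the certificate
    for the accuracy k associates samples T_k of approximate couplings. A limit
    of their empirical measures is a coupling for the original measure, since
    the first marginals of T_k are close to those of S_k and these approximate
    the noisy measure. *)
Lemma couplable_of_certificate j e :
  (forall n, exists m, certificate d Q nF j e (dec n) (dec m)) ->
  couplable j e.
Proof.
move=> cert lambda /(noisy_measuresP cA _ _ (invS01 e)) noisy.
have [U [FU ooU]] := exists_ultrafilter.
have step k : exists ST : seq sample * seq sample,
    [/\ (0 < size ST.1)%N, (0 < size ST.2)%N,
      forall u, u \in tests_upto k -> k%:R * `|@frequency R d A bool cA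
        bool_coding ST.1 u.1.1 [::]
         - valuation cA bool_coding lambda u.1.1 [::]| <= 1 &
      approx_coupling d nF j.+1%:R^-1 (@small R k) (tests_upto k)
        (@frequency R d A bool cA bool_coding ST.1) (@frequency R d A A cA cA ST.2)
        (freq R (map (@config2_of d A A cA cA) ST.2) (@mismatch d A))].
  have [m] := cert (enc (k, tests_upto k)); rewrite encK.
  case: (dec m) => -[t tests] Us; rewrite /certificate /=.
  set L := region _ _ _; set N := (_ * _)%N => /allP cm.
  have P0 : (0 < precision k t)%N by rewrite /precision addn1.
  have K0 : (0 < (Q * 2) ^ L)%N by rewrite expn_gt0 muln_gt0 code_size_gt0.
  have N0 : (0 < N)%N by rewrite muln_gt0 P0.
  have [S [sS shS HS]] := @sampling d A bool cA bool_coding R lambda L N N0.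
  have S0 : (0 < size S)%N by rewrite sS.
  set eta := (precision k t)%:R^-1 : R.
  have etaE : ((Q * 2) ^ L)%:R / N%:R = eta.
    by rewrite /N natrM invfM mulrCA divff ?mulr1 // pnatr_eq0 -lt0n.
  rewrite etaE in HS.
  have eta0 : 0 <= eta by rewrite invr_ge0.
  have near : near_on d L eta (@frequency R d A bool cA bool_coding S)
      (valuation cA bool_coding lambda).
    by move=> c1 c2 i1 i2; apply: HS; apply: event2_regional.
  have noisyS : noisy_samples d Q nF e t tests S.
    apply/(noisy_samplesE R) => //.
    apply: (approx_noisy_near _ eta0 _ _ _ near (noisy tests)).
    - by move=> u ut; rewrite mem_cat ut orbT.
    - rewrite mulrAC -natrM ler_pdivrMr ?ltr0n // mul1r ler_nat /precision.
      by rewrite mulnDr -addnA (leq_trans _ (leq_addl _ _)) // leq_addr.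
    - by move=> *; apply: freq01.
    - exact: valuation01.
  have SA : S \in all_samples Q L N by rewrite mem_all_samples sS eqxx shS.
  have := cm S SA; rewrite noisyS /= => /allPn[T TU /negPn].
  move=> /(@coupling_samplesE R d A cA nF j k (tests_upto k) S T S0)[T0 cpl].
  exists (S, T); split => // u uk.
  have [|i1 _ _ _ _] := @test_inside d nF (tests_upto k ++ tests) u.
    by rewrite mem_cat uk.
  apply: (le_trans (ler_wpM2l (ler0n _ k) (near _ [::] i1 isT))).
  rewrite ler_pdivrMr ?ltr0n // mul1r ler_nat /precision mulnDr -addnA.
  by rewrite (leq_trans _ (leq_addr _ _)) // leq_pmull.
have [ST HST] := choice step.
have T0 k : (0 < size (map (@config2_of d A A cA cA) (ST k).2))%N.
  by rewrite size_map; have [] := HST k.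
have [xi xiE] := limit_probability R FU T0.
exists xi; apply: (approx_coupling_limit FU ooU
  (f := fun k => @frequency R d A bool cA bool_coding (ST k).1)
  (g := fun k => @frequency R d A A cA cA (ST k).2)
  (mis := fun k => freq R (map (@config2_of d A A cA cA) (ST k).2) (@mismatch d A))).
- by move=> c1 c2; apply: xiE; apply: event2_cylinder.
- exact: xiE mismatch_cylinder.
- by move=> k u uk; have [_ _ + _] := HST k; apply.
- by move=> k; have [] := HST k.
Qed.

(** If no m is a certificate, then for every k this holds for the first k
    tests, accuracy 1 / k, and the first k candidates for samples of couplings;
    so there are approximately noisy samples S_k for which none of these
    candidates is a coupling. A limit of the empirical measures is noisy, hence
    has a coupling. Samples T of this coupling are approximately coupled to S_k
    for suitable large k, where T is one of the first k candidates, a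
    contradiction. *)
Lemma certificate_of_couplable j e : couplable j e ->
  forall n, exists m, certificate d Q nF j e (dec n) (dec m).
Proof.
move=> cpl n; apply: contrapT => nocert.
have [U [FU ooU]] := exists_ultrafilter.
case nE : (dec n : nat * seq test) => [t tests].
pose Us k : seq (seq sample) := [seq dec i | i <- iota 0 k].
have step k : exists S : seq sample,
    [/\ (0 < size S)%N, noisy_samples d Q nF e k (tests_upto k) S &
      forall T, T \in Us k -> ~~ coupling_samples d Q nF j t tests S T].
  apply: contrapT => noS; apply: nocert.
  exists (enc (k, tests_upto k, Us k)); rewrite nE encK /certificate /=.
  apply/allP => S; rewrite mem_all_samples => /andP[/eqP sS _].
  apply/implyP => noisyS; apply/negP => /allP noT; apply: noS.
  exists S; split => //; rewrite sS muln_gt0 /precision addn1 /=.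
  by rewrite expn_gt0 muln_gt0 code_size_gt0.
have [S HS] := choice step.
have S0 k : (0 < size (S k))%N by have [] := HS k.
have S0' k : (0 < size (map (@config2_of d A bool cA bool_coding) (S k)))%N.
  by rewrite size_map.
have [lambda lamE] := limit_probability R FU S0'.
have lamE' c1 c2 : @frequency R d A bool cA bool_coding (S k) c1 c2
    @[k --> U] --> valuation cA bool_coding lambda c1 c2.
  by apply: lamE; apply: event2_cylinder.
have [|xi xiE] := cpl lambda.
  apply/(noisy_measuresP cA _ _ (invS01 e)).
  apply: (approx_noisy_limit FU ooU lamE') => k.
  by apply/(noisy_samplesE R) => //; have [] := HS k.
pose L := region d nF tests.
pose K := ((Q * Q) ^ L)%N.
(* The error 1 / (4 t + 1) is positive also for t = 0, and twice of it is at
   most 1 / t. *)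
pose N := ((4 * t).+1 * K)%N.
have K0 : (0 < K)%N by rewrite expn_gt0 muln_gt0 code_size_gt0.
have N0 : (0 < N)%N by rewrite muln_gt0.
have [T [sT _ HT]] := @sampling d A A cA cA R xi L N N0.
pose eta : R := (4 * t).+1%:R^-1.
have eta0 : 0 < eta by rewrite invr_gt0 ltr0n.
have etaE : K%:R / N%:R = eta.
  by rewrite /N natrM invfM mulrCA divff ?mulr1 // pnatr_eq0 -lt0n.
rewrite etaE in HT.
have T0 : (0 < size T)%N by rewrite sT.
have Tnear : near_on d L eta (@frequency R d A A cA cA T) (valuation cA cA xi).
  by move=> c1 c2 i1 i2; apply: HT; apply: event2_regional.
have Tmis := HT _ (mismatch_regional (site0_inside d nF tests)).
have Snear : \forall k \near U, forall u, u \in tests ->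
    `|@frequency R d A bool cA bool_coding (S k) u.1.1 [::]
      - valuation cA bool_coding lambda u.1.1 [::]| <= eta.
  elim: (tests) => [|u s IHs]; first by apply: nearW.
  have Hu : \forall k \near U, `|@frequency R d A bool cA bool_coding (S k) u.1.1 [::]
      - valuation cA bool_coding lambda u.1.1 [::]| <= eta.
    have := lamE' u.1.1 [::] => /cvgr_distC_le; exact.
  apply: filterS2 Hu IHs => k Hu Hs v; rewrite in_cons => /orP[/eqP->//|].
  exact: Hs.
have TU : U [set k | T \in Us k].
  apply: filterS (eventually_ge ooU (enc T).+1) => k /= kT.
  by apply/mapP; exists (enc T); rewrite ?encK // mem_iota.
have [k [/= Sk Tk]] := @filter_ex _ U _ _ (@filterI _ U _ _ _ Snear TU).
have [_ _ /(_ T Tk)/negP] := HS k; apply.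
apply/(coupling_samplesE R) => //; split => //.
apply: (approx_coupling_near (ltW eta0) _ Sk Tnear Tmis (xiE tests)).
rewrite mulrAC -natrM ler_pdivrMr ?ltr0n // mul1r ler_nat.
by rewrite leqW // leq_mul.
Qed.

End Compactness.

(** * A covering lemma *)

Section Covering.
Variable d : nat.
Implicit Types (k l : site d) (J D : seq (site d)).

Definition cube k n : pred (site d) :=
  fun l => [forall i, `|l ord0 i - k ord0 i| <= n%:Z].

Definition box n : seq (site d) := [seq box_site j | j : 'rV['I_(n.*2.+1)]_d].

Lemma size_box n : size (box n) = (n.*2.+1 ^ d)%N.
Proof. by rewrite size_map -cardE card_mx card_ord mul1n. Qed.

Lemma box_site_inj n : injective (@box_site d n).
Proof.
move=> j j' /rowP jj; apply/rowP => i; apply: val_inj.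
by have := jj i; rewrite !mxE => /addIr [].
Qed.

Lemma uniq_box n : uniq (box n).
Proof. by rewrite map_inj_uniq ?enum_uniq //; apply: box_site_inj. Qed.

Lemma mem_box n l : (l \in box n) = cube 0 n l.
Proof.
apply/mapP/forallP => [[j _ ->] i|nl].
  rewrite !mxE subr0 ler_norml; move: (ltn_ord (j ord0 i)); move: (nat_of_ord
    (j ord0 i)) => v vn; apply/andP; split; lia.
have H i : (absz (l ord0 i + n%:Z)%R < n.*2.+1)%N.
  by have := nl i; rewrite mxE subr0 ler_norml; lia.
exists (\row_i Ordinal (H i)); first by rewrite mem_enum.
apply/rowP => i; rewrite !mxE /=; have := nl i; rewrite mxE subr0 ler_norml;
  rewrite -[l 0 i]/(l ord0 i); move: (l ord0 i) => a; lia.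
Qed.

Lemma cube_shift k n l : cube k n l = cube 0 n (l - k).
Proof. by apply: eq_forallb => i; rewrite !mxE subr0. Qed.

Lemma count_cube k n D : uniq D -> (count (cube k n) D <= n.*2.+1 ^ d)%N.
Proof.
move=> uD; rewrite -size_filter -size_box.
rewrite -(size_map (fun l => l - k)); apply: uniq_leq_size.
  by rewrite map_inj_uniq ?filter_uniq // => l l' /addIr.
move=> _ /mapP[l + ->]; rewrite mem_filter => /andP[kl _].
by rewrite mem_box -cube_shift.
Qed.

Lemma cube_disjoint k0 n0 k n l : (n <= n0)%N -> cube k0 n0 l -> cube k n l ->
  cube k0 n0.*2 k.
Proof.
move=> nn /forallP k0l /forallP kl; apply/forallP => i.
have := k0l i; have := kl i; rewrite !ler_norml; lia.
Qed.

Variable R : realType.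

Lemma exists_max (T : eqType) (r : T -> nat) (s : seq T) : (0 < size s)%N ->
  exists2 x, x \in s & forall y, y \in s -> (r y <= r x)%N.
Proof.
elim: s => // a [|b s] IHs _; first by exists a => [|y]; rewrite mem_seq1 // =>
  /eqP->.
have [x xs xmax] := IHs isT.
have [ax|xa] := leqP (r a) (r x).
  exists x; first by rewrite in_cons xs orbT.
  by move=> y; rewrite in_cons => /orP[/eqP->//|/xmax].
exists a; first exact: mem_head.
by move=> y; rewrite in_cons => /orP[/eqP->//|/xmax /leq_trans -> //]; apply: ltnW.
Qed.

(** The Vitali covering argument, by induction on J. Let k0 in J be a centre of
    maximal radius r0. The centres in the cube of radius 2 r0 around k0 are at
    most (4 r0 + 1)^d <= 2^d (2 r0 + 1)^d in number, and the cube of radius r0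
    contains at least t (2 r0 + 1)^d points of D. Both are discarded; the
    remaining centres have cubes disjoint from that of k0, hence lose no point
    of D. *)
Lemma vitali (t : R) (r : site d -> nat) J D : 0 <= t -> uniq J -> uniq D ->
  (forall k, k \in J ->
    t * ((r k).*2.+1 ^ d)%:R <= (count (cube k (r k)) D)%:R) ->
  t * (size J)%:R <= (2 ^ d * size D)%:R.
Proof.
move=> t0; have [n] := ubnP (size J); elim: n J D => // n IHn J D.
case: (posnP (size J)) => [/size0nil -> *|J0 Jn uJ uD HJ].
  by rewrite mulr0 ler0n.
have [k0 k0J k0max] := exists_max r J0.
pose r0 := r k0.
pose J1 := seq.filter (cube k0 r0.*2) J.
pose J2 := seq.filter (predC (cube k0 r0.*2)) J.
pose D1 := seq.filter (cube k0 r0) D.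
pose D2 := seq.filter (predC (cube k0 r0)) D.
have sJ : (size J = size J1 + size J2)%N by rewrite !size_filter count_predC.
have sD : (size D = size D1 + size D2)%N by rewrite !size_filter count_predC.
have J2n : (size J2 < n)%N.
  have J10 : (0 < size J1)%N.
    rewrite size_filter -has_count; apply/hasP; exists k0 => //.
    by apply/forallP => i; rewrite subrr normr0.
  by lia.
have H2 : t * (size J2)%:R <= (2 ^ d * size D2)%:R.
  apply: IHn; rewrite ?filter_uniq // => k.
  rewrite mem_filter => /andP[/= k0k kJ]; rewrite (le_trans (HJ k kJ)) // ler_nat.
  rewrite count_filter; apply: sub_count => l /= kl; rewrite kl /=.
  apply/negP => k0l; move: k0k => /negP; apply.
  exact: cube_disjoint (k0max k kJ) k0l kl.
have H1 : t * (size J1)%:R <= (2 ^ d * size D1)%:R.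
  have J1le : (size J1 <= 2 ^ d * (r0.*2.+1 ^ d))%N.
    rewrite -expnMn (leq_trans _ (_ : r0.*2.*2.+1 ^ d <= _)%N) //.
      by rewrite size_filter count_cube.
    by have [->|d0] := posnP d; rewrite ?expn0 ?leq_exp2r //; lia.
  rewrite (le_trans (ler_wpM2l t0 (_ : _ <= (2 ^ d * r0.*2.+1 ^ d)%:R))) ?ler_nat //.
  rewrite !natrM mulrCA ler_wpM2l ?ler0n // size_filter.
  exact: HJ.
by rewrite sJ sD mulnDr !natrD mulrDr lerD.
Qed.

End Covering.

(** * Besicovitch distance and mismatch at the origin *)

Section Integrals.
Variables (dT : measure_display) (T : measurableType dT) (R : realType).
Variable P : probability T R.

Lemma integral_card (I : finType) (E : I -> set T) :
  (forall i, measurable (E i)) ->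
  measurable_fun setT ((fun z => (#|[pred i | `[<E i z>]]|%:R)%:E) : T -> \bar R) /\
  (\int[P]_z (#|[pred i | `[<E i z>]]|%:R)%:E = \sum_i P (E i))%E.
Proof.
move=> mE.
have cardE z : (#|[pred i | `[<E i z>]]|%:R : R)%:E = (\sum_i (\1_(E i) z : R)%:E)%E.
  rewrite sumEFin -sum1_card natr_sum big_mkcond /=; congr (_%:E).
  apply: eq_bigr => i _; rewrite indicE -[z \in E i]/(`[<E i z>]) inE.
  by case: `[<E i z>].
have mi i : measurable_fun setT ((fun z => (\1_(E i) z)%:E) : T -> \bar R).
  by apply/measurable_EFinP; apply: measurable_indic.
rewrite (funext cardE); split; first exact: emeasurable_sum.
rewrite ge0_integral_sum //.
by apply: eq_bigr => i _; rewrite integral_indic // setIT.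
Qed.

(** The integral of the number of events that occur is the sum of their
    probabilities. *)
Lemma sum_le_of_card (I J : finType) (E : I -> set T) (F : J -> set T) (a b : R) :
  (forall i, measurable (E i)) -> (forall j, measurable (F j)) ->
  0 <= a -> 0 <= b ->
  (forall z, a * #|[pred i | `[<E i z>]]|%:R <= b * #|[pred j | `[<F j z>]]|%:R) ->
  (a%:E * \sum_i P (E i) <= b%:E * \sum_j P (F j))%E.
Proof.
move=> mE mF a0 b0 EF.
have [m1 <-] := integral_card mE; have [m2 <-] := integral_card mF.
rewrite -!ge0_integralZl_EFin //; try by move=> z _; rewrite lee_fin.
apply: ge0_le_integral => //.
- by move=> z _; rewrite mule_ge0 // lee_fin.
- by apply: emeasurable_funM.
- by apply: emeasurable_funM.
- by move=> z _; rewrite -!EFinM lee_fin.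
Qed.

End Integrals.

Section Hamming.
Variables (R : realType) (d : nat) (A : alphabetType).
Variable xi : probability (borel (config d (A * A)%type)) R.
Hypothesis inv : shift_invariant xi.
Local Notation X := (config d (A * A)%type).

Definition mismatch_at (k : site d) : set X := [set z | (z k).1 != (z k).2].

Lemma mismatch_at_cylinder k : cylinder (mismatch_at k).
Proof. by exists [:: k] => x y xy; rewrite /mismatch_at /= xy ?mem_head. Qed.

Lemma mismatch_at_borel k : measurable (mismatch_at k : set (borel X)).
Proof. exact: cylinder_borel (mismatch_at_cylinder k). Qed.

Definition rate : R := fine (xi (@mismatch d A)).

Lemma mismatch_at_shift k l : mismatch_at (k + l) = shift_config k @^-1`
  mismatch_at l.
Proof. by []. Qed.

Lemma mismatch_atE k : xi (mismatch_at k) = rate%:E.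
Proof.
rewrite -[k]addr0 mismatch_at_shift inv ?fineK //; last exact: mismatch_at_borel.
by rewrite fin_num_measure //; apply: mismatch_at_borel.
Qed.

Lemma rate01 : 0 <= rate <= 1.
Proof.
rewrite -!lee_fin -(mismatch_atE 0) measure_ge0 /=.
by apply: probability_le1; apply: mismatch_at_borel.
Qed.

Definition density n (z : X) : R :=
  #|[pred j : 'rV['I_(n.*2.+1)]_d |
      proj1c z (box_site j) != proj2c z (box_site j) :> A]|%:R
     / (n.*2.+1 ^ d)%:R.

Lemma box_size_gt0 n : 0 < (n.*2.+1 ^ d)%:R :> R.
Proof. by rewrite ltr0n expn_gt0. Qed.

Lemma density01 n z : 0 <= density n z <= 1.
Proof.
rewrite divr_ge0 ?ler0n //= ler_pdivrMr ?box_size_gt0 // mul1r ler_nat.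
by rewrite (leq_trans (max_card _)) // card_mx card_ord mul1n.
Qed.

Lemma densityE n z : (density n z)%:E = ((n.*2.+1 ^ d)%:R^-1%:E *
  (#|[pred j : 'rV['I_(n.*2.+1)]_d | `[<mismatch_at (box_site j) z>]]|%:R)%:E)%E.
Proof.
rewrite /density mulrC EFinM; congr (_ * (_%:R)%:E)%E; apply: eq_card => j.
by rewrite !inE /mismatch_at /= asboolb.
Qed.

Lemma density_measurable n :
  measurable_fun setT ((fun z => (density n z)%:E) : borel X -> \bar R).
Proof.
rewrite (funext (densityE n)); apply: emeasurable_funM => //.
by have [] := integral_card xi (fun j : 'rV['I_(n.*2.+1)]_d =>
  mismatch_at_borel (box_site j)).
Qed.

(** By invariance, each site of the box contributes the rate. *)
Lemma integral_density n : (\int[xi]_z (density n z)%:E = rate%:E)%E.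
Proof.
rewrite (funext (densityE n)).
have [m E] := integral_card xi (fun j : 'rV['I_(n.*2.+1)]_d =>
  mismatch_at_borel (box_site j)).
rewrite ge0_integralZl_EFin //.
rewrite E (eq_bigr (fun=> rate%:E)) => [|j _]; last exact: mismatch_atE.
rewrite sumEFin sumr_const card_mx card_ord mul1n -EFinM -[rate *+ _]mulr_natl mulrA.
by rewrite mulVf ?mul1r // lt0r_neq0 // box_size_gt0.
Qed.

Local Notation ham z := (limn_esup (fun n => (density n z)%:E)).

Lemma hamming_measurable :
  measurable_fun setT ((fun z => ham z) : borel X -> \bar R).
Proof.
by apply: measurable_fun_limn_esup => n; apply: density_measurable.
Qed.

Lemma limn_esup_le (u : nat -> \bar R) C : (forall n, u n <= C)%E ->
  (limn_esup u <= C)%E.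
Proof.
move=> uC; rewrite limn_esup_lim; apply: lime_le; first exact: is_cvg_esups.
by apply: nearW => n; apply: ge_ereal_sup => _ [m _ <-].
Qed.

Lemma limn_esup_ge (u : nat -> \bar R) C : (forall n, C <= u n)%E ->
  (C <= limn_esup u)%E.
Proof.
move=> uC; rewrite limn_esup_lim; apply: lime_ge; first exact: is_cvg_esups.
by apply: nearW => n; apply: (le_trans (uC n)); apply: ereal_sup_ubound; exists
  n => //=.
Qed.

Lemma ham01 z : (0 <= ham z <= 1)%E.
Proof.
apply/andP; split; [apply: limn_esup_ge|apply: limn_esup_le] => n;
by rewrite lee_fin; have /andP[] := density01 n z.
Qed.

(** The densities have the rate as expectation for each n and are at most 1, so
    Fatou's lemma applies to their differences from 1; it bounds the rate by
    the integral of the upper limit of the densities. *)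
Lemma rate_le_integral : (rate%:E <= \int[xi]_z ham z)%E.
Proof.
pose f n z : \bar R := (1 - (density n z)%:E)%E.
have mf n : measurable_fun setT (f n : borel X -> \bar R).
  by apply: emeasurable_funB => //; apply: density_measurable.
have f0 n z : [set: borel X] z -> (0 <= f n z)%E.
  by move=> _; rewrite /f -EFinB lee_fin subr_ge0; have /andP[] := density01 n z.
have Hf := fatou xi measurableT mf f0.
have fE n : (\int[xi]_z f n z = (1 - rate)%:E)%E.
  have : (\int[xi]_z ((density n z)%:E + f n z) = 1)%E.
    rewrite (eq_integral (cst 1%E)) => [|z _].
      by rewrite integral_cst // mul1e; apply: probability_setT.
    by rewrite /f -EFinB -EFinD subrKC.
  rewrite ge0_integralD //; last 2 first.
  - exact: density_measurable.
  - by move=> z; apply: f0.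
    rewrite integral_density => H; by rewrite EFinB -H addeAC subee // add0e.
  by move=> z _; rewrite lee_fin; have /andP[] := density01 n z.
have fh z : limn_einf (fun n => f n z) = (1 - ham z)%E.
  by rewrite (@limn_einf_shift R (fun n => - (density n z)%:E)%E 1%E) // limn_einfN.
have H : (\int[xi]_z (1 - ham z) <= (1 - rate)%:E)%E.
  have E1 : (\int[xi]_z (1 - ham z) = \int[xi]_z limn_einf (fun n => f n z))%E.
    by apply: eq_integral => z _; rewrite fh.
  have E2 : limn_einf (fun n => (\int[xi]_z f n z)%E) = (1 - rate)%:E.
    by rewrite (funext fE) is_cvg_limn_einfE; [apply: lim_cst|apply: is_cvg_cst].
  by rewrite E1 -E2; apply: Hf.
have : (\int[xi]_z (ham z + (1 - ham z)) = 1)%E.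
  rewrite (eq_integral (cst 1%E)) => [|z _].
    by rewrite integral_cst // mul1e; apply: probability_setT.
  have /andP[h0 h1] := ham01 z.
  by rewrite /= addeC subeK // fin_numE gt_eqF ?lt_eqF //;
    [apply: le_lt_trans h1 _; apply: ltry | apply: lt_le_trans h0; apply: ltNyr].
rewrite ge0_integralD //.
- move=> I1; rewrite -(@leeD2rE _ (1 - rate)%:E) //.
  rewrite -EFinD addrC subrK -I1; exact: leeD2l.
- by move=> z _; have /andP[] := ham01 z.
- exact: hamming_measurable.
- move=> z _; move: (ham01 z); case: (ham z) => [r| |] //=.
    by rewrite -EFinB !lee_fin subr_ge0 => /andP[].
  by rewrite leye_eq andbF.
- apply: (@emeasurable_funB _ _ _ setT (cst 1%E) (fun z : borel X => ham z)) => //.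
  exact: hamming_measurable.
Qed.

(** Only boxes of radius up to N are considered, which makes this set a
    cylinder and the covering argument finite. *)
Definition exceeding (t : R) N : set X := [set z | exists2 n, (n <= N)%N & t <
  density n z].

Lemma exceeding_cylinder t N : cylinder (exceeding t N).
Proof.
exists (flatten [seq box d n | n <- iota 0 N.+1]) => x y xy [n nN tn].
exists n => //; rewrite (_ : density n y = density n x) //.
rewrite /density; congr (_%:R / _); apply: eq_card => j; rewrite !inE.
rewrite /proj1c /proj2c xy //; apply/flattenP; exists (box d n).
  by apply: map_f; rewrite mem_iota.
by apply: map_f; rewrite mem_enum.
Qed.

Lemma card_box (P : pred (site d)) n :
  #|[pred j : 'rV['I_(n.*2.+1)]_d | P (box_site j)]| = count P (box d n).
Proof.
by rewrite -sum1_card -sum1_count big_map big_enum_cond; apply: eq_bigl.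
Qed.

(** The sites of the box of radius N around which the density of mismatches
    exceeds t in some box of radius at most N are the centres of [vitali]. All
    these boxes are contained in the box of radius 2 N. *)
Lemma exceeding_count t N z : 0 <= t ->
  t * #|[pred j : 'rV['I_(N.*2.+1)]_d |
         `[<(shift_config (box_site j) @^-1` exceeding t N) z>]]|%:R
  <= (2 ^ d)%:R * #|[pred j : 'rV['I_(N.*2.*2.+1)]_d | `[<mismatch_at (box_site
    j) z>]]|%:R.
Proof.
move=> t0.
pose J := [seq k <- box d N | `[<exceeding t N (shift_config k z)>]].
pose D := [seq k <- box d N.*2 | `[<mismatch_at k z>]].
rewrite (card_box (fun k => `[<exceeding t N (shift_config k z)>])).
rewrite (card_box (fun k => `[<mismatch_at k z>])).
rewrite -!size_filter -/J -/D -natrM.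
have rP k : exists n, k \in J -> (n <= N)%N /\ t < density n (shift_config k z).
  have [kJ|kJ] := boolP (k \in J); last by exists 0%N.
  move: kJ; rewrite mem_filter => /andP[/asboolP[n nN tn] _].
  by exists n.
have [r rH] := choice rP.
apply: (@vitali d R t r) => //; try by rewrite filter_uniq // uniq_box.
move=> k kJ; have [nN tn] := rH k kJ.
set n := r k in nN tn *.
have : t * (n.*2.+1 ^ d)%:R <= (count (fun l => `[<mismatch_at (k + l) z>])
  (box d n))%:R.
  rewrite -ler_pdivlMr ?box_size_gt0 // ltW //.
  rewrite -(card_box (fun l => `[<mismatch_at (k + l) z>])) (lt_le_trans tn) //.
  rewrite /density ler_wpM2r ?invr_ge0 ?ler0n // ler_nat subset_leq_card //.
  by apply/fintype.subsetP => j; rewrite !inE => kj; exact: kj.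
move/le_trans; apply; rewrite ler_nat -!size_filter.
rewrite -(size_map (fun l => k + l)); apply: uniq_leq_size.
  by rewrite map_inj_uniq ?filter_uniq ?uniq_box // => l l' /addrI.
move=> _ /mapP[l + ->]; rewrite !mem_filter => /andP[kl ln].
rewrite kl /= cube_shift addrC addKr -mem_box ln /= mem_box.
move: kJ; rewrite mem_filter mem_box => /andP[_ /forallP kN].
move: ln; rewrite mem_box => /forallP ln.
apply/forallP => i; have := kN i; have := ln i; rewrite !mxE !ler_norml.
move: (l ord0 i) (k ord0 i) => a b; lia.
Qed.

(** Integrating [exceeding_count], the left side becomes t (2 N + 1)^d
    xi([exceeding] t N), and the right side is 2^d (4 N + 1)^d times the rate,
    with 4 N + 1 <= 2 (2 N + 1). *)
Lemma maximal_inequality t N : 0 < t ->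
  (xi (exceeding t N) <= ((4 ^ d)%:R * rate / t)%:E)%E.
Proof.
move=> t0.
have mE k : measurable (shift_config k @^-1` exceeding t N : set (borel X)).
  exact: cylinder_borel (shift_cylinder _ (exceeding_cylinder t N)).
have := sum_le_of_card xi (fun j : 'rV['I_(N.*2.+1)]_d => mE (box_site j))
  (fun j : 'rV['I_(N.*2.*2.+1)]_d => mismatch_at_borel (box_site j))
  (ltW t0) (ler0n _ (2 ^ d)) (fun z => exceeding_count N z (ltW t0)).
rewrite (eq_bigr (fun=> xi (exceeding t N))) => [|j _]; last first.
  exact: inv (cylinder_borel (exceeding_cylinder t N)).
rewrite [X in (_ <= _ * X)%E](eq_bigr (fun=> rate%:E)) => [|j _]; last exact:
  mismatch_atE.
have -> : xi (exceeding t N) = (fine (xi (exceeding t N)))%:E.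
  rewrite fineK // fin_num_measure //.
  exact: cylinder_borel (exceeding_cylinder t N).
rewrite !sumEFin !sumr_const !card_mx !card_ord !mul1n -!EFinM !lee_fin.
set x := fine _.
rewrite -[x *+ _]mulr_natl -[rate *+ _]mulr_natl => H.
have /andP[rate0 _] := rate01.
rewrite ler_pdivlMr // -(ler_pM2l (box_size_gt0 N)).
rewrite [x * t]mulrC mulrCA (le_trans H) // !mulrA ler_wpM2r //.
rewrite -!natrM ler_nat.
rewrite -!expnMn; have [->|d0] := posnP d; first by rewrite !expn0.
rewrite leq_exp2r //; lia.
Qed.

(** The upper limit of the densities is at most t outside of the union of the
    sets [exceeding] t N, and at most 1 everywhere. *)
Lemma integral_hamming_le t : 0 < t ->
  (\int[xi]_z ham z <= (t + (4 ^ d)%:R * rate / t)%:E)%E.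
Proof.
move=> t0; pose E : set (borel X) := \bigcup_N exceeding t N.
have mEN N : measurable (exceeding t N : set (borel X)).
  exact: cylinder_borel (exceeding_cylinder t N).
have mE : measurable E by apply: bigcupT_measurable.
have E_le : (xi E <= ((4 ^ d)%:R * rate / t)%:E)%E.
  have ndE : nondecreasing_seq (exceeding t : nat -> set (borel X)).
    move=> m n mn; apply/subsetPset => z [k km tk]; exists k => //.
    exact: leq_trans mn.
  have cv := nondecreasing_cvg_mu mEN mE ndE (mu := xi).
  rewrite -(cvg_lim _ cv) //; apply: lime_le; first by apply/cvg_ex; exists (xi E).
  by apply: nearW => N /=; apply: maximal_inequality.
have hle z : (ham z <= t%:E + (\1_E z)%:E)%E.
  have [zE|zE] := pselect (E z).
    rewrite indicE mem_set //; have /andP[_ h1] := ham01 z.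
    by rewrite (le_trans h1) // -EFinD lee_fin lerDr ltW.
  rewrite indicE memNset // adde0; apply: limn_esup_le => n.
  rewrite lee_fin leNgt; apply/negP => tn; apply: zE.
  by exists n => //; exists n.
apply: (@le_trans _ _ (\int[xi]_z (t%:E + (\1_E z)%:E))%E).
  apply: ge0_le_integral => //.
  - by move=> z _; have /andP[] := ham01 z.
  - exact: hamming_measurable.
  - by apply: emeasurable_funD => //; apply/measurable_EFinP; apply: measurable_indic.
rewrite ge0_integralD //; last 2 first.
- by move=> z _; rewrite lee_fin ltW.
- by apply/measurable_EFinP; apply: measurable_indic.
have -> : (\int[xi]_z t%:E = t%:E)%E.
  rewrite integral_cst // -[RHS]mule1; congr (_ * _)%E.
  exact: probability_setT.
by rewrite integral_indic // setIT EFinD leeD2l.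
Qed.

End Hamming.

(** * Stability through mismatch rates *)

Section Stability.
Variables (R : realType) (d : nat) (A : alphabetType) (cA : coding A).
Variable F : seq (pattern d A).
Local Notation nF := (coded_patterns cA F).
Local Notation M := (invariant_measures F : set (probability (borel (config d A)) R)).

Lemma proj1_event c : @proj1c d A bool @^-1` event cA c = event2 cA bool_coding
  c [::].
Proof. by apply/seteqP; split => z; rewrite /event2 /= andbT. Qed.

Lemma approx_coupling_of_coupling (lambda : probability (borel (config d (A *
  bool)%type)) R)
    mu nu xi delta :
  has_image lambda (@proj1c d A bool) mu -> M nu -> coupling mu nu xi ->
  fine (xi (@mismatch d A)) <= delta ->
  forall tests, approx_coupling d nF delta (@nonpositive R) tests
    (valuation cA bool_coding lambda) (valuation cA cA xi)
    (fine (xi (@mismatch d A))).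
Proof.
move=> lmu [nuinv nufull] [xinv xmu xnu] xd tests.
have mev c : measurable (event cA c : set (borel (config d A))).
  by apply: cylinder_borel; apply: eventb_cylinder.
split => [|u _|w /mapP[p pF ->]|].
- by move: xinv => /(shift_invariantP cA cA).
- apply/nonpositive_dist; rewrite /valuation -proj1_event.
  have -> : event2 cA cA u.1.1 [::] = @proj1c d A A @^-1` event cA u.1.1.
    by apply/seteqP; split => z; rewrite /event2 /= andbT.
  have := xmu _ (mev u.1.1); rewrite -(lmu _ (mev u.1.1)) /pushforward => ->.
  by [].
- have /(SFT_full _ nuinv) := nufull => /(_ p pF) nu0.
  have mel : measurable (elementary (val p) : set (borel (config d A))).
    by apply: cylinder_borel; apply: elementary_cylinder.
  rewrite /nonpositive /= /valuation.
  have -> : event2 cA cA [::] (coded cA (val p)) =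
      @proj2c d A A @^-1` elementary (val p).
    apply/seteqP; split => z; rewrite /event2 /=; first by move/eventb_coded.
    by move=> ze; apply/eventb_coded.
  by have := xnu _ mel; rewrite nu0 /pushforward => ->.
- by rewrite /nonpositive /= subr_le0.
Qed.

Lemma besicovitch_set_lt mu (b : \bar R) : (besicovitch_set mu M < b)%E ->
  exists nu xi, [/\ M nu, coupling mu nu xi &
    (\int[xi]_z hamming R (proj1c z) (proj2c z) < b)%E].
Proof.
move=> /ereal_inf_lt[_ [nu Mnu <-]] /ereal_inf_lt[_ [xi cxi <-]] lt.
by exists nu, xi.
Qed.

Lemma couplable_of_bound j e :
  (forall mu, noisy_marginals F (e.+1%:R^-1 : R) mu ->
    exists nu xi, [/\ M nu, coupling mu nu xi &
      fine (xi (@mismatch d A)) <= j.+1%:R^-1]) ->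
  couplable R cA F j e.
Proof.
move=> H lambda nl.
have [mu muE] := image_probability (@proj1c_cylinder d A bool) lambda.
have lmu : has_image lambda (@proj1c d A bool) mu by move=> V _; rewrite muE.
have [|nu [xi [Mnu cxi xile]]] := H mu; first by exists lambda.
by exists xi; apply: approx_coupling_of_coupling lmu Mnu cxi xile.
Qed.

(** By continuity of the modulus at 0, the distances for noise of small level
    are smaller than 1/(j+1), and so is the integral of d_H for some coupling,
    which bounds its rate. For j = 0 every rate is sufficient, and a coupling
    exists for noise of level 1 because the distance is finite. *)
Lemma couplable_of_stable : stable R F ->
  forall j, exists e, (j = 0%N -> e = 0%N) /\ couplable R cA F j e.
Proof.
move=> [f [fmono fge0 f0 fcont fsup]].
have bound eps mu : 0 <= eps <= 1 -> noisy_marginals F eps mu ->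
    (besicovitch_set mu M <= (f eps)%:E)%E.
  move=> eps01 nmu; apply: le_trans (fsup eps eps01).
  by apply: ereal_sup_ubound; exists mu.
case=> [|j].
  exists 0%N; split => //; apply: couplable_of_bound => mu nmu.
  have := bound 1 mu; rewrite ler01 lexx => /(_ isT).
  move: nmu; rewrite invr1 => nmu /(_ nmu) b1.
  have [nu [xi [Mnu cxi _]]] := besicovitch_set_lt (le_lt_trans b1 (ltry _)).
  exists nu, xi; split => //.
  have [xinv _ _] := cxi.
  by have /andP[] := rate01 xinv.
pose delta : R := j.+2%:R^-1.
have delta0 : 0 < delta by rewrite invr_gt0.
have [e fe] : exists e, f e.+1%:R^-1 < delta.
  have : \forall x \near within `[0, 1] (nbhs (0 : R)), f x < delta.
    by apply: (cvgr_lt _ fcont); rewrite f0.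
  rewrite /within /= => -[r /= r0 Hr].
  pose e := Num.trunc r^-1.
  have er : e.+1%:R^-1 < r by rewrite -[r]invrK ltf_pV2 ?posrE ?invr_gt0 //
    truncnS_gt.
  exists e; apply: Hr.
    by rewrite /= sub0r normrN ger0_norm ?invr_ge0.
  by rewrite /= in_itv; apply: invS01.
exists e; split => //; apply: couplable_of_bound => mu nmu.
have [|nu [xi [Mnu cxi lt]]] := @besicovitch_set_lt mu delta%:E.
  by apply: le_lt_trans (bound _ mu (invS01 R e) nmu) _; rewrite lte_fin.
exists nu, xi; split => //.
have [xinv _ _] := cxi.
by rewrite -lee_fin; apply: ltW; apply: le_lt_trans (rate_le_integral xinv) _.
Qed.

(** The measure on the subshift is the second marginal of xi. The first one is
    mu because both have the same values on events. *)
Lemma coupling_of_approx (lambda : probability (borel (config d (A * bool)%type)) R)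
    mu (xi : probability (borel (config d (A * A)%type)) R) delta :
  has_image lambda (@proj1c d A bool) mu ->
  (forall tests, approx_coupling d nF delta (@nonpositive R) tests
    (valuation cA bool_coding lambda) (valuation cA cA xi)
    (fine (xi (@mismatch d A)))) ->
  fine (xi (@mismatch d A)) <= delta /\
  exists nu, M nu /\ coupling mu nu xi.
Proof.
move=> lmu H.
have inv : shift_invariant xi.
  by apply/(shift_invariantP cA cA) => tests; have [] := H tests.
split; first by have [_ _ _] := H [::]; rewrite /nonpositive /= subr_le0.
have [nu nuE] := image_probability (@proj2c_cylinder d A A) xi.
have [mu' muE'] := image_probability (@proj1c_cylinder d A A) xi.
have nuinv : shift_invariant nu.
  move=> k B mB; rewrite !nuE.
  exact: inv k _ (preimage_borel (@proj2c_cylinder d A A) mB).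
exists nu; split.
  split => //; apply/(SFT_full _ nuinv) => w wF; rewrite nuE.
  have -> : @proj2c d A A @^-1` elementary (val w) = event2 cA cA [::] (coded
    cA (val w)).
    apply/seteqP; split => z; rewrite /event2 /=; last by move/eventb_coded.
    by move=> ze; apply/eventb_coded.
  rewrite valuationE; congr (_%:E); apply/eqP; rewrite eq_le.
  have [_ _ + _] := H [::] => /(_ (coded cA (val w)) (map_f _ wF)) => -> /=.
  by have /andP[] := valuation01 cA cA xi [::] (coded cA (val w)).
split => //; last by move=> V _; rewrite nuE.
move=> V mV; rewrite -[LHS]muE'; apply: (event_eq (cA := cA)) => // c.
have mev : measurable (event cA c : set (borel (config d A))).
  by apply: cylinder_borel; apply: eventb_cylinder.
rewrite muE' -(lmu _ mev) /pushforward proj1_event.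
have -> : @proj1c d A A @^-1` event cA c = event2 cA cA c [::].
  by apply/seteqP; split => z; rewrite /event2 /= andbT.
rewrite !valuationE; congr (_%:E).
have [_ + _ _] := H [:: (c, [::], [::])] => /(_ (c, [::], [::])).
by rewrite mem_head => /(_ isT) /nonpositive_dist.
Qed.

Lemma integral_hamming_le1 (xi : probability (borel (config d (A * A)%type)) R) :
  (\int[xi]_z hamming R (proj1c z) (proj2c z) <= 1)%E.
Proof.
apply: (@le_trans _ _ (\int[xi]_z cst 1%E z)%E).
  apply: ge0_le_integral => //.
  - by move=> z _; have /andP[] := ham01 R z.
  - exact: hamming_measurable.
  - by move=> z _; have /andP[] := ham01 R z.
by rewrite integral_cst // mul1e; apply: probability_le1.
Qed.

Lemma noisy_marginals_sub (x y : R) : x <= y ->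
  noisy_marginals F x `<=` noisy_marginals F y.
Proof.
move=> xy mu [lambda [inv [p /andP[p0 px] iid]] lmu]; exists lambda => //.
by split => //; exists p => //; rewrite p0 (le_trans px).
Qed.

Lemma besicovitch_set_le j e (x : R) mu : couplable R cA F j e ->
  x <= e.+1%:R^-1 -> noisy_marginals F x mu ->
  (besicovitch_set mu M <= 1)%E /\
  forall t, 0 < t -> (besicovitch_set mu M <= (t + (4 ^ d)%:R / j.+1%:R / t)%:E)%E.
Proof.
move=> cpl xe /(noisy_marginals_sub xe)[lambda nl lmu].
have [xi Hxi] := cpl lambda nl.
have [rle [nu [Mnu cxi]]] := coupling_of_approx lmu Hxi.
have le_int : (besicovitch_set mu M <=
    \int[xi]_z hamming R (proj1c z) (proj2c z))%E.
  apply: (@le_trans _ _ (besicovitch mu nu)).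
    by apply: ereal_inf_lbound; exists nu.
  by apply: ereal_inf_lbound; exists xi.
split; first exact: le_trans le_int (integral_hamming_le1 xi).
move=> t t0; apply: (le_trans le_int).
have [xinv _ _] := cxi.
apply: le_trans (integral_hamming_le xinv t0) _.
by rewrite lee_fin lerD2l ler_pM2r ?invr_gt0 // ler_wpM2l.
Qed.

(** The smallest modulus is the supremum s of the distances. It is at most 1 by
    the case j = 0 and small near 0 by the other ones. The value 0 is added to
    the set whose supremum is taken, since the supremum of the empty set is
    -oo. *)
Lemma stable_of_couplable :
  (forall j, exists e, (j = 0%N -> e = 0%N) /\ couplable R cA F j e) -> stable R F.
Proof.
move=> H.
pose s x := ereal_sup (0%E |` [set besicovitch_set mu M | mu in noisy_marginals F x]).
have s_le (x : R) (b : \bar R) : (0 <= b)%E ->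
    (forall mu, noisy_marginals F x mu -> (besicovitch_set mu M <= b)%E) -> (s
      x <= b)%E.
  move=> b0 Hb; apply: ge_ereal_sup => _ [->//|[mu nmu <-]]; exact: Hb.
have s_ge0 x : (0 <= s x)%E by apply: ereal_sup_ubound; left.
have s_le1 (x : R) : x <= 1 -> (s x <= 1)%E.
  have [e [/(_ erefl) -> cpl]] := H 0%N.
  move=> x1; apply: s_le => // mu nmu.
  by have [|+ _] := besicovitch_set_le cpl _ nmu; rewrite ?invr1.
have s_fin (x : R) : x <= 1 -> s x = (fine (s x))%:E.
  by move=> x1; rewrite fineK // ge0_fin_numE // (le_lt_trans (s_le1 x x1)) ?ltry.
have s_mono x y : x <= y -> (s x <= s y)%E.
  move=> xy; apply: ereal_sup_le => _ [->|[mu nmu <-]]; first by left.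
  by right; exists mu => //; apply: noisy_marginals_sub nmu.
have s_small (delta : R) : 0 < delta -> exists e, forall x : R,
    x <= e.+1%:R^-1 -> (s x <= delta%:E)%E.
  move=> delta0; pose t := delta / 2.
  have t0 : 0 < t by rewrite divr_gt0.
  (* This j satisfies 4^d / (j+1) <= t^2, so that both terms of the bound on
     the distance are at most t = delta / 2. *)
  pose j := Num.trunc ((4 ^ d)%:R / t / t).
  have [e [_ cpl]] := H j; exists e => x xe; apply: s_le; first by rewrite
    lee_fin ltW.
  move=> mu nmu; have [_ /(_ t t0)] := besicovitch_set_le cpl xe nmu.
  move/le_trans; apply; rewrite lee_fin.
  have -> : delta = t + t by rewrite -mulrDl /t; field.
  rewrite lerD2l mulrAC ler_pdivrMr ?ltr0n // [t * _]mulrC -ler_pdivrMr //.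
  by rewrite ltW // truncnS_gt.
have s0 : fine (s 0) = 0.
  apply/eqP; rewrite eq_le fine_ge0 // andbT; apply/ler_addgt0Pl => delta delta0.
  have [e He] := s_small delta delta0.
  by rewrite addr0 -lee_fin -s_fin ?ler01 // He.
exists (fun x => fine (s x)); split => //.
- move=> x y; rewrite !in_itv /= => /andP[x0 x1] /andP[y0 y1] xy.
  by rewrite -lee_fin -!s_fin // s_mono.
- by move=> x /andP[x0 x1]; rewrite fine_ge0.
- rewrite s0; apply/cvgrPdist_le => delta delta0.
  have [e He] := s_small delta delta0.
  exists e.+1%:R^-1; first by rewrite /= invr_gt0.
  move=> x /=; rewrite !sub0r !normrN => xe; rewrite in_itv => /andP[/= x0 x1].
  rewrite ger0_norm ?fine_ge0 // -lee_fin -s_fin // He //.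
  by rewrite ltW // (le_lt_trans (ler_norm _)).
- move=> eps /andP[eps0 eps1]; rewrite -s_fin //.
  by apply: ereal_sup_le => _ [mu nmu <-]; right; exists mu.
Qed.

End Stability.

(** * Nonemptiness of the subshift *)

Section Nonempty.
Variables (R : realType) (d : nat) (A : alphabetType) (cA : coding A).
Variable F : seq (pattern d A).

Definition all_noise : config d (A * bool)%type := fun=> (point, true).

Definition all_noise_measure : probability (borel (config d (A * bool)%type)) R :=
  \d_(all_noise : borel (config d (A * bool)%type)).

Lemma all_noise_measureE B : all_noise_measure B = (`[<B all_noise>]%:R)%:E.
Proof. exact: (@diracE _ (borel (config d (A * bool)%type)) R all_noise B). Qed.

(** A forbidden pattern without noise does not occur if it involves at least
    one site, and a constant sequence of 1 is i.i.d. Bernoulli of parameter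
    1. *)
Lemma all_noise_noisy : (forall w, w \in F -> val w != [::]) ->
  noisy_measures F (0.+1%:R^-1 : R) all_noise_measure.
Proof.
move=> Fne.
have valE c1 c2 : valuation cA bool_coding all_noise_measure c1 c2 =
    (eventb cA c1 (proj1c all_noise) && eventb bool_coding c2 (proj2c all_noise))%:R.
  by rewrite /valuation all_noise_measureE /= /event2 /= asboolb.
have noise1 : eventb bool_coding noise_at0 (proj2c all_noise) by [].
apply/(noisy_measuresP cA _ _ (invS01 R 0)) => tests; split => [|_ /mapP[w wF
  ->]||u _ _].
- have inv : shift_invariant all_noise_measure.
    by move=> k B mB; rewrite !all_noise_measureE.
  by move: inv => /(shift_invariantP cA bool_coding).
- rewrite valE /nonpositive /=.
  rewrite (_ : eventb bool_coding _ _ = false) ?andbF //.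
  by move: (Fne w wF); rewrite /=; case: (sval w).
- by rewrite valE /= /nonpositive /= invr1 subrr.
- by rewrite !valE; apply/nonpositive_dist; rewrite /= mulr1.
Qed.

Lemma SFT_nonempty : (forall w, w \in F -> val w != [::]) ->
  couplable R cA F 0 0 -> SFT F !=set0.
Proof.
move=> Fne cpl; have [xi Hxi] := cpl _ (all_noise_noisy Fne).
have [mu muE] := image_probability (@proj1c_cylinder d A bool) all_noise_measure.
have lmu : has_image all_noise_measure (@proj1c d A bool) mu by move=> V _;
  rewrite muE.
have [_ [nu [[_ full] _]]] := coupling_of_approx lmu Hxi.
apply/set0P/eqP => S0; move: full; rewrite S0 measure0 => /esym/eqP.
by rewrite onee_eq0.
Qed.

Lemma SFT_patterns_nonempty : SFT F !=set0 -> forall w, w \in F -> val w != [::].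
Proof.
move=> [x xF] w wF; apply/eqP => w0.
by apply: (xF w wF 0) => e; rewrite w0.
Qed.

End Nonempty.

(** * Codes of families of patterns *)

Section Codes.
Variables (d q : nat).
Local Notation cA := (ord_coding q).
Implicit Types (w : pattern d 'I_q.+1) (F : seq (pattern d 'I_q.+1)).

Lemma enc_seq_nat (s : seq nat) : enc s = CodeSeq.code s.
Proof. congr CodeSeq.code; exact: map_id. Qed.

Lemma pattern_codeE w : pattern_code w = enc (coded cA (val w)).
Proof.
rewrite -[RHS]/(CodeSeq.code (map enc _)) -map_comp; congr CodeSeq.code.
by apply: eq_map => e /=; rewrite enc_seq_nat.
Qed.

Lemma dec_family_code F :
  dec (family_code F) = [:: d; q.+1; enc (coded_patterns cA F)] :> seq nat.
Proof.
rewrite -[RHS]encK enc_seq_nat; congr (dec (CodeSeq.code [:: _; _; _])).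
rewrite -[RHS]/(CodeSeq.code (map enc _)) -map_comp; congr CodeSeq.code.
by apply: eq_map => w; rewrite pattern_codeE.
Qed.

Lemma code_dim_family F : code_dim (family_code F) = d.
Proof. by rewrite /code_dim dec_family_code. Qed.

Lemma code_alphabet_family F : code_alphabet (family_code F) = q.+1.
Proof. by rewrite /code_alphabet dec_family_code. Qed.

Lemma code_patterns_family F : code_patterns (family_code F) = coded_patterns cA F.
Proof. by rewrite /code_patterns dec_family_code /= encK. Qed.

Definition valid_pattern (w : seq (seq nat)) := ~~ nilp w && all (fun e =>
  [&& size e == d.+1, head 0%N e < q.+1 &
    count (fun e' => enc (behead e') == enc (behead e)) w <= 1])%N w.

Lemma valid_coded w : val w != [::] -> valid_pattern (coded cA (val w)).
Proof.
move=> wne; rewrite /valid_pattern /nilp size_map size_eq0 wne /=.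
apply/allP => _ /mapP[e ew ->] /=; rewrite size_coords eqxx /= ltn_ord /=.
rewrite count_map (eq_count (a2 := fun c => c.1 == e.1)); last first.
  move=> c /=; apply/eqP/eqP => [|->//].
  by move=> /(can_inj (@encK _))/(can_inj (@coordsK d)).
have := valP w; rewrite -(count_map fst (pred1 e.1)) => uw.
by rewrite (count_uniq_mem _ uw) leq_b1.
Qed.

Lemma coded_of_valid (v : seq (seq nat)) : valid_pattern v ->
  exists w, val w != [::] /\ coded cA (val w) = v.
Proof.
move=> /andP[vne /allP vv].
pose s := [seq (site_of d (behead e), inord (head 0%N e) : 'I_q.+1) | e <- v].
have sz e : e \in v -> coords (site_of d (behead e)) = behead e.
  move=> /vv /and3P[/eqP es _ _]; rewrite coords_site_of.
  apply: (@eq_from_nth _ 0%N); rewrite size_mkseq ?size_behead ?es //.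
  by move=> i id; rewrite nth_mkseq.
have us : uniq (unzip1 s).
  rewrite /s /unzip1 -map_comp; apply: count_mem_uniq => k.
  have [kv|kv] := boolP (k \in _); last exact/count_memPn.
  apply/eqP; rewrite eqn_leq -has_count has_pred1 kv andbT.
  move: kv => /mapP[e ev ->]; rewrite count_map.
  have /and3P[_ _] := vv e ev; apply: leq_trans; rewrite leq_eqVlt; apply/orP; left.
  apply/eqP/eq_in_count => e' e'v /=; apply/eqP/eqP => [h|/(can_inj (@encK _))->//].
  by rewrite -(sz e' e'v) h sz.
exists (exist _ s us); split.
  by rewrite /= -size_eq0 size_map.
rewrite /coded /= /s -map_comp -[RHS]map_id; apply/eq_in_map => e ev /=.
rewrite sz // inordK; last by have /and3P[] := vv e ev.
by have /and3P[+ _ _] := vv e ev; case: e {ev}.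
Qed.

End Codes.

Lemma valid_codeP x : valid_code x <->
  exists d q (F : seq (pattern d 'I_q.+1)),
    [/\ (0 < d)%N, x = family_code F & forall w, w \in F -> val w != [::]].
Proof.
split; last first.
  move=> [d [q [F [d0 -> Fne]]]].
  rewrite /valid_code code_dim_family code_alphabet_family code_patterns_family.
  rewrite dec_family_code d0 /=; apply/allP => _ /mapP[w wF ->].
  exact: valid_coded (Fne w wF).
case/and4P => sx d0; rewrite /code_alphabet /code_dim /code_patterns in d0 *.
case Ex : (dec x : seq nat) sx d0 => [|d [|Q [|l []]]] //= _ d0.
case: Q Ex => // q Ex _ vF.
have : exists F : seq (pattern d 'I_q.+1),
    (forall w, w \in F -> val w != [::]) /\ coded_patterns (ord_coding q) F = dec l.
  elim: (dec l : seq (seq (seq nat))) vF => [_|v s IHs /= /andP[vv /IHs[F [Fne <-]]]].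
    by exists [::].
  have [w [wne <-]] := coded_of_valid vv.
  exists (w :: F); split => // w'; rewrite in_cons => /orP[/eqP->//|]; exact: Fne.
move=> [F [Fne EF]]; exists d, q, F; split => //.
apply: (can_inj (@decK (seq_encType nat_encType))).
by rewrite dec_family_code EF decK.
Qed.

(** * Stability as an alternation of four quantifiers *)

Lemma PstabP (R : realType) x : Pstab R x <->
  forall j, exists e, forall n, exists m, stability_predicate x j e n m.
Proof.
split.
  move=> [d [q [F [d0 -> ne st]]]] j.
  have [e [je cpl]] := couplable_of_stable (ord_coding q) st j.
  exists e => n.
  have [m cm] := certificate_of_couplable cpl n; exists m.
  rewrite /stability_predicate code_dim_family code_alphabet_family
    code_patterns_family.
  apply/and3P; split => //; last by apply/implyP => /eqP/je->.
  apply/valid_codeP; exists d, q, F; split => //.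
  exact: SFT_patterns_nonempty.
move=> H.
have [d [q [F [d0 xE Fne]]]] : exists d q (F : seq (pattern d 'I_q.+1)),
    [/\ (0 < d)%N, x = family_code F & forall w, w \in F -> val w != [::]].
  apply/valid_codeP; have [e /(_ 0%N)[m]] := H 0%N.
  by case/and3P.
have cpl j : exists e, (j = 0%N -> e = 0%N) /\ couplable R (ord_coding q) F j e.
  have [e He] := H j; exists e; split.
    by have [m /and3P[_ /implyP je _]] := He 0%N; move=> /eqP/je/eqP.
  apply: couplable_of_certificate => n; have [m] := He n.
  rewrite /stability_predicate xE code_dim_family code_alphabet_family
    code_patterns_family.
  by case/and3P => _ _ c; exists m.
exists d, q, F; split => //; last exact: stable_of_couplable cpl.
have [e [/(_ erefl) e0 c]] := cpl 0%N; rewrite e0 in c.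
exact: SFT_nonempty Fne c.
Qed.

Theorem theorem6p8 (R : realType) : in_Pi 4 (Pstab R).
Proof.
exists (fun v => stability_predicate (nth 0%N v 0) (nth 0%N v 1) (nth 0%N v 2)
  (nth 0%N v 3) (nth 0%N v 4)); split.
  exact: stability_predicate_decidable.
by move=> x; apply: PstabP.
Qed.
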